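(* Let $L_1,L_2,L_3$ be affine Lagrangian sections of $T^*\mathbb{R}$ with $L_i\cap L_j\neq\emptyset$ and $L_i\neq L_j$ for $i\neq j$. Let $f_1,f_2,f_3$ be functions on $\mathbb{R}$ with $L_i=\operatorname{graph}(df_i)$ for $i=1,2,3$, and let $x_i$ be the intersection point of $L_i$ and $L_{i+1}$ (indices mod $3$). Assume that there exists a triangle which has distinct vertices $x_1,x_2,x_3$ in counterclockwise order. Let $p_i$ be the unique critical point of $f_{i+1}-f_i$, let $I\in\mathcal{M}_g(\mathbb{R};\vec f,\vec p)$ be the (unique) gradient tree, and let $I_i:(-\infty,0]\to\mathbb{R}$ be its restriction to the external edge $e_i$ with external vertex $v_i$, $I(v_i)=p_i$. For $\epsilon>0$ put $L_i^\epsilon=\operatorname{graph}(\epsilon\,df_i)$ and let $x_i^\epsilon$ be the intersection point of $L_i^\epsilon$ and $L_{i+1}^\epsilon$. Set $z_1=1$, $z_2=\infty$, $z_3=0$, and let $w_\epsilon$ be the Schwarz--Christoffel map from the upper half plane to the bounded triangle $x_1^\epsilon x_2^\epsilon x_3^\epsilon$ such that $w_\epsilon(z_i)=x_i^\epsilon$ for $i=1,2,3$. Let $\delta>0$ be such that $D_{z_i}(\delta)\cap D_{z_j}(\delta)=\emptyset$ for $i\neq j$. Then $$\lim_{\epsilon\to+0}\ \sup_{z\in D(\delta)}|w_\epsilon(z)-p_0|=0,$$ $$\lim_{\epsilon\to+0}\ \sup_{(\tau,\sigma)\in\Theta_{ext}}|w_\epsilon\circ\phi_{z_i,\delta}(\tau,\sigma)-I_i(\epsilon\tau)|=0\qquad(i=1,2,3,\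 I_i(0)=p_0),$$ where $p_0$ is the critical point of $f_2-f_1$, $f_3-f_2$ or $f_1-f_3$ (i.e. the one among $p_1,p_2,p_3$) whose Morse index, as a critical point of the corresponding difference, is zero.
   Context: Identify $T^*\mathbb{R}$ with $\mathbb{R}^2=\mathbb{C}$, $(x,y)\leftrightarrow x+iy$, where $x$ is the base coordinate and $y$ the fibre coordinate; $\mathbb{R}$ is identified with the zero section, $p\leftrightarrow (p,0)$. For a function $f$ on $\mathbb{R}$, $\operatorname{graph}(df)=\{(x,f'(x))\}$. An affine Lagrangian section is a line $\{y=ax+b\}$ with $a,b\in\mathbb{R}$; so $f_i(x)=\frac12a_ix^2+b_ix+c_i$. Put $f_4=f_1$, $L_4=L_1$. The Morse index of a nondegenerate critical point is the number of negative eigenvalues of the Hessian there. Gradient trees for $k=3$ (metric on $\mathbb{R}$ Euclidean): the underlying tree is the tripod with one internal vertex and three external edges $e_1,e_2,e_3$, each identified with $(-\infty,0]$ so that $0$ is the internal vertex and $-\infty$ is the external vertex $v_i$. An element $I\in\mathcal{M}_g(\mathbb{R};\vec f,\vec p)$ is a continuous map on the tripod, i.e. a triple of curves $I_i:(-\infty,0]\to\mathbb{R}$ with $\frac{dI_i}{dt}=-\operatorname{grad}(f_{i+1}-f_i)(I_i)$, $\lim_{t\to-\infty}I_i(t)=p_i$ ($i=1,2,3$), and $I_1(0)=I_2(0)=I_3(0)$. Under the stated hypotheses there is exactly one such $I$, and exactly one of $p_1,p_2,p_3$ has Morse index zero. The Schwarz--Christoffel map is the conformal map from the open upper half plane $\mathbb{H}$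 onto the interior of the triangle, extended continuously to $\overline{\mathbb{H}}\cup\{\infty\}$, with the prescribed values at the three boundary points. $\overline{\mathbb{H}}=\{z\in\mathbb{C}:\operatorname{Im}z\ge0\}$. For $\delta>0$: $D_p(\delta)=\{z:|z-p|<\delta,\ \operatorname{Im}z\geq0\}$ for $p\in\mathbb{R}$, and $D_\infty(\delta)=\{z:|z|^{-1}<\delta,\ \operatorname{Im}z\ge0\}$. $D(\delta)=\overline{\mathbb{H}}\setminus\bigcup_{i=1}^3D_{z_i}(\delta)$. $\Theta_{ext}=\{(\tau,\sigma)\in(-\infty,0)\times[0,1]\}$, and $\phi_{p,\delta}(\tau,\sigma)=p+\delta\exp[\pi(\tau+i\sigma)]$ for $p\in\mathbb{R}$, $\phi_{\infty,\delta}(\tau,\sigma)=-\delta^{-1}\exp[-\pi(\tau+i\sigma)]$. *)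

(* Defs.v *)
From Stdlib Require Import Reals List.
From Coquelicot Require Import Coquelicot.
Open Scope R_scope.

(** The cotangent bundle of [R] is [C = R * R]: the real part is the base
    coordinate, the imaginary part the fibre coordinate, and the zero section
    is the image of [RtoC]. *)

Inductive idx : Set := i1 | i2 | i3.

Definition nxt (i : idx) : idx :=
  match i with i1 => i2 | i2 => i3 | i3 => i1 end.

(** * Lagrangian sections *)

Definition same_set (A B : C -> Prop) : Prop := forall z, A z <-> B z.

Definition affine_section (L : C -> Prop) : Prop :=
  exists a b : R, same_set L (fun z => Im z = a * Re z + b).

Definition graph (g : R -> R) : C -> Prop := fun z => Im z = g (Re z).

(** * Triangles *)

Definition pairwise_distinct (x : idx -> C) : Prop :=
  forall i j, i <> j -> x i <> x j.

Definition counterclockwise (x : idx -> C) : Prop :=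
  0 < (Re (x i2) - Re (x i1)) * (Im (x i3) - Im (x i1))
      - (Im (x i2) - Im (x i1)) * (Re (x i3) - Re (x i1)).

Definition triangle (x : idx -> C) : C -> Prop := fun z =>
  exists s t u : R, 0 <= s /\ 0 <= t /\ 0 <= u /\ s + t + u = 1 /\
    z = (s * x i1 + t * x i2 + u * x i3)%C.

Definition interior (A : C -> Prop) : C -> Prop := fun z =>
  @locally C_UniformSpace z A.

(** * Critical points and Morse index on [R] *)

Definition critical_point (g : R -> R) (p : R) : Prop := is_derive g p 0.

(** The Hessian as an endomorphism of the tangent line at [p]. *)
Definition hessian (g : R -> R) (p : R) : R -> R := fun v => Derive_n g 2 p * v.

Definition eigenvalue (A : R -> R) (l : R) : Prop :=
  exists v : R, v <> 0 /\ A v = l * v.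

(** Eigenvalues of an endomorphism of a line have multiplicity one, so they may
    be counted without multiplicity. *)
Definition has_morse_index (g : R -> R) (p : R) (n : nat) : Prop :=
  critical_point g p /\ ~ eigenvalue (hessian g p) 0 /\
  exists s : list R, NoDup s /\ length s = n /\
    forall l, In l s <-> eigenvalue (hessian g p) l /\ l < 0.

(** * Gradient trees with three external edges *)

Definition diff (f : idx -> R -> R) (i : idx) : R -> R :=
  fun x => f (nxt i) x - f i x.

(** The differential equation is imposed on the whole closed half-line, with a
    one-sided derivative at [0]; continuity of the edges follows. *)
Definition gradient_tree (f : idx -> R -> R) (p : idx -> R)
    (I : idx -> R -> R) : Prop :=
  (forall i t, t <= 0 ->
     filterdiff (K := R_AbsRing) (U := R_NormedModule) (V := R_NormedModule)
       (I i) (within (fun s => s <= 0) (locally t))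
       (fun h => h * - Derive (diff f i) (I i t))) /\
  (forall i, is_lim (I i) m_infty (p i)) /\
  I i1 0 = I i2 0 /\ I i2 0 = I i3 0.

(** * Schwarz-Christoffel maps *)

Definition upper_half_plane (z : C) : Prop := 0 < Im z.
Definition closed_half_plane (z : C) : Prop := 0 <= Im z.

Definition holomorphic_on (U : C -> Prop) (f : C -> C) : Prop :=
  forall z, U z -> ex_derive (K := C_AbsRing) (V := C_NormedModule) f z.

Definition conformal_onto (U V : C -> Prop) (f : C -> C) : Prop :=
  holomorphic_on U f /\ (forall z, U z -> V (f z)) /\
  exists g : C -> C,
    holomorphic_on V g /\ (forall v, V v -> U (g v)) /\
    (forall z, U z -> g (f z) = z) /\ (forall v, V v -> f (g v) = v).

(** In [option C] and [option R], [None] is the point at infinity. *)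

Definition nbhs_infty (P : C -> Prop) : Prop :=
  exists M : R, forall z, M < Cmod z -> P z.

Definition continuous_closed_half_plane_infty (w : option C -> C) : Prop :=
  (forall z, closed_half_plane z ->
     filterlim (fun u => w (Some u))
       (within closed_half_plane (@locally C_UniformSpace z))
       (@locally C_UniformSpace (w (Some z)))) /\
  filterlim (fun u => w (Some u))
    (within closed_half_plane nbhs_infty)
    (@locally C_UniformSpace (w None)).

Definition schwarz_christoffel (zeta : idx -> option R) (x : idx -> C)
    (w : option C -> C) : Prop :=
  conformal_onto upper_half_plane (interior (triangle x))
    (fun z => w (Some z)) /\
  continuous_closed_half_plane_infty w /\
  forall i, w (option_map RtoC (zeta i)) = x i.

Definition zpt (i : idx) : option R :=
  match i with i1 => Some 1 | i2 => None | i3 => Some 0 end.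

(** * Half-discs and strip-like ends *)

(** At infinity, [0] has to be excluded explicitly because [/ 0 = 0]. *)
Definition half_disc (p : option R) (delta : R) (z : C) : Prop :=
  match p with
  | Some p => Cmod (z - p)%C < delta /\ 0 <= Im z
  | None => z <> 0 /\ / Cmod z < delta /\ 0 <= Im z
  end.

Definition thick_part (delta : R) (z : C) : Prop :=
  closed_half_plane z /\ forall i, ~ half_disc (zpt i) delta z.

Definition Theta_ext (q : R * R) : Prop := fst q < 0 /\ 0 <= snd q <= 1.

Definition Cexp (z : C) : C :=
  (exp (Re z) * (cos (Im z) + Ci * sin (Im z)))%C.

Definition phi (p : option R) (delta : R) (q : R * R) : C :=
  let zeta : C := (PI * (fst q + Ci * snd q))%C in
  match p with
  | Some p => (p + delta * Cexp zeta)%C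
  | None => (- (/ delta) * Cexp (- zeta))%C
  end.

(** * Limits of suprema *)

Definition sup_over {T : Type} (D : T -> Prop) (h : T -> R) : Rbar :=
  Lub_Rbar (fun r => exists x, D x /\ r = h x).

(** The coercion [real] sends infinite values to [0], hence the first clause. *)
Definition tends_to_0_at_0plus (s : R -> Rbar) : Prop :=
  at_right 0 (fun e => is_finite (s e)) /\
  filterlim (fun e => real (s e)) (at_right 0) (locally 0).

(* Main.v *)
Require Import Defs.
From Stdlib Require Import Reals List Lra Lia Classical ClassicalEpsilon Ranalysis5.
From Coquelicot Require Import Coquelicot.
Open Scope R_scope.

(** For small [e] the triangle is thin: its middle vertex has an angle close to [PI] and each of the
    two others, the tips, an angle [PI * beta] with [PI * beta] asymptotic to [e * |A|], where [A]
    is the difference of the slopes. No formula for the Schwarz-Christoffel map is used. By a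
    convexity argument [w] is injective on the boundary and maps the three arcs into the three open
    edges. At a tip [v], put [W = ((w - v) / (m - v)) ^ (1 / beta)] with [m] the middle vertex, and
    let [zeta] be the coordinate of the half plane sending the preimages of the tip, the middle
    vertex and the other tip to [0], [1] and infinity. The angles under which the arcs between
    these points are seen from [zeta] and from [W] are harmonic, and the maximum principle bounds
    them by each other. Elementary geometry turns this into bounds of [|W|] by constant multiples
    of [|zeta|] and conversely, so that [|w - v|] is [|m - v| |zeta| ^ beta] up to constants raised
    to the power [beta], which tend to one. The bounds at both tips together locate [w], because
    in a thin triangle the distances to the two tips add up to nearly the length of the long
    side. *)

(** * Goursat's theorem on rectangles *)

(** The factor [PI] in [phi] cancels the one in [beta]: on the strip-like end at a tip, |zeta| is
    comparable to exp (PI * tau), and its power with exponent [beta], which is close to e * |A| /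
    PI, is close to exp (e * |A| * tau). That is the gradient line at time e * tau. The estimate has
    to hold on the whole infinite strip, which shapes the proof in two ways. The constants comparing
    |zeta| with |W| must be absolute, so the comparison sees the triangle only through the edges
    that receive the three arcs, and the maximum principle has to tolerate exceptional points at the
    corners. Moreover the relative error of [beta] is multiplied by an unbounded tau; this is
    harmless because r * exp (- r) <= 1 for r >= 0. On the side of the tree, Morse index zero means
    that the slope difference is positive. Then the critical point attracts the flow, the only
    gradient line issuing from it is constant, and the three edges meet there. The same sign places
    this point horizontally between the two others, so it is the middle vertex. *)

Definition bad_quarter (P : R -> R -> R -> R -> Prop) (w h a c : R) : R * R :=
  if excluded_middle_informative (P a (a + w) c (c + h)) then
    if excluded_middle_informative (P (a + w) (a + w + w) c (c + h)) then
      if excluded_middle_informative (P a (a + w) (c + h) (c + h + h)) then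
        (a + w, c + h)
      else (a, c + h)
    else (a + w, c)
  else (a, c).

(** In the successor case [n] still denotes [S k], so the quarters of step [k] have sides w / 2 ^ (k
    + 1). [bad_quarter] returns the upper right quarter untested: it is bad by elimination. *)
Fixpoint bad_corner (P : R -> R -> R -> R -> Prop) (w h a c : R) (n : nat) : R * R :=
  match n with
  | O => (a, c)
  | S k => let q := bad_corner P w h a c k in
           bad_quarter P (w / 2 ^ n) (h / 2 ^ n) (fst q) (snd q)
  end.

(** The supremum of the left ends works: every left end lies below every right end, since both
    compare with the interval of larger index. *)
Lemma nested_point (u : nat -> R) (w : R) :
  0 <= w ->
  (forall n, u n <= u (S n) /\ u (S n) + w / 2 ^ (S n) <= u n + w / 2 ^ n) ->
  exists x, forall n, u n <= x <= u n + w / 2 ^ n.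
Proof.
  intros Hw H.
  assert (M : forall n k, u n <= u (n + k)%nat /\
            u (n + k)%nat + w / 2 ^ (n + k) <= u n + w / 2 ^ n).
  { intros n k; induction k as [|k IH].
    - rewrite Nat.add_0_r; lra.
    - rewrite Nat.add_succ_r; specialize (H (n + k)%nat); lra. }
  assert (P : forall n, 0 <= w / 2 ^ n).
  { intros n; apply Rdiv_le_0_compat; [lra | apply pow_lt; lra]. }
  assert (B : forall n k, u n <= u k + w / 2 ^ k).
  { intros n k; destruct (Nat.le_ge_cases n k) as [L | L].
    - replace k with (n + (k - n))%nat by lia.
      specialize (M n (k - n)%nat); specialize (P (n + (k - n))%nat); lra.
    - replace n with (k + (n - k))%nat by lia.
      specialize (M k (n - k)%nat); specialize (P (k + (n - k))%nat); lra. }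
  destruct (completeness (fun x => exists n, x = u n)) as [x [Hx1 Hx2]].
  - exists (u O + w / 2 ^ 0); intros y [n ->]; apply B.
  - exists (u O), O; reflexivity.
  - exists x; intros n; split.
    + apply Hx1; exists n; reflexivity.
    + apply Hx2; intros y [k ->]; apply B.
Qed.

(** The successive bad quarters are nested, so [nested_point] finds a common point in each
    coordinate separately. *)
Lemma rectangle_bisection (P : R -> R -> R -> R -> Prop) (a b c d : R) :
  a <= b -> c <= d ->
  (forall w h x y, 0 <= w -> 0 <= h ->
     P x (x + w) y (y + h) -> P (x + w) (x + w + w) y (y + h) ->
     P x (x + w) (y + h) (y + h + h) -> P (x + w) (x + w + w) (y + h) (y + h + h) ->
     P x (x + w + w) y (y + h + h)) ->
  ~ P a b c d ->
  exists x y, a <= x <= b /\ c <= y <= d /\ forall n, exists a' c',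
    a <= a' <= x /\ x <= a' + (b - a) / 2 ^ n <= b /\
    c <= c' <= y /\ y <= c' + (d - c) / 2 ^ n <= d /\
    ~ P a' (a' + (b - a) / 2 ^ n) c' (c' + (d - c) / 2 ^ n).
Proof.
  intros Hab Hcd Hsplit Hbad.
  set (w := b - a); set (h := d - c).
  pose (q := bad_corner P w h a c).
  assert (PW : forall n, 0 <= w / 2 ^ n).
  { intros n; apply Rdiv_le_0_compat; [unfold w; lra | apply pow_lt; lra]. }
  assert (PH : forall n, 0 <= h / 2 ^ n).
  { intros n; apply Rdiv_le_0_compat; [unfold h; lra | apply pow_lt; lra]. }
  assert (HW : forall z n, z / 2 ^ n = z / 2 ^ S n + z / 2 ^ S n).
  { intros z n; simpl; field; apply pow_nonzero; lra. }
  assert (Bad : forall n, ~ P (fst (q n)) (fst (q n) + w / 2 ^ n)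
                              (snd (q n)) (snd (q n) + h / 2 ^ n)).
  { induction n as [|n IH].
    - simpl; unfold w, h.
      replace (a + (b - a) / 1) with b by field.
      replace (c + (d - c) / 1) with d by field; exact Hbad.
    - rewrite (HW w n), (HW h n), <- !Rplus_assoc in IH.
      unfold q in *; cbn [bad_corner]; cbv zeta.
      set (x := fst (bad_corner P w h a c n)) in *.
      set (y := snd (bad_corner P w h a c n)) in *.
      unfold bad_quarter.
      destruct (excluded_middle_informative _) as [H1 | H1]; [| exact H1].
      destruct (excluded_middle_informative _) as [H2 | H2]; [| exact H2].
      destruct (excluded_middle_informative _) as [H3 | H3]; [| exact H3].
      intros H4; cbn [fst snd] in H4.
      apply IH, Hsplit; auto. }
  assert (Step : forall n,
            (fst (q (S n)) = fst (q n) \/ fst (q (S n)) = fst (q n) + w / 2 ^ S n) /\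
            (snd (q (S n)) = snd (q n) \/ snd (q (S n)) = snd (q n) + h / 2 ^ S n)).
  { intros n; unfold q; cbn [bad_corner]; cbv zeta; unfold bad_quarter.
    repeat destruct (excluded_middle_informative _); cbn [fst snd]; auto. }
  destruct (nested_point (fun n => fst (q n)) w) as [x Hx].
  { exact (PW O) || (unfold w; lra). }
  { intros n; specialize (Step n); specialize (PW (S n)); rewrite (HW w n); lra. }
  destruct (nested_point (fun n => snd (q n)) h) as [y Hy].
  { unfold h; lra. }
  { intros n; specialize (Step n); specialize (PH (S n)); rewrite (HW h n); lra. }
  assert (In : forall n, a <= fst (q n) /\ fst (q n) + w / 2 ^ n <= b /\
                         c <= snd (q n) /\ snd (q n) + h / 2 ^ n <= d).
  { induction n as [|n IH].
    - simpl; unfold w, h.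
      replace (a + (b - a) / 1) with b by field.
      replace (c + (d - c) / 1) with d by field; lra.
    - rewrite (HW w n), (HW h n) in IH; specialize (Step n).
      specialize (PW (S n)); specialize (PH (S n)); lra. }
  exists x, y; split; [| split].
  - specialize (In O); specialize (Hx O); lra.
  - specialize (In O); specialize (Hy O); lra.
  - intros n; exists (fst (q n)), (snd (q n)).
    specialize (In n); specialize (Hx n); specialize (Hy n); specialize (Bad n).
    repeat split; try lra; exact Bad.
Qed.

(** The outward flux of the field (U, -V) through the boundary of a rectangle. Its divergence dU/dx
    - dV/dy vanishes by a Cauchy-Riemann equation if U + iV is holomorphic. *)
Definition flux (U V : R -> R -> R) (a b c d : R) : R :=
  RInt (fun y => U b y - U a y) c d - RInt (fun x => V x d - V x c) a b.

Lemma differentiable_section_l (U : R -> R -> R) (x y p q : R) :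
  differentiable_pt_lim U x y p q -> continuous (fun t => U t y) x.
Proof.
  intros H; apply continuity_pt_filterlim, derivable_continuous_pt.
  eexists; apply (derivable_pt_lim_comp_2d U (fun t => t) (fun _ => y) x p q 1 0 H).
  - apply derivable_pt_lim_id.
  - apply derivable_pt_lim_const.
Qed.

Lemma differentiable_section_r (U : R -> R -> R) (x y p q : R) :
  differentiable_pt_lim U x y p q -> continuous (fun t => U x t) y.
Proof.
  intros H; apply continuity_pt_filterlim, derivable_continuous_pt.
  eexists; apply (derivable_pt_lim_comp_2d U (fun _ => x) (fun t => t) y p q 0 1 H).
  - apply derivable_pt_lim_const.
  - apply derivable_pt_lim_id.
Qed.

Lemma RInt_split (f : R -> R) (a m b : R) :
  a <= m <= b -> (forall t, a <= t <= b -> continuous f t) ->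
  RInt f a b = RInt f a m + RInt f m b.
Proof.
  intros Hm Hc; symmetry.
  apply (RInt_Chasles f a m b); apply (ex_RInt_continuous (V := R_CompleteNormedModule)); intros t;
    rewrite Rmin_left, Rmax_right by lra; intros Ht; apply Hc; lra.
Qed.

Lemma RInt_near_const (f : R -> R) (a b k e : R) :
  a <= b -> (forall t, a <= t <= b -> continuous f t) ->
  (forall t, a <= t <= b -> Rabs (f t - k) <= e) ->
  Rabs (RInt f a b - k * (b - a)) <= e * (b - a).
Proof.
  intros Hab Hc He.
  assert (Ef : ex_RInt f a b).
  { apply (ex_RInt_continuous (V := R_CompleteNormedModule)); intros t.
    rewrite Rmin_left, Rmax_right by lra; apply Hc. }
  assert (Ek : ex_RInt (fun _ : R => k) a b) by apply ex_RInt_const.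
  replace (RInt f a b - k * (b - a)) with (RInt (fun t => f t - k) a b).
  - rewrite (Rmult_comm e); apply abs_RInt_le_const; auto.
    exact (ex_RInt_minus f (fun _ => k) a b Ef Ek).
  - etransitivity; [exact (RInt_minus f (fun _ => k) a b Ef Ek) |].
    rewrite RInt_const; unfold minus, plus, opp, scal, mult; simpl.
    unfold mult; simpl; ring.
Qed.

Lemma flux_quarters (U V : R -> R -> R) (x y w h : R) :
  0 <= w -> 0 <= h ->
  (forall s t, x <= s <= x + w + w -> y <= t <= y + h + h ->
     continuous (fun r => U s r) t /\ continuous (fun r => V r t) s) ->
  flux U V x (x + w + w) y (y + h + h) =
    flux U V x (x + w) y (y + h) + flux U V (x + w) (x + w + w) y (y + h)
    + flux U V x (x + w) (y + h) (y + h + h)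
    + flux U V (x + w) (x + w + w) (y + h) (y + h + h).
Proof.
  intros Hw Hh Hc; unfold flux.
  assert (CU : forall s1 s2 t, x <= s1 <= x + w + w -> x <= s2 <= x + w + w ->
            y <= t <= y + h + h -> continuous (fun r => U s2 r - U s1 r) t).
  { intros s1 s2 t H1 H2 Ht.
    exact (continuous_minus (fun r => U s2 r) (fun r => U s1 r) t
             (proj1 (Hc s2 t H2 Ht)) (proj1 (Hc s1 t H1 Ht))). }
  assert (CV : forall t1 t2 s, y <= t1 <= y + h + h -> y <= t2 <= y + h + h ->
            x <= s <= x + w + w -> continuous (fun r => V r t2 - V r t1) s).
  { intros t1 t2 s H1 H2 Hs.
    exact (continuous_minus (fun r => V r t2) (fun r => V r t1) s
             (proj2 (Hc s t2 Hs H2)) (proj2 (Hc s t1 Hs H1))). }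
  assert (EU : forall s1 s2 c d, x <= s1 <= x + w + w -> x <= s2 <= x + w + w ->
            y <= c <= d -> d <= y + h + h -> ex_RInt (fun r => U s2 r - U s1 r) c d).
  { intros; apply (ex_RInt_continuous (V := R_CompleteNormedModule) (fun r => U s2 r - U s1 r)); intros t;
      rewrite Rmin_left, Rmax_right by lra; intros Ht; apply CU; lra. }
  assert (EV : forall t1 t2 a b, y <= t1 <= y + h + h -> y <= t2 <= y + h + h ->
            x <= a <= b -> b <= x + w + w -> ex_RInt (fun r => V r t2 - V r t1) a b).
  { intros; apply (ex_RInt_continuous (V := R_CompleteNormedModule) (fun r => V r t2 - V r t1)); intros t;
      rewrite Rmin_left, Rmax_right by lra; intros Ht; apply CV; lra. }
  assert (SU : forall c d, y <= c <= d -> d <= y + h + h ->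
     RInt (fun r => U (x + w + w) r - U x r) c d =
     RInt (fun r => U (x + w + w) r - U (x + w) r) c d +
     RInt (fun r => U (x + w) r - U x r) c d).
  { intros c d H1 H2.
    rewrite <- (RInt_plus (V := R_CompleteNormedModule)); try (apply EU; lra).
    apply RInt_ext; intros; unfold plus; simpl; ring. }
  assert (SV : forall a b, x <= a <= b -> b <= x + w + w ->
     RInt (fun r => V r (y + h + h) - V r y) a b =
     RInt (fun r => V r (y + h + h) - V r (y + h)) a b +
     RInt (fun r => V r (y + h) - V r y) a b).
  { intros a b H1 H2.
    rewrite <- (RInt_plus (V := R_CompleteNormedModule)); try (apply EV; lra).
    apply RInt_ext; intros; unfold plus; simpl; ring. }
  rewrite (RInt_split (fun r => U (x + w + w) r - U x r) y (y + h)) by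
    (try lra; intros; apply CU; lra).
  rewrite (RInt_split (fun r => V r (y + h + h) - V r y) x (x + w)) by
    (try lra; intros; apply CV; lra).
  rewrite !SU, !SV by lra; ring.
Qed.

(** The linear parts cancel: dU/dx and dV/dy are both [p], so each of the two integrals is p * (b -
    a) * (d - c) up to the remainder. *)
Lemma flux_small (U V : R -> R -> R) (x y p q s e del a b c d : R) :
  0 <= e ->
  (forall u v, Rabs (u - x) < del -> Rabs (v - y) < del ->
     Rabs (U u v - U x y - (p * (u - x) + q * (v - y))) <= e * Rmax (Rabs (u - x)) (Rabs (v - y)) /\
     Rabs (V u v - V x y - (s * (u - x) + p * (v - y))) <= e * Rmax (Rabs (u - x)) (Rabs (v - y))) ->
  a <= x <= b -> c <= y <= d -> b - a < del -> d - c < del ->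
  (forall s t, a <= s <= b -> c <= t <= d ->
     continuous (fun r => U s r) t /\ continuous (fun r => V r t) s) ->
  Rabs (flux U V a b c d) <= 2 * e * ((b - a) + (d - c)) ^ 2.
Proof.
  intros He Hlin Hx Hy Hb Hd Hc; set (m := (b - a) + (d - c)).
  assert (Near : forall u v, a <= u <= b -> c <= v <= d ->
     Rabs (U u v - U x y - (p * (u - x) + q * (v - y))) <= e * m /\
     Rabs (V u v - V x y - (s * (u - x) + p * (v - y))) <= e * m).
  { intros u v Hu Hv.
    assert (A1 : Rabs (u - x) <= b - a) by (apply Rabs_le; lra).
    assert (A2 : Rabs (v - y) <= d - c) by (apply Rabs_le; lra).
    assert (A3 : Rmax (Rabs (u - x)) (Rabs (v - y)) <= m)
      by (unfold m; apply Rmax_lub; lra).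
    destruct (Hlin u v) as [H1 H2]; try lra.
    split; eapply Rle_trans; eauto; apply Rmult_le_compat_l; lra. }
  assert (F1 : Rabs (RInt (fun t => U b t - U a t) c d - p * (b - a) * (d - c))
               <= 2 * e * m * (d - c)).
  { apply RInt_near_const; [lra | |].
    - intros t Ht; apply (continuous_minus (fun r => U b r) (fun r => U a r));
        apply Hc; lra.
    - intros t Ht.
      destruct (Near b t) as [H1 _]; try lra.
      destruct (Near a t) as [H2 _]; try lra.
      apply Rabs_le; apply Rabs_le_between in H1; apply Rabs_le_between in H2; lra. }
  assert (F2 : Rabs (RInt (fun t => V t d - V t c) a b - p * (d - c) * (b - a))
               <= 2 * e * m * (b - a)).
  { apply RInt_near_const; [lra | |].
    - intros t Ht; apply (continuous_minus (fun r => V r d) (fun r => V r c));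
        apply Hc; lra.
    - intros t Ht.
      destruct (Near t d) as [_ H1]; try lra.
      destruct (Near t c) as [_ H2]; try lra.
      apply Rabs_le; apply Rabs_le_between in H1; apply Rabs_le_between in H2; lra. }
  unfold flux; apply Rabs_le; apply Rabs_le_between in F1; apply Rabs_le_between in F2.
  unfold m in *; nra.
Qed.

Lemma eventually_pow_half (w e : R) : 0 < e -> exists n, w / 2 ^ n < e.
Proof.
  intros He; destruct (Rle_or_lt w 0) as [Hw | Hw].
  { exists O; simpl; lra. }
  destruct (pow_lt_1_zero (/ 2)) with (y := e / w) as [n Hn].
  - rewrite Rabs_right; lra.
  - apply Rdiv_lt_0_compat; lra.
  - exists n; specialize (Hn n (le_n n)).
    rewrite <- RPow_abs, Rabs_right, pow_inv in Hn by lra.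
    unfold Rdiv; apply Rmult_lt_reg_l with (/ w); [apply Rinv_0_lt_compat; lra |].
    replace (/ w * (w * / 2 ^ n)) with (/ 2 ^ n); [lra |].
    field; split; [apply pow_nonzero; lra | lra].
Qed.

(** Goursat's bisection: no continuity of the partial derivatives is assumed. *)
Lemma flux_zero (U V : R -> R -> R) (a b c d : R) :
  a < b -> c < d ->
  (forall x y, a <= x <= b -> c <= y <= d -> exists p q s,
     differentiable_pt_lim U x y p q /\ differentiable_pt_lim V x y s p) ->
  flux U V a b c d = 0.
Proof.
  intros Hab Hcd Hdiff.
  assert (Hc : forall s t, a <= s <= b -> c <= t <= d ->
     continuous (fun r => U s r) t /\ continuous (fun r => V r t) s).
  { intros s t Hs Ht; destruct (Hdiff s t Hs Ht) as (p & q & r & H1 & H2).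
    split; [eapply differentiable_section_r | eapply differentiable_section_l]; eauto. }
  assert (Main : forall e, 0 < e -> Rabs (flux U V a b c d) <= e * ((b - a) * (d - c))).
  2: { apply NNPP; intros Hnz.
       assert (Hpos : 0 < Rabs (flux U V a b c d)) by (apply Rabs_pos_lt; auto).
       assert (Har : 0 < (b - a) * (d - c)) by (apply Rmult_lt_0_compat; lra).
       specialize (Main (Rabs (flux U V a b c d) / (2 * ((b - a) * (d - c))))).
       replace (Rabs (flux U V a b c d) / (2 * ((b - a) * (d - c))) * ((b - a) * (d - c)))
         with (Rabs (flux U V a b c d) / 2) in Main by (field; lra).
       enough (0 < Rabs (flux U V a b c d) / (2 * ((b - a) * (d - c)))) by lra.
       apply Rdiv_lt_0_compat; lra. }
  intros e He; apply NNPP; intros Hbad.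
  (* The bound is proportional to the area, hence additive over quarters. The guards keep the
     rectangles inside the region of differentiability. *)
  destruct (rectangle_bisection
    (fun x1 x2 y1 y2 => a <= x1 -> x2 <= b -> c <= y1 -> y2 <= d ->
       Rabs (flux U V x1 x2 y1 y2) <= e * ((x2 - x1) * (y2 - y1))) a b c d)
    as (x & y & Hx & Hy & Hn); try lra.
  { intros w h x y Hw Hh P1 P2 P3 P4 L1 L2 L3 L4.
    rewrite flux_quarters by (try lra; intros; apply Hc; lra).
    specialize (P1 ltac:(lra) ltac:(lra) ltac:(lra) ltac:(lra)).
    specialize (P2 ltac:(lra) ltac:(lra) ltac:(lra) ltac:(lra)).
    specialize (P3 ltac:(lra) ltac:(lra) ltac:(lra) ltac:(lra)).
    specialize (P4 ltac:(lra) ltac:(lra) ltac:(lra) ltac:(lra)).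
    apply Rabs_le; apply Rabs_le_between in P1; apply Rabs_le_between in P2;
      apply Rabs_le_between in P3; apply Rabs_le_between in P4; nra. }
  set (w := b - a) in *; set (h := d - c) in *.
  assert (Hw : 0 < w) by (unfold w; lra); assert (Hh : 0 < h) by (unfold h; lra).
  (* Makes the bound 2 * e' * (w + h) ^ 2 of [flux_small] one half of e * w * h, so that the bad
     rectangle is contradicted with room to spare. *)
  set (e' := e * (w * h) / (4 * (w + h) ^ 2)).
  assert (He' : 0 < e').
  { unfold e'; apply Rdiv_lt_0_compat; [apply Rmult_lt_0_compat; nra | nra]. }
  destruct (Hdiff x y Hx Hy) as (p & q & s & D1 & D2).
  destruct (D1 (mkposreal e' He')) as [d1 Hd1]; destruct (D2 (mkposreal e' He')) as [d2 Hd2].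
  simpl in Hd1, Hd2.
  assert (Hdel : 0 < Rmin d1 d2) by (apply Rmin_pos; apply cond_pos).
  destruct (eventually_pow_half (w + h) (Rmin d1 d2) Hdel) as [n Hsize].
  assert (Hp : 0 < 2 ^ n) by (apply pow_lt; lra).
  destruct (Hn n) as (a' & c' & H1 & H2 & H3 & H4 & Hnot).

  replace ((w + h) / 2 ^ n) with (w / 2 ^ n + h / 2 ^ n) in Hsize by (field; lra).
  apply Hnot; intros _ _ _ _.
  eapply Rle_trans; [apply (flux_small U V x y p q s e' (Rmin d1 d2)); try lra |].
  - intros u v Hu Hv; split; [apply Hd1 | apply Hd2];
      (eapply Rlt_le_trans; [eassumption |]); (apply Rmin_l || apply Rmin_r).
  - intros; apply Hc; lra.
  - unfold e'.
    replace (a' + w / 2 ^ n - a' + (c' + h / 2 ^ n - c')) with ((w + h) / 2 ^ n) by (field; lra).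
    replace ((a' + w / 2 ^ n - a') * (c' + h / 2 ^ n - c')) with (w * h / (2 ^ n) ^ 2)
      by (field; lra).
    replace (2 * (e * (w * h) / (4 * (w + h) ^ 2)) * ((w + h) / 2 ^ n) ^ 2)
      with (e * (w * h / (2 ^ n) ^ 2) / 2) by (field; lra).
    assert (0 < e * (w * h / (2 ^ n) ^ 2)); [| lra].
    apply Rmult_lt_0_compat; [lra |]; apply Rdiv_lt_0_compat; nra.
Qed.

(** * Complex derivatives *)

Definition cderiv (F : C -> C) (z l : C) : Prop :=
  forall e, 0 < e -> exists d, 0 < d /\ forall h, Cmod h < d ->
    Cmod (F (z + h) - F z - l * h)%C <= e * Cmod h.

Lemma ex_derive_cderiv (F : C -> C) (z : C) :
  ex_derive (K := C_AbsRing) (V := C_NormedModule) F z -> exists l, cderiv F z l.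
Proof.
  intros [l [_ Hl]]; exists l; intros e He.
  specialize (Hl z (fun P H => H) (mkposreal e He)).
  destruct Hl as [d Hd].
  exists d; split; [apply cond_pos |]; intros h Hh.
  specialize (Hd (z + h)%C).
  assert (E : minus (z + h)%C z = h).
  { unfold minus, plus, opp; simpl; ring. }
  assert (B : @ball (AbsRing_UniformSpace C_AbsRing) z d (z + h)%C).
  { unfold ball; simpl; unfold AbsRing_ball, abs; simpl.
    change (Cmod (minus (z + h)%C z) < d); rewrite E; exact Hh. }
  specialize (Hd B); simpl in Hd.
  change (Cmod (minus (minus (F (z + h)%C) (F z)) (scal (minus (z + h)%C z) l))
          <= e * Cmod (minus (z + h)%C z)) in Hd.
  rewrite E in Hd.
  replace (F (z + h) - F z - l * h)%C
    with (minus (minus (F (z + h)%C) (F z)) (scal h l)); [exact Hd |].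
  unfold minus, plus, opp, scal; simpl; unfold mult; simpl; ring.
Qed.

Lemma cderiv_lipschitz (F : C -> C) (z l : C) :
  cderiv F z l -> exists d, 0 < d /\ forall h, Cmod h < d ->
    Cmod (F (z + h) - F z)%C <= (Cmod l + 1) * Cmod h.
Proof.
  intros H; destruct (H 1 Rlt_0_1) as [d [Hd Hh]]; exists d; split; [exact Hd |].
  intros h Hs; specialize (Hh h Hs).
  replace (F (z + h) - F z)%C with ((F (z + h) - F z - l * h) + l * h)%C by ring.
  eapply Rle_trans; [apply Cmod_triangle |]; rewrite Cmod_mult; lra.
Qed.

Lemma cderiv_continuous (F : C -> C) (z l : C) :
  cderiv F z l -> forall e, 0 < e -> exists d, 0 < d /\ forall w, Cmod (w - z)%C < d ->
    Cmod (F w - F z)%C < e.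
Proof.
  intros H e He; destruct (cderiv_lipschitz F z l H) as [d [Hd K]]; pose proof (Cmod_ge_0 l).
  exists (Rmin d (e / (Cmod l + 1))); split.
  { apply Rmin_pos; [exact Hd | apply Rdiv_lt_0_compat; lra]. }
  intros w Hw; apply Rmin_Rgt in Hw; destruct Hw as [Hw1 Hw2].
  specialize (K (w - z)%C Hw1); replace (z + (w - z))%C with w in K by ring.
  eapply Rle_lt_trans; [exact K |].
  apply Rmult_lt_compat_l with (r := Cmod l + 1) in Hw2; [| lra].
  replace ((Cmod l + 1) * (e / (Cmod l + 1))) with e in Hw2 by (field; lra); exact Hw2.
Qed.

Lemma cderiv_ext_loc (F G : C -> C) (z l : C) (d : R) :
  0 < d -> (forall w, Cmod (w - z)%C < d -> F w = G w) -> cderiv F z l -> cderiv G z l.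
Proof.
  intros Hd He H e Hepos; destruct (H e Hepos) as [d' [Hd' Hh]].
  exists (Rmin d d'); split; [apply Rmin_pos; auto |]; intros h Hs.
  apply Rmin_Rgt in Hs; destruct Hs as [S1 S2]; rewrite <- !He; auto.
  - replace (z - z)%C with (RtoC 0) by ring; rewrite Cmod_0; exact Hd.
  - replace (z + h - z)%C with h by ring; exact S1.
Qed.

Lemma cderiv_const (c z : C) : cderiv (fun _ => c) z 0.
Proof.
  intros e He; exists 1; split; [lra |]; intros h _.
  replace (c - c - 0 * h)%C with (RtoC 0) by ring; rewrite Cmod_0.
  apply Rmult_le_pos; [lra | apply Cmod_ge_0].
Qed.

Lemma cderiv_id (z : C) : cderiv (fun w => w) z 1.
Proof.
  intros e He; exists 1; split; [lra |]; intros h _.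
  replace (z + h - z - 1 * h)%C with (RtoC 0) by ring; rewrite Cmod_0.
  apply Rmult_le_pos; [lra | apply Cmod_ge_0].
Qed.

Lemma cderiv_plus (F G : C -> C) (z l m : C) :
  cderiv F z l -> cderiv G z m -> cderiv (fun w => F w + G w)%C z (l + m).
Proof.
  intros HF HG e He.
  destruct (HF (e / 2)) as [d1 [P1 H1]]; [lra |].
  destruct (HG (e / 2)) as [d2 [P2 H2]]; [lra |].
  exists (Rmin d1 d2); split; [apply Rmin_pos; auto |]; intros h Hs.
  apply Rmin_Rgt in Hs; destruct Hs as [S1 S2]; specialize (H1 h S1); specialize (H2 h S2).
  replace (F (z + h) + G (z + h) - (F z + G z) - (l + m) * h)%C
    with ((F (z + h) - F z - l * h) + (G (z + h) - G z - m * h))%C by ring.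
  eapply Rle_trans; [apply Cmod_triangle | lra].
Qed.

Lemma cderiv_scal (F : C -> C) (c z l : C) :
  cderiv F z l -> cderiv (fun w => c * F w)%C z (c * l).
Proof.
  intros HF e He; pose proof (Cmod_ge_0 c) as Hc.
  destruct (HF (e / (Cmod c + 1))) as [d [P H]]; [apply Rdiv_lt_0_compat; lra |].
  exists d; split; [exact P |]; intros h Hs; specialize (H h Hs).
  replace (c * F (z + h) - c * F z - c * l * h)%C
    with (c * (F (z + h) - F z - l * h))%C by ring.
  rewrite Cmod_mult.
  apply Rle_trans with (Cmod c * (e / (Cmod c + 1) * Cmod h)).
  - apply Rmult_le_compat_l; auto.
  - replace (Cmod c * (e / (Cmod c + 1) * Cmod h))
      with ((Cmod c / (Cmod c + 1)) * (e * Cmod h)) by (field; lra).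
    rewrite <- (Rmult_1_l (e * Cmod h)) at 2.
    apply Rmult_le_compat_r; [apply Rmult_le_pos; [lra | apply Cmod_ge_0] |].
    apply Rmult_le_reg_r with (Cmod c + 1); [lra |]; field_simplify; lra.
Qed.

Lemma cderiv_comp (F G : C -> C) (z l m : C) :
  cderiv G z m -> cderiv F (G z) l -> cderiv (fun w => F (G w)) z (l * m).
Proof.
  intros HG HF e He.
  pose proof (Cmod_ge_0 l) as Hl; pose proof (Cmod_ge_0 m) as Hm.
  destruct (cderiv_lipschitz _ _ _ HG) as [d0 [P0 H0]].
  destruct (HF (e / (2 * (Cmod m + 1)))) as [d1 [P1 H1]]; [apply Rdiv_lt_0_compat; lra |].
  destruct (HG (e / (2 * (Cmod l + 1)))) as [d2 [P2 H2]]; [apply Rdiv_lt_0_compat; lra |].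
  exists (Rmin (Rmin d0 d2) (d1 / (Cmod m + 1))); split.
  { repeat apply Rmin_pos; auto; apply Rdiv_lt_0_compat; lra. }
  intros h Hs.
  apply Rmin_Rgt in Hs; destruct Hs as [Hs S1].
  apply Rmin_Rgt in Hs; destruct Hs as [S0 S2].
  specialize (H0 h S0); specialize (H2 h S2).
  set (k := (G (z + h) - G z)%C) in *.
  assert (Sk : Cmod k < d1).
  { eapply Rle_lt_trans; [exact H0 |].
    apply Rmult_lt_compat_l with (r := Cmod m + 1) in S1; [| lra].
    replace ((Cmod m + 1) * (d1 / (Cmod m + 1))) with d1 in S1 by (field; lra); exact S1. }
  specialize (H1 k Sk).
  replace (G z + k)%C with (G (z + h)%C) in H1 by (unfold k; ring).
  replace (F (G (z + h)) - F (G z) - l * m * h)%C with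
    ((F (G (z + h)) - F (G z) - l * k) + l * (k - m * h))%C by ring.
  eapply Rle_trans; [apply Cmod_triangle |]; rewrite Cmod_mult.
  assert (A1 : e / (2 * (Cmod m + 1)) * Cmod k <= e / 2 * Cmod h).
  { replace (e / 2 * Cmod h) with (e / (2 * (Cmod m + 1)) * ((Cmod m + 1) * Cmod h))
      by (field; lra).
    apply Rmult_le_compat_l; [left; apply Rdiv_lt_0_compat; lra | exact H0]. }
  assert (A2 : Cmod l * Cmod (k - m * h)%C <= e / 2 * Cmod h).
  { apply Rle_trans with (Cmod l * (e / (2 * (Cmod l + 1)) * Cmod h)).
    - apply Rmult_le_compat_l; auto.
    - replace (Cmod l * (e / (2 * (Cmod l + 1)) * Cmod h))
        with ((Cmod l / (Cmod l + 1)) * (e / 2 * Cmod h)) by (field; lra).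
      rewrite <- (Rmult_1_l (e / 2 * Cmod h)) at 2.
      apply Rmult_le_compat_r; [apply Rmult_le_pos; [lra | apply Cmod_ge_0] |].
      apply Rmult_le_reg_r with (Cmod l + 1); [lra |]; field_simplify; lra. }
  lra.
Qed.

Lemma cderiv_inv (z : C) : z <> 0 -> cderiv (fun w => / w)%C z (- / (z * z)).
Proof.
  intros Hz e He; assert (P : 0 < Cmod z) by (apply Cmod_gt_0; exact Hz).
  exists (Rmin (Cmod z / 2) (e * (Cmod z) ^ 3 / 2)); split.
  { apply Rmin_pos; [lra |]. apply Rdiv_lt_0_compat; [| lra].
    apply Rmult_lt_0_compat; [lra | apply pow_lt; lra]. }
  intros h Hs.
  apply Rmin_Rgt in Hs; destruct Hs as [S1 S2].
  assert (B : Cmod z / 2 <= Cmod (z + h)%C).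
  { pose proof (Cmod_triangle (z + h) (- h)) as T; rewrite Cmod_opp in T.
    replace (z + h + - h)%C with z in T by ring; lra. }
  assert (Hzh : (z + h)%C <> 0) by (apply Cmod_gt_0; lra).
  replace (/ (z + h) - / z - - / (z * z) * h)%C with (h * h / (z * z * (z + h)))%C.
  2: { field; split; auto. }
  rewrite Cmod_div, !Cmod_mult.
  2: { repeat apply Cmult_neq_0; auto. }
  apply Rle_trans with (Cmod h * Cmod h / (Cmod z * Cmod z * (Cmod z / 2))).
  - apply Rmult_le_compat_l; [apply Rmult_le_pos; apply Cmod_ge_0 |].
    apply Rinv_le_contravar; [repeat apply Rmult_lt_0_compat; lra |].
    apply Rmult_le_compat_l; [apply Rmult_le_pos; lra | lra].
  - replace (Cmod h * Cmod h / (Cmod z * Cmod z * (Cmod z / 2)))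
      with (Cmod h * (2 / (Cmod z) ^ 3) * Cmod h) by (field; lra).
    apply Rmult_le_compat_r; [apply Cmod_ge_0 |].
    apply Rmult_le_reg_r with ((Cmod z) ^ 3 / 2).
    + apply Rdiv_lt_0_compat; [apply pow_lt; lra | lra].
    + replace (Cmod h * (2 / Cmod z ^ 3) * (Cmod z ^ 3 / 2)) with (Cmod h) by (field; lra).
      lra.
Qed.

Lemma Re_plus (a b : C) : Re (a + b)%C = Re a + Re b. Proof. reflexivity. Qed.
Lemma Im_plus (a b : C) : Im (a + b)%C = Im a + Im b. Proof. reflexivity. Qed.
Lemma Re_minus (a b : C) : Re (a - b)%C = Re a - Re b. Proof. reflexivity. Qed.
Lemma Im_minus (a b : C) : Im (a - b)%C = Im a - Im b. Proof. reflexivity. Qed.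
Lemma Re_mult (a b : C) : Re (a * b)%C = Re a * Re b - Im a * Im b.
Proof. reflexivity. Qed.
Lemma Im_mult (a b : C) : Im (a * b)%C = Re a * Im b + Im a * Re b.
Proof. reflexivity. Qed.

Lemma Re_Cexp (z : C) : Re (Cexp z) = exp (Re z) * cos (Im z).
Proof. unfold Cexp; simpl; ring. Qed.

Lemma Im_Cexp (z : C) : Im (Cexp z) = exp (Re z) * sin (Im z).
Proof. unfold Cexp; simpl; ring. Qed.

Lemma C_ext (a b : C) : Re a = Re b -> Im a = Im b -> a = b.
Proof. destruct a, b; simpl; intros -> ->; reflexivity. Qed.

Lemma Cexp_plus (a b : C) : Cexp (a + b) = (Cexp a * Cexp b)%C.
Proof.
  apply C_ext; rewrite ?Re_mult, ?Im_mult, !Re_Cexp, !Im_Cexp, Re_plus, Im_plus, exp_plus,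
    ?cos_plus, ?sin_plus; ring.
Qed.

Lemma Cmod_Cexp (z : C) : Cmod (Cexp z) = exp (Re z).
Proof.
  unfold Cmod; rewrite <- (sqrt_Rsqr (exp (Re z))) by (left; apply exp_pos).
  f_equal; change (Re (Cexp z) ^ 2 + Im (Cexp z) ^ 2 = Rsqr (exp (Re z))).
  rewrite Re_Cexp, Im_Cexp; unfold Rsqr.
  pose proof (sin2_cos2 (Im z)) as H; unfold Rsqr in H.
  transitivity (exp (Re z) * exp (Re z) * (sin (Im z) * sin (Im z) + cos (Im z) * cos (Im z)));
    [ring | rewrite H; ring].
Qed.

Lemma Cmod_le_sum (z : C) : Cmod z <= Rabs (Re z) + Rabs (Im z).
Proof.
  pose proof (Rabs_pos (Re z)); pose proof (Rabs_pos (Im z)).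
  unfold Cmod.
  rewrite <- (sqrt_Rsqr (Rabs (Re z) + Rabs (Im z))) by lra.
  apply sqrt_le_1_alt; unfold Rsqr.
  change (Re z ^ 2 + Im z ^ 2 <= (Rabs (Re z) + Rabs (Im z)) * (Rabs (Re z) + Rabs (Im z))).
  rewrite <- (pow2_abs (Re z)), <- (pow2_abs (Im z)); nra.
Qed.

Lemma Rabs_Re_le (z : C) : Rabs (Re z) <= Cmod z.
Proof. apply re_le_Cmod. Qed.

Lemma Rabs_Im_le (z : C) : Rabs (Im z) <= Cmod z.
Proof. eapply Rle_trans; [apply Rmax_r | apply Rmax_Cmod]. Qed.

Lemma derivable_small (f : R -> R) (l : R) :
  derivable_pt_lim f 0 l -> forall e, 0 < e -> exists d, 0 < d /\
    forall x, Rabs x < d -> Rabs (f x - f 0 - l * x) <= e * Rabs x.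
Proof.
  intros H e He; destruct (H e He) as [d Hd]; exists d; split; [apply cond_pos |].
  intros x Hx; destruct (Req_dec x 0) as [-> | Hx0].
  - replace (f 0 - f 0 - l * 0) with 0 by ring; rewrite Rabs_R0; lra.
  - specialize (Hd x Hx0 Hx); rewrite Rplus_0_l in Hd.
    replace (f x - f 0 - l * x) with (((f x - f 0) / x - l) * x) by (field; auto).
    rewrite Rabs_mult; apply Rmult_le_compat_r; [apply Rabs_pos | lra].
Qed.

Lemma cderiv_exp_0 : cderiv Cexp 0 1.
Proof.
  intros e He.
  (* The real and imaginary remainders come out as 3 * m and 4 * m times |h|, which e / 12 covers;
     the bound 1 / 4 keeps exp x below 2. *)
  set (m := Rmin (e / 12) (1 / 4)).
  assert (Hm : 0 < m) by (apply Rmin_pos; lra).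
  assert (Hm1 : m <= e / 12) by apply Rmin_l.
  assert (Hm2 : m <= 1 / 4) by apply Rmin_r.
  destruct (derivable_small exp 1 (eq_ind _ (fun v => derivable_pt_lim exp 0 v)
              (derivable_pt_lim_exp 0) _ exp_0) m Hm) as [d1 [P1 H1]].
  destruct (derivable_small sin 1 (eq_ind _ (fun v => derivable_pt_lim sin 0 v)
              (derivable_pt_lim_sin 0) _ cos_0) m Hm) as [d2 [P2 H2]].
  assert (D3 : derivable_pt_lim cos 0 0).
  { replace 0 with (- sin 0) at 2 by (rewrite sin_0; ring); apply derivable_pt_lim_cos. }
  destruct (derivable_small cos 0 D3 m Hm) as [d3 [P3 H3]].
  exists (Rmin (Rmin d1 d2) (Rmin d3 m)); split; [apply Rmin_pos; apply Rmin_pos; assumption |].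
  intros h Hs.
  pose proof (Rabs_Re_le h) as B1; pose proof (Rabs_Im_le h) as B2.
  apply Rmin_Rgt in Hs; destruct Hs as [S12 S34].
  apply Rmin_Rgt in S12; destruct S12 as [S1 S2]; apply Rmin_Rgt in S34; destruct S34 as [S3 S4].
  set (x := Re h) in *; set (y := Im h) in *.
  specialize (H1 x ltac:(lra)); specialize (H2 y ltac:(lra)); specialize (H3 y ltac:(lra)).
  rewrite exp_0 in H1; rewrite sin_0 in H2; rewrite cos_0 in H3.
  assert (Ex : Rabs (exp x - 1) <= 2 * m).
  { replace (exp x - 1) with ((exp x - 1 - 1 * x) + x) by ring.
    eapply Rle_trans; [apply Rabs_triang |]; nra. }
  assert (Ex2 : 0 < exp x <= 2).
  { split; [apply exp_pos |]; apply Rabs_le_between in Ex; lra. }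
  eapply Rle_trans; [apply Cmod_le_sum |].
  assert (A1 : Rabs (Re (Cexp (0 + h) - Cexp 0 - 1 * h)%C) <= 3 * m * Cmod h).
  { replace (Re (Cexp (0 + h) - Cexp 0 - 1 * h)%C)
      with ((exp x - 1 - 1 * x) + exp x * (cos y - 1 - 0 * y)).
    2: { replace (0 + h)%C with h by ring.
         change (exp x - 1 - 1 * x + exp x * (cos y - 1 - 0 * y) =
                 Re (Cexp h) - Re (Cexp 0) - (1 * Re h - 0 * Im h)).
         rewrite !Re_Cexp; simpl; rewrite exp_0, cos_0; fold x y; ring. }
    eapply Rle_trans; [apply Rabs_triang |]; rewrite Rabs_mult, (Rabs_right (exp x)) by lra.
    pose proof (Rabs_pos (cos y - 1 - 0 * y)); nra. }
  assert (A2 : Rabs (Im (Cexp (0 + h) - Cexp 0 - 1 * h)%C) <= 4 * m * Cmod h).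
  { replace (Im (Cexp (0 + h) - Cexp 0 - 1 * h)%C)
      with (exp x * (sin y - 0 - 1 * y) + (exp x - 1) * y).
    2: { replace (0 + h)%C with h by ring.
         change (exp x * (sin y - 0 - 1 * y) + (exp x - 1) * y =
                 Im (Cexp h) - Im (Cexp 0) - (1 * Im h + 0 * Re h)).
         rewrite !Im_Cexp; simpl; rewrite sin_0; fold x y; ring. }
    eapply Rle_trans; [apply Rabs_triang |]; rewrite !Rabs_mult, (Rabs_right (exp x)) by lra.
    pose proof (Rabs_pos (sin y - 0 - 1 * y));
      pose proof (Rabs_pos y); nra. }
  pose proof (Cmod_ge_0 h); nra.
Qed.

Lemma cderiv_exp (z : C) : cderiv Cexp z (Cexp z).
Proof.
  intros e He; pose proof (exp_pos (Re z)) as P.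
  destruct (cderiv_exp_0 (e / exp (Re z))) as [d [Hd H]]; [apply Rdiv_lt_0_compat; lra |].
  exists d; split; [exact Hd |]; intros h Hs; specialize (H h Hs).
  replace (Cexp (z + h) - Cexp z - Cexp z * h)%C
    with (Cexp z * (Cexp (0 + h) - Cexp 0 - 1 * h))%C.
  2: { replace (0 + h)%C with h by ring; rewrite Cexp_plus.
       replace (Cexp 0) with (RtoC 1); [ring |].
       apply C_ext; rewrite ?Re_Cexp, ?Im_Cexp; simpl; rewrite exp_0, ?cos_0, ?sin_0; ring. }
  rewrite Cmod_mult, Cmod_Cexp.
  replace (e * Cmod h) with (exp (Re z) * (e / exp (Re z) * Cmod h)) by (field; lra).
  apply Rmult_le_compat_l; lra.
Qed.

(** * Holomorphic and harmonic functions on the upper half plane *)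

Lemma ball_C (z w : C) (e : R) :
  @ball C_UniformSpace z e w <-> Rabs (Re w - Re z) < e /\ Rabs (Im w - Im z) < e.
Proof. reflexivity. Qed.

Lemma locally_Cmod (z : C) (P : C -> Prop) :
  @locally C_UniformSpace z P <->
  exists d, 0 < d /\ forall w, Cmod (w - z)%C < d -> P w.
Proof.
  split.
  - intros [d Hd]; exists d; split; [apply cond_pos |]; intros w Hw; apply Hd.
    apply ball_C; pose proof (Rabs_Re_le (w - z)%C); pose proof (Rabs_Im_le (w - z)%C).
    change (Re (w - z)%C) with (Re w - Re z) in *; change (Im (w - z)%C) with (Im w - Im z) in *.
    lra.
  - intros [d [Hd H]]; assert (P2 : 0 < d / 2) by lra; exists (mkposreal _ P2); intros w Hw.
    destruct (proj1 (ball_C _ _ _) Hw) as [Hw1 Hw2]; simpl in Hw1, Hw2; apply H.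
    eapply Rle_lt_trans; [apply Cmod_le_sum |].
    change (Rabs (Re w - Re z) + Rabs (Im w - Im z) < d); lra.
Qed.

Lemma continuous_eps (f : C -> R) (z : C) :
  @continuous C_UniformSpace R_UniformSpace f z ->
  forall e, 0 < e -> exists d, 0 < d /\ forall w, Cmod (w - z)%C < d -> Rabs (f w - f z) < e.
Proof.
  intros H e He; apply locally_Cmod.
  apply (H (fun x => Rabs (x - f z) < e)); exists (mkposreal e He); intros y Hy; exact Hy.
Qed.

Lemma continuous_Re (z : C) : @continuous C_UniformSpace R_UniformSpace Re z.
Proof. destruct z; apply continuous_fst. Qed.

Lemma continuous_Im (z : C) : @continuous C_UniformSpace R_UniformSpace Im z.
Proof. destruct z; apply continuous_snd. Qed.

Lemma Rabs_Cmod_minus (z w : C) : Rabs (Cmod w - Cmod z) <= Cmod (w - z)%C.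
Proof.
  pose proof (Cmod_triangle (w - z) z) as H1; pose proof (Cmod_triangle (z - w) w) as H2.
  replace (w - z + z)%C with w in H1 by ring; replace (z - w + w)%C with z in H2 by ring.
  replace (z - w)%C with (- (w - z))%C in H2 by ring; rewrite Cmod_opp in H2.
  apply Rabs_le; lra.
Qed.

Lemma continuous_Cmod (z : C) : @continuous C_UniformSpace R_UniformSpace Cmod z.
Proof.
  intros P [d Hd]; apply locally_Cmod; exists d; split; [apply cond_pos |].
  intros w Hw; apply Hd; eapply Rle_lt_trans; [apply Rabs_Cmod_minus | exact Hw].
Qed.

Lemma continuous_derivable (f : R -> R) (x l : R) : derivable_pt_lim f x l -> continuous f x.
Proof.
  intros H; apply continuity_pt_filterlim, derivable_continuous_pt; exists l; exact H.
Qed.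

Lemma continuous_atan (x : R) : continuous atan x.
Proof. eapply continuous_derivable, derivable_pt_lim_atan. Qed.

Lemma continuous_ln (x : R) : 0 < x -> continuous ln x.
Proof. intros H; eapply continuous_derivable, (derivable_pt_lim_ln x H). Qed.

Lemma continuous_Rinv (x : R) : x <> 0 -> continuous Rinv x.
Proof.
  intros H; apply continuity_pt_filterlim, (continuity_pt_inv (fun t => t)); auto.
  apply continuity_pt_id.
Qed.

Lemma Cmod_sqr (z : C) : Cmod z * Cmod z = Re z * Re z + Im z * Im z.
Proof.
  unfold Cmod; rewrite sqrt_sqrt.
  - change (Re z ^ 2 + Im z ^ 2 = Re z * Re z + Im z * Im z); ring.
  - change (0 <= Re z ^ 2 + Im z ^ 2); nra.
Qed.

Lemma Cmod_pos_Re (z : C) : 0 < Re z -> 0 < Cmod z.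
Proof. intros H; pose proof (Rabs_Re_le z); pose proof (Rle_abs (Re z)); lra. Qed.

Lemma Cmod_pos_Im (z : C) : 0 < Im z -> 0 < Cmod z.
Proof. intros H; pose proof (Rabs_Im_le z); pose proof (Rle_abs (Im z)); lra. Qed.

(** The principal logarithm, only meaningful on the right half plane. *)
Definition Clog (z : C) : C := (ln (Cmod z), atan (Im z / Re z)).

Lemma Cexp_Clog (z : C) : 0 < Re z -> Cexp (Clog z) = z.
Proof.
  intros H; pose proof (Cmod_pos_Re z H) as P.
  assert (S : sqrt (1 + (Im z / Re z)²) = Cmod z / Re z).
  { apply sqrt_lem_1.
    - unfold Rsqr; nra.
    - apply Rdiv_le_0_compat; lra.
    - replace (Cmod z / Re z * (Cmod z / Re z)) with (Cmod z * Cmod z / (Re z * Re z)) by (field; lra).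
      rewrite Cmod_sqr; unfold Rsqr; field; lra. }
  apply C_ext; rewrite ?Re_Cexp, ?Im_Cexp; simpl; rewrite exp_ln by exact P.
  - rewrite cos_atan, S; field; lra.
  - rewrite sin_atan, S; field; lra.
Qed.

Lemma continuous_arg_ratio (f g : C -> R) (z : C) :
  @continuous C_UniformSpace R_UniformSpace f z ->
  @continuous C_UniformSpace R_UniformSpace g z -> g z <> 0 ->
  @continuous C_UniformSpace R_UniformSpace (fun w => atan (f w / g w)) z.
Proof.
  intros Hf Hg Hz; apply (continuous_comp (fun w => f w / g w) atan); [| apply continuous_atan].
  apply (continuous_mult (K := R_AbsRing) f (fun w => / g w)); auto.
  apply (continuous_comp g Rinv); auto; apply continuous_Rinv; exact Hz.
Qed.

(** The derivative of an inverse function: continuity of [Clog] makes its increment [k] small, the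
    derivative of [Cexp] gives h = z * k up to e1 * |k|, and this in turn bounds |k| by 2 * |h| /
    |z|. *)
Lemma cderiv_Clog (z : C) : 0 < Re z -> cderiv Clog z (/ z).
Proof.
  intros Hz; pose proof (Cmod_pos_Re z Hz) as Pz.
  assert (Nz : z <> 0) by (apply Cmod_gt_0; exact Pz).
  intros e He.
  set (e1 := Rmin (e / 2 * (Cmod z * Cmod z)) (Cmod z / 2)).
  assert (Pe1 : 0 < e1) by (apply Rmin_pos; [repeat apply Rmult_lt_0_compat |]; lra).
  assert (E1 : e1 <= e / 2 * (Cmod z * Cmod z)) by apply Rmin_l.
  assert (E2 : e1 <= Cmod z / 2) by apply Rmin_r.
  destruct (cderiv_exp (Clog z) e1 Pe1) as [d1 [P1 H1]].
  destruct (continuous_eps (fun w => ln (Cmod w)) z) with (e := d1 / 2) as [d2 [P2 H2]].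
  { apply (continuous_comp Cmod ln); [apply continuous_Cmod | apply continuous_ln, Pz]. }
  { lra. }
  destruct (continuous_eps (fun w => atan (Im w / Re w)) z) with (e := d1 / 2) as [d3 [P3 H3]].
  { apply continuous_arg_ratio; [apply continuous_Im | apply continuous_Re | lra]. }
  { lra. }
  exists (Rmin (Rmin d2 d3) (Re z)); split; [apply Rmin_pos; [apply Rmin_pos |]; lra |].
  intros h Hs.
  apply Rmin_Rgt in Hs; destruct Hs as [Hs S4].
  apply Rmin_Rgt in Hs; destruct Hs as [S2 S3].
  assert (Pzh : 0 < Re (z + h)%C).
  { rewrite Re_plus; pose proof (Rabs_Re_le h) as B; pose proof (Rle_abs (- Re h)) as B'.
    rewrite Rabs_Ropp in B'; lra. }
  replace h with (z + h - z)%C in S2, S3 by ring.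
  specialize (H2 _ S2); specialize (H3 _ S3).
  set (k := (Clog (z + h) - Clog z)%C).
  assert (Sk : Cmod k < d1).
  { eapply Rle_lt_trans; [apply Cmod_le_sum |].
    change (Rabs (ln (Cmod (z + h)%C) - ln (Cmod z)) +
            Rabs (atan (Im (z + h)%C / Re (z + h)%C) - atan (Im z / Re z)) < d1); lra. }
  specialize (H1 k Sk).
  replace (Clog z + k)%C with (Clog (z + h)) in H1 by (unfold k; ring).
  rewrite !Cexp_Clog in H1 by assumption.
  replace (z + h - z - z * k)%C with (h - z * k)%C in H1 by ring.
  assert (Bk : Cmod k <= 2 / Cmod z * Cmod h).
  { pose proof (Cmod_triangle h (- (h - z * k))) as T; rewrite Cmod_opp in T.
    replace (h + - (h - z * k))%C with (z * k)%C in T by ring; rewrite Cmod_mult in T.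
    assert (Cmod z * Cmod k <= 2 * Cmod h) by (pose proof (Cmod_ge_0 k); nra).
    apply Rmult_le_reg_l with (Cmod z); [exact Pz |].
    replace (Cmod z * (2 / Cmod z * Cmod h)) with (2 * Cmod h) by (field; lra); assumption. }
  replace (k - / z * h)%C with (- (/ z * (h - z * k)))%C by (field; exact Nz).
  rewrite Cmod_opp, Cmod_mult, Cmod_inv by exact Nz.
  apply Rmult_le_reg_l with (Cmod z); [exact Pz |].
  rewrite <- Rmult_assoc, Rinv_r, Rmult_1_l by lra.
  eapply Rle_trans; [exact H1 |].
  apply Rle_trans with (e1 * (2 / Cmod z * Cmod h)); [apply Rmult_le_compat_l; lra |].
  apply Rle_trans with (e / 2 * (Cmod z * Cmod z) * (2 / Cmod z * Cmod h)).
  - apply Rmult_le_compat_r; [| exact E1].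
    apply Rmult_le_pos; [apply Rdiv_le_0_compat; lra | apply Cmod_ge_0].
  - apply Req_le; field; lra.
Qed.

Definition holomorphic_H (F : C -> C) : Prop :=
  forall z, 0 < Im z -> exists l, cderiv F z l.

(** Being a real part is the form in which Goursat's theorem applies and yields the mean value
    property; it is stable under sums and real multiples. *)
Definition harmonic_H (u : C -> R) : Prop :=
  exists F, holomorphic_H F /\ forall z, 0 < Im z -> u z = Re (F z).

(** The argument, only meaningful on the upper half plane. *)
Definition Harg (z : C) : R := PI / 2 - atan (Re z / Im z).

Lemma holomorphic_H_comp_plus (F : C -> C) (c : C) :
  holomorphic_H F -> holomorphic_H (fun z => F z + c)%C.
Proof.
  intros H z Hz; destruct (H z Hz) as [l Hl].
  eexists; apply cderiv_plus; [exact Hl | apply cderiv_const].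
Qed.

Lemma holomorphic_H_scal (F : C -> C) (c : C) :
  holomorphic_H F -> holomorphic_H (fun z => c * F z)%C.
Proof.
  intros H z Hz; destruct (H z Hz) as [l Hl]; eexists; apply cderiv_scal; exact Hl.
Qed.

Lemma holomorphic_H_id : holomorphic_H (fun z => z).
Proof. intros z _; eexists; apply cderiv_id. Qed.

Lemma harmonic_H_ext (u v : C -> R) :
  (forall z, 0 < Im z -> u z = v z) -> harmonic_H u -> harmonic_H v.
Proof.
  intros E [F [HF Hu]]; exists F; split; [exact HF |].
  intros z Hz; rewrite <- E by exact Hz; auto.
Qed.

Lemma harmonic_H_plus (u v : C -> R) :
  harmonic_H u -> harmonic_H v -> harmonic_H (fun z => u z + v z).
Proof.
  intros [F [HF Hu]] [G [HG Hv]]; exists (fun z => F z + G z)%C; split.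
  - intros z Hz; destruct (HF z Hz) as [l Hl]; destruct (HG z Hz) as [m Hm].
    eexists; apply cderiv_plus; eassumption.
  - intros z Hz; rewrite Hu, Hv by exact Hz; reflexivity.
Qed.

Lemma harmonic_H_scal (u : C -> R) (c : R) : harmonic_H u -> harmonic_H (fun z => c * u z).
Proof.
  intros [F [HF Hu]]; exists (fun z => c * F z)%C; split.
  - apply holomorphic_H_scal; exact HF.
  - intros z Hz; rewrite Hu by exact Hz; unfold Re; simpl; ring.
Qed.

Lemma harmonic_H_const (c : R) : harmonic_H (fun _ => c).
Proof.
  exists (fun _ => RtoC c); split; [| reflexivity].
  intros z _; eexists; apply cderiv_const.
Qed.

Lemma harmonic_H_minus (u v : C -> R) :
  harmonic_H u -> harmonic_H v -> harmonic_H (fun z => u z - v z).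
Proof.
  intros Hu Hv; apply harmonic_H_ext with (fun z => u z + (-1) * v z); [intros; ring |].
  apply harmonic_H_plus; [exact Hu | apply harmonic_H_scal; exact Hv].
Qed.

Lemma holomorphic_H_Clog (G : C -> C) :
  holomorphic_H G -> (forall z, 0 < Im z -> 0 < Re (G z)) ->
  holomorphic_H (fun z => Clog (G z)).
Proof.
  intros H HR z Hz; destruct (H z Hz) as [l Hl].
  eexists; apply cderiv_comp; [exact Hl | apply cderiv_Clog; auto].
Qed.

Lemma harmonic_H_ln_Re (G : C -> C) :
  holomorphic_H G -> (forall z, 0 < Im z -> 0 < Re (G z)) ->
  harmonic_H (fun z => ln (Cmod (G z))).
Proof.
  intros H HR; exists (fun z => Clog (G z)); split; [apply holomorphic_H_Clog; auto |].
  reflexivity.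
Qed.

Lemma harmonic_H_arg_Re (G : C -> C) :
  holomorphic_H G -> (forall z, 0 < Im z -> 0 < Re (G z)) ->
  harmonic_H (fun z => atan (Im (G z) / Re (G z))).
Proof.
  intros H HR; exists (fun z => - Ci * Clog (G z))%C; split.
  - apply holomorphic_H_scal, holomorphic_H_Clog; auto.
  - intros z _; simpl; ring.
Qed.

(** Multiplication by -i turns the upper half plane into the right one, where [Clog] is available,
    and preserves the modulus. *)
Lemma harmonic_H_ln (G : C -> C) :
  holomorphic_H G -> (forall z, 0 < Im z -> 0 < Im (G z)) ->
  harmonic_H (fun z => ln (Cmod (G z))).
Proof.
  intros H HI.
  apply harmonic_H_ext with (fun z => ln (Cmod (- Ci * G z)%C)).
  - intros z _; rewrite Cmod_mult, Cmod_opp, Cmod_Ci, Rmult_1_l; reflexivity.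
  - apply harmonic_H_ln_Re; [apply holomorphic_H_scal; exact H |].
    intros z Hz; specialize (HI z Hz); rewrite Re_mult; simpl; lra.
Qed.

Lemma harmonic_H_Harg (G : C -> C) :
  holomorphic_H G -> (forall z, 0 < Im z -> 0 < Im (G z)) ->
  harmonic_H (fun z => Harg (G z)).
Proof.
  intros H HI.
  apply harmonic_H_ext with
    (fun z => PI / 2 + atan (Im (- Ci * G z)%C / Re (- Ci * G z)%C)).
  - intros z Hz; specialize (HI z Hz); unfold Harg.
    replace (Im (- Ci * G z)%C / Re (- Ci * G z)%C) with (- (Re (G z) / Im (G z))).
    + rewrite atan_opp; ring.
    + rewrite Re_mult, Im_mult; simpl; field.
      lra.
  - apply harmonic_H_plus; [apply harmonic_H_const |].
    apply harmonic_H_arg_Re; [apply holomorphic_H_scal; exact H |].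
    intros z Hz; specialize (HI z Hz); rewrite Re_mult; simpl; lra.
Qed.

Lemma Harg_bounds (z : C) : 0 < Harg z < PI.
Proof. unfold Harg; pose proof (atan_bound (Re z / Im z)); lra. Qed.

Lemma cderiv_differentiable (F : C -> C) (x y : R) (l : C) :
  cderiv F (x, y) l ->
  differentiable_pt_lim (fun s t => Re (F (s, t))) x y (Re l) (- Im l) /\
  differentiable_pt_lim (fun s t => Im (F (s, t))) x y (Im l) (Re l).
Proof.
  intros H.
  assert (K : forall e : posreal, locally_2d (fun u v =>
     Cmod (F (u, v) - F (x, y) - l * ((u - x)%R, (v - y)%R))%C
       <= e * Rmax (Rabs (u - x)) (Rabs (v - y))) x y).
  { intros e; pose proof (cond_pos e) as Pe.
    destruct (H (e / 2)) as [d [Hd Hh]]; [lra |].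
    assert (P : 0 < d / 2) by lra; exists (mkposreal _ P); simpl; intros u v Hu Hv.
    assert (B : Cmod (u - x, v - y) <= 2 * Rmax (Rabs (u - x)) (Rabs (v - y))).
    { eapply Rle_trans; [apply Cmod_le_sum |]; simpl.
      pose proof (Rmax_l (Rabs (u - x)) (Rabs (v - y)));
        pose proof (Rmax_r (Rabs (u - x)) (Rabs (v - y))); lra. }
    assert (B' : Cmod (u - x, v - y) < d).
    { eapply Rle_lt_trans; [apply Cmod_le_sum |]; simpl; lra. }
    specialize (Hh _ B').
    replace ((x, y) + ((u - x)%R, (v - y)%R))%C with (u, v) in Hh
      by (apply C_ext; simpl; ring).
    eapply Rle_trans; [exact Hh |]; nra. }
  split; intros e; destruct (K e) as [d Hd]; exists d; intros u v Hu Hv;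
    specialize (Hd u v Hu Hv); eapply Rle_trans; try exact Hd.
  - eapply Rle_trans; [| apply Rabs_Re_le]; apply Req_le; f_equal; simpl; unfold Re, Im; ring.
  - eapply Rle_trans; [| apply Rabs_Im_le]; apply Req_le; f_equal; simpl; unfold Re, Im; ring.
Qed.

Lemma circle_in_H (b : C) (rho theta : R) :
  exp rho < Im b -> 0 < Im (b + Cexp (rho, theta))%C.
Proof.
  intros H; rewrite Im_plus; pose proof (Rabs_Im_le (Cexp (rho, theta))) as B.
  rewrite Cmod_Cexp in B; change (Re (rho, theta)) with rho in B.
  pose proof (Rle_abs (- Im (Cexp (rho, theta)))) as B'; rewrite Rabs_Ropp in B'; lra.
Qed.

(** In the coordinate [z = b + exp (rho + i theta)] the circles around [b] are vertical segments,
    and the horizontal sides of a rectangle of height [2 PI] cancel by periodicity. *)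
Lemma mean_value (F : C -> C) (b : C) (r : R) :
  holomorphic_H F -> r < ln (Im b) -> 0 < Im b ->
  (forall t, continuous (fun t => Re (F (b + Cexp (r, t))%C)) t) /\
  RInt (fun t => Re (F (b + Cexp (r, t))%C)) 0 (2 * PI) = 2 * PI * Re (F b).
Proof.
  intros HF Hr Hb.
  set (U := fun s t : R => Re (F (b + Cexp (s, t))%C)).
  set (V := fun s t : R => Im (F (b + Cexp (s, t))%C)).
  assert (Hexp : forall s, s <= r -> exp s < Im b).
  { intros s Hs; rewrite <- (exp_ln (Im b)) by exact Hb; apply exp_increasing; lra. }
  assert (D : forall s t, s <= r -> exists p q s', differentiable_pt_lim U s t p q /\
                                                   differentiable_pt_lim V s t s' p).
  { intros s t Hs; destruct (HF (b + Cexp (s, t))%C) as [l Hl].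
    { apply circle_in_H, Hexp, Hs. }
    assert (Hd : cderiv (fun z => F (b + Cexp z)%C) (s, t) (l * (0 + Cexp (s, t)))%C).
    { apply (cderiv_comp F (fun z => b + Cexp z)%C); [| exact Hl].
      apply cderiv_plus; [apply cderiv_const | apply cderiv_exp]. }
    apply cderiv_differentiable in Hd; destruct Hd as [H1 H2].
    do 3 eexists; split; [exact H1 | exact H2]. }
  assert (CU : forall s t, s <= r -> continuous (fun t => U s t) t).
  { intros s t Hs; destruct (D s t Hs) as (p & q & s' & H1 & _).
    eapply differentiable_section_r; exact H1. }
  split; [intros t; exact (CU r t (Rle_refl r)) |].
  assert (EU : forall s, s <= r -> ex_RInt (fun t => U s t) 0 (2 * PI)).
  { intros s Hs; apply (ex_RInt_continuous (V := R_CompleteNormedModule));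
      intros t _; apply CU; exact Hs. }
  pose proof PI_RGT_0 as HPI.
  assert (Same : forall s, s < r ->
            RInt (fun t => U r t) 0 (2 * PI) = RInt (fun t => U s t) 0 (2 * PI)).
  { intros s Hs.
    assert (Z : flux U V s r 0 (2 * PI) = 0).
    { apply flux_zero; try lra; intros x y Hx Hy; apply D; lra. }
    unfold flux in Z.
    rewrite (RInt_ext (fun x => V x (2 * PI) - V x 0) (fun _ => 0)) in Z.
    2: { intros x _; apply Rminus_diag_eq; unfold V.
         replace (Cexp (x, 2 * PI)) with (Cexp (x, 0)); [reflexivity |].
         apply C_ext; rewrite ?Re_Cexp, ?Im_Cexp; simpl;
           rewrite ?cos_2PI, ?sin_2PI, ?cos_0, ?sin_0; reflexivity. }
    rewrite RInt_const in Z.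
    rewrite (RInt_minus (V := R_CompleteNormedModule) (fun t => U r t) (fun t => U s t)) in Z
      by (apply EU; lra).
    unfold minus, plus, opp, scal in Z; simpl in Z; unfold mult in Z; simpl in Z; lra. }
  apply NNPP; intros Hne.
  set (gap := Rabs (RInt (fun t => U r t) 0 (2 * PI) - 2 * PI * Re (F b))).
  assert (Hgap : 0 < gap) by (apply Rabs_pos_lt; unfold U in *; lra).
  destruct (HF b Hb) as [l Hl].
  destruct (cderiv_continuous F b l Hl (gap / (4 * PI))) as [e [Pe He]];
    [apply Rdiv_lt_0_compat; lra |].
  (* On the circle of radius exp s < e the real part differs from its value at the centre by at most
     gap / (4 * PI). The integral is then off by at most gap / 2, against the choice of [gap]. *)
  set (s := Rmin (r - 1) (ln e - 1)).
  assert (Hs : s < r) by (unfold s; pose proof (Rmin_l (r - 1) (ln e - 1)); lra).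
  assert (Es : exp s < e).
  { rewrite <- (exp_ln e) by exact Pe; apply exp_increasing.
    unfold s; pose proof (Rmin_r (r - 1) (ln e - 1)); lra. }
  assert (B : Rabs (RInt (fun t => U s t) 0 (2 * PI) - Re (F b) * (2 * PI - 0))
              <= gap / (4 * PI) * (2 * PI - 0)).
  { apply RInt_near_const; [lra | intros; apply CU; lra |].
    intros t _; unfold U.
    change (Re (F (b + Cexp (s, t))%C) - Re (F b)) with (Re (F (b + Cexp (s, t)) - F b)%C).
    eapply Rle_trans; [apply Rabs_Re_le |]; left; apply He.
    replace (b + Cexp (s, t) - b)%C with (Cexp (s, t)) by ring; rewrite Cmod_Cexp; exact Es. }
  rewrite <- (Same s Hs) in B.
  replace (gap / (4 * PI) * (2 * PI - 0)) with (gap / 2) in B by (field; lra).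
  replace (Re (F b) * (2 * PI - 0)) with (2 * PI * Re (F b)) in B by ring.
  fold gap in B; lra.
Qed.

(** * The maximum principle *)

Definition at_boundary (t : R) : (C -> Prop) -> Prop :=
  within (fun z : C => 0 < Im z) (@locally C_UniformSpace (RtoC t)).

Lemma at_boundary_iff (t : R) (P : C -> Prop) :
  at_boundary t P <-> exists d, 0 < d /\ forall z, 0 < Im z -> Cmod (z - t)%C < d -> P z.
Proof.
  unfold at_boundary, within; rewrite locally_Cmod; split; intros [d [Hd H]];
    exists d; split; auto.
Qed.

Lemma harmonic_H_continuous (u : C -> R) (z : C) :
  harmonic_H u -> 0 < Im z -> forall e, 0 < e -> exists d, 0 < d /\
    forall w, 0 < Im w -> Cmod (w - z)%C < d -> Rabs (u w - u z) < e.
Proof.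
  intros [F [HF Hu]] Hz e He; destruct (HF z Hz) as [l Hl].
  destruct (cderiv_continuous F z l Hl e He) as [d [Hd H]]; exists d; split; [exact Hd |].
  intros w Hw Hs; rewrite !Hu by assumption.
  change (Re (F w) - Re (F z)) with (Re (F w - F z)%C).
  eapply Rle_lt_trans; [apply Rabs_Re_le | apply H, Hs].
Qed.

(** On a circle with centre abscissa [a] and radius [r], integrating the bound s - k * x^2 loses k *
    r^2 * PI against its value at the centre: the strict gap that excludes an interior maximum. *)
Lemma RInt_quadratic_cos (s k a r : R) :
  is_RInt (fun t => s - k * (a + r * cos t) ^ 2) 0 (2 * PI)
    (2 * PI * (s - k * a ^ 2) - k * r ^ 2 * PI).
Proof.
  set (G := fun t => (s - k * a ^ 2) * t - 2 * k * a * r * sin t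
                     - k * r ^ 2 * (t / 2 + sin t * cos t / 2)).
  replace (2 * PI * (s - k * a ^ 2) - k * r ^ 2 * PI) with (minus (G (2 * PI)) (G 0)).
  2: { unfold minus, plus, opp, G; simpl; rewrite sin_2PI, cos_2PI, sin_0, cos_0; field. }
  apply (is_RInt_derive G).
  - intros t _; unfold G; auto_derive; [exact I |].
    pose proof (sin2_cos2 t) as H; unfold Rsqr in H.
    replace (sin t * (1 * - sin t)) with (cos t * cos t - 1) by lra.
    field.
  - intros t _; apply continuity_pt_filterlim; reg.
Qed.

(** The perturbation [u + k x^2] is strictly subharmonic, hence has no interior maximum. *)
Lemma maximum_principle_infty (u : C -> R) (B : R) :
  harmonic_H u -> (forall z, 0 < Im z -> u z <= B) ->
  (forall t e, 0 < e -> at_boundary t (fun z => u z <= e)) ->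
  (forall e, 0 < e -> exists M, forall z, 0 < Im z -> M < Cmod z -> u z <= e) ->
  forall z, 0 < Im z -> u z <= 0.
Proof.
  intros Hu HB Hbd Hinf z0 Hz0; apply Rnot_lt_le; intros Hm; set (m := u z0) in *.
  destruct (Hinf (m / 4)) as [M HM]; [lra |].
  set (R0 := Rmax M 1).
  assert (R0M : M <= R0) by apply Rmax_l; assert (R01 : 1 <= R0) by apply Rmax_r.
  (* Keeps k * x^2 at most m / 4 for |x| <= 2 * R0. Wherever u <= m / 4 the perturbed function is
     then at most m / 2, well below its supremum. *)
  set (k := m / (16 * R0 ^ 2)).
  assert (PR : 0 < R0 ^ 2) by (apply pow_lt; lra).
  assert (Pk : 0 < k) by (unfold k; apply Rdiv_lt_0_compat; lra).
  set (v := fun z : C => u z + k * (Re z) ^ 2).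
  assert (Hk : forall x, Rabs x <= 2 * R0 -> 0 <= k * x ^ 2 <= m / 4).
  { intros x Hx; rewrite <- pow2_abs; split; [pose proof (pow2_ge_0 (Rabs x)); nra |].
    apply Rle_trans with (k * (2 * R0) ^ 2).
    - apply Rmult_le_compat_l; [lra | apply pow_incr; split; [apply Rabs_pos | exact Hx]].
    - unfold k; apply Req_le; field; lra. }
  set (box := fun z : C => Rabs (Re z) <= 2 * R0 /\ 0 < Im z <= 2 * R0).
  assert (In0 : forall z, 0 < Im z -> m / 4 < u z -> Cmod z <= R0).
  { intros z Hz Hu4; apply Rnot_lt_le; intros L; specialize (HM z Hz); lra. }
  assert (Bz0 : box z0).
  { specialize (In0 z0 Hz0 ltac:(fold m; lra)); pose proof (Rabs_Re_le z0);
      pose proof (Rabs_Im_le z0); pose proof (Rle_abs (Im z0)); unfold box; lra. }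
  destruct (completeness (fun r => exists z, box z /\ r = v z)) as [S [S1 S2]].
  { exists (B + m / 4); intros r [z [[Hz1 Hz2] ->]]; unfold v.
    specialize (HB z ltac:(lra)); specialize (Hk (Re z) Hz1); lra. }
  { exists (v z0), z0; auto. }
  assert (Sm : m <= S).
  { apply Rle_trans with (v z0); [| apply S1; exists z0; auto].
    unfold v; fold m; destruct Bz0 as [Hz1 _]; specialize (Hk _ Hz1); lra. }
  assert (Hb : exists b, box b /\ v b = S).
  { apply NNPP; intros No.
    (* The box misses its bottom side, so attainment is proved by covering its closure: if [v] never
       took the value [S], every point of the closure would have a radius [d] with v <= S - d
       nearby, and compactness would lower the supremum. *)
    assert (Gauge : forall x y, exists d : posreal, -(2 * R0) <= x <= 2 * R0 -> 0 <= y <= 2 * R0 ->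
       forall z, box z -> Rabs (Re z - x) < d -> Rabs (Im z - y) < d -> v z <= S - d).
    { intros x y.
      destruct (classic (-(2 * R0) <= x <= 2 * R0 /\ 0 <= y <= 2 * R0)) as [[Hx Hy] | Hn].
      2: { exists (mkposreal 1 Rlt_0_1); intros; exfalso; apply Hn; auto. }
      destruct (Rle_lt_or_eq_dec 0 y (proj1 Hy)) as [Py | Ey].
      - set (p := (x, y) : C).
        assert (Bp : box p) by (split; simpl; [apply Rabs_le; lra | lra]).
        assert (Lp : v p < S).
        { destruct (Rle_lt_or_eq_dec (v p) S) as [L | E]; auto.
          - apply S1; exists p; auto.
          - exfalso; apply No; exists p; auto. }
        destruct (harmonic_H_continuous u p Hu Py ((S - v p) / 4)) as [d1 [P1 H1]]; [lra |].
        destruct (continuous_eps (fun z : C => k * Re z ^ 2) p) with (e := (S - v p) / 4)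
          as [d2 [P2 H2]]; [| lra |].
        { apply (continuous_comp Re (fun r => k * r ^ 2)); [apply continuous_Re |].
          apply continuity_pt_filterlim; reg. }
        assert (Pd : 0 < Rmin (Rmin (d1 / 2) (d2 / 2)) ((S - v p) / 2)).
        { repeat apply Rmin_pos; lra. }
        exists (mkposreal _ Pd); intros _ _ z Bz Z1 Z2; simpl in *.
        pose proof (Rmin_l (Rmin (d1 / 2) (d2 / 2)) ((S - v p) / 2)).
        pose proof (Rmin_r (Rmin (d1 / 2) (d2 / 2)) ((S - v p) / 2)).
        pose proof (Rmin_l (d1 / 2) (d2 / 2)); pose proof (Rmin_r (d1 / 2) (d2 / 2)).
        assert (Dz : Cmod (z - p)%C < d1 /\ Cmod (z - p)%C < d2).
        { pose proof (Cmod_le_sum (z - p)%C) as T.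
          change (Re (z - p)%C) with (Re z - x) in T; change (Im (z - p)%C) with (Im z - y) in T.
          lra. }
        destruct Dz as [Dz1 Dz2]; destruct Bz as [Bz1 Bz2].
        specialize (H1 z ltac:(lra) Dz1); specialize (H2 z Dz2).
        apply Rabs_lt_between in H1; apply Rabs_lt_between in H2; unfold v in *; simpl in *; lra.
      - destruct (proj1 (at_boundary_iff x _) (Hbd x (m / 4) ltac:(lra))) as [d [Pd Hd]].
        assert (Pd2 : 0 < Rmin (d / 2) (m / 2)) by (apply Rmin_pos; lra).
        exists (mkposreal _ Pd2); intros _ _ z [Bz1 Bz2] Z1 Z2; simpl in *.
        pose proof (Rmin_l (d / 2) (m / 2)); pose proof (Rmin_r (d / 2) (m / 2)).
        assert (Dz : Cmod (z - x)%C < d).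
        { pose proof (Cmod_le_sum (z - x)%C) as T.
          change (Re (z - x)%C) with (Re z - x) in T; change (Im (z - x)%C) with (Im z - 0) in T.
          rewrite <- Ey in Z2; lra. }
        specialize (Hd z ltac:(lra) Dz); specialize (Hk (Re z) Bz1); unfold v; lra. }
    destruct (compactness_value_2d (-(2 * R0)) (2 * R0) 0 (2 * R0)
      (fun x y => proj1_sig (constructive_indefinite_description _ (Gauge x y)))) as [d Hd].
    assert (Up : S <= S - d); [| pose proof (cond_pos d); lra].
    apply S2; intros r [z [Bz ->]]; apply Rnot_lt_le; intros L.
    pose proof Bz as [Bz1 Bz2]; apply Rabs_le_between in Bz1.
    apply (Hd (Re z) (Im z) Bz1 ltac:(lra)); intros (x & y & Hx & Hy & D1 & D2 & D3).
    destruct (constructive_indefinite_description _ (Gauge x y)) as [e He]; simpl in *.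
    specialize (He Hx Hy z Bz D1 D2); lra. }
  destruct Hb as [b [Bb Eb]]; pose proof Bb as [Bb1 Bb2].
  assert (Cb : Cmod b <= R0).
  { apply In0; [lra |]; unfold v in Eb; specialize (Hk _ Bb1); lra. }
  (* The circle around [b] stays in the half plane and, as |b| <= R0, in the box, where v <= S. *)
  set (rho := Rmin (Im b) R0 / 2).
  assert (Prho : 0 < rho < Im b /\ rho <= R0).
  { unfold rho; assert (0 < Rmin (Im b) R0) by (apply Rmin_pos; lra).
    pose proof (Rmin_l (Im b) R0); lra. }
  destruct Hu as [F [HF Hu]].
  destruct (mean_value F b (ln rho) HF) as [MC MV].
  { apply ln_increasing; lra. }
  { lra. }
  assert (Le : RInt (fun t => Re (F (b + Cexp (ln rho, t))%C)) 0 (2 * PI)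
               <= 2 * PI * (S - k * Re b ^ 2) - k * rho ^ 2 * PI).
  { rewrite <- (is_RInt_unique _ _ _ _ (RInt_quadratic_cos S k (Re b) rho)).
    pose proof PI_RGT_0; apply RInt_le; [lra | | |].
    - apply (ex_RInt_continuous (V := R_CompleteNormedModule)); intros; apply MC.
    - eexists; apply RInt_quadratic_cos.
    - intros t _.
      assert (Hz : 0 < Im (b + Cexp (ln rho, t))%C).
      { apply circle_in_H; rewrite exp_ln; lra. }
      set (z := (b + Cexp (ln rho, t))%C) in *.
      assert (Rz : Re z = Re b + rho * cos t).
      { unfold z; rewrite Re_plus, Re_Cexp; simpl; rewrite exp_ln by lra; reflexivity. }
      assert (Cz : Cmod z <= 2 * R0).
      { unfold z; eapply Rle_trans; [apply Cmod_triangle |]; rewrite Cmod_Cexp; simpl.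
        rewrite exp_ln; lra. }
      assert (Vz : v z <= S).
      { apply S1; exists z; split; [| reflexivity].
        pose proof (Rabs_Re_le z); pose proof (Rabs_Im_le z); pose proof (Rle_abs (Im z)).
        unfold box; lra. }
      unfold v in Vz; rewrite <- Hu, <- Rz by exact Hz; lra. }
  rewrite MV, <- Hu in Le by lra; unfold v in Eb; pose proof PI_RGT_0.
  assert (0 < k * rho ^ 2 * PI).
  { apply Rmult_lt_0_compat; [apply Rmult_lt_0_compat; [lra | apply pow_lt; lra] | lra]. }
  rewrite <- Eb in Le; lra.
Qed.

Lemma ln_ge_0 (x : R) : 1 <= x -> 0 <= ln x.
Proof. intros; rewrite <- ln_1; apply ln_le; lra. Qed.

Lemma Cmod_plus_Ci (z : C) : 0 < Im z -> 1 <= Cmod (z + Ci)%C /\ Cmod z - 1 <= Cmod (z + Ci)%C.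
Proof.
  intros Hz; split.
  - pose proof (Rabs_Im_le (z + Ci)%C) as B; rewrite Im_plus in B; simpl in B.
    pose proof (Rle_abs (Im z + 1)); lra.
  - pose proof (Cmod_triangle (z + Ci) (- Ci)) as T; rewrite Cmod_opp, Cmod_Ci in T.
    replace (z + Ci + - Ci)%C with z in T by ring; lra.
Qed.

(** Three exceptional boundary points [a1], [a2] and infinity are allowed, thanks to the barrier
    [ln |z - a1| + ln |z - a2| - 3 ln |z + i|]. *)
Lemma maximum_principle (u : C -> R) (a1 a2 B : R) :
  harmonic_H u -> (forall z, 0 < Im z -> u z <= B) ->
  (forall t e, t <> a1 -> t <> a2 -> 0 < e -> at_boundary t (fun z => u z <= e)) ->
  forall z, 0 < Im z -> u z <= 0.
Proof.
  intros Hu HB Hbd.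
  set (K := fun a : R => ln (1 + Cmod (a + Ci)%C)).
  assert (HK : forall a, 0 <= K a).
  { intros a; apply ln_ge_0; pose proof (Cmod_ge_0 (a + Ci)%C); lra. }
  assert (Pos : forall (a : R) z, 0 < Im z -> 0 < Cmod (z - a)%C).
  { intros a z Hz; apply Cmod_pos_Im; change (0 < Im z - 0); lra. }
  assert (Bar : forall (a : R) z, 0 < Im z -> ln (Cmod (z - a)%C) <= K a + ln (Cmod (z + Ci)%C)).
  { intros a z Hz; destruct (Cmod_plus_Ci z Hz) as [H1 _].
    pose proof (Cmod_ge_0 (a + Ci)%C) as Pa.
    unfold K; rewrite <- ln_mult by lra; apply ln_le; [apply Pos, Hz |].
    pose proof (Cmod_triangle (z + Ci) (- (a + Ci))) as T; rewrite Cmod_opp in T.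
    replace (z + Ci + - (a + Ci))%C with (z - a)%C in T by ring; nra. }
  (* Two of the three copies of ln |z + i| absorb the growth of the other logarithms; the third one
     sends [s] to minus infinity at infinity. *)
  set (s := fun z : C => ln (Cmod (z - a1)%C) + ln (Cmod (z - a2)%C)
                         + ((-3) * ln (Cmod (z + Ci)%C) + - (K a1 + K a2))).
  assert (Hs : harmonic_H s).
  { repeat apply harmonic_H_plus.
    - apply (harmonic_H_ln (fun z => z + - a1)%C); [apply holomorphic_H_comp_plus, holomorphic_H_id |].
      intros z Hz; change (0 < Im z + - 0); lra.
    - apply (harmonic_H_ln (fun z => z + - a2)%C); [apply holomorphic_H_comp_plus, holomorphic_H_id |].
      intros z Hz; change (0 < Im z + - 0); lra.
    - apply harmonic_H_scal, (harmonic_H_ln (fun z => z + Ci)%C);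
        [apply holomorphic_H_comp_plus, holomorphic_H_id |].
      intros z Hz; change (0 < Im z + 1); lra.
    - apply harmonic_H_const. }
  assert (S0 : forall z, 0 < Im z -> s z <= - ln (Cmod (z + Ci)%C) /\ s z <= 0 /\
             s z <= ln (Cmod (z - a1)%C) /\ s z <= ln (Cmod (z - a2)%C)).
  { intros z Hz; pose proof (Bar a1 z Hz); pose proof (Bar a2 z Hz).
    destruct (Cmod_plus_Ci z Hz) as [H1 _]; pose proof (ln_ge_0 _ H1).
    pose proof (HK a1); pose proof (HK a2); unfold s; lra. }
  assert (Key : forall h, 0 < h -> forall z, 0 < Im z -> u z + h * s z <= 0).
  { intros h Hh; apply maximum_principle_infty with (B := B).
    - apply harmonic_H_plus; [exact Hu | apply harmonic_H_scal; exact Hs].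
    - intros z Hz; specialize (HB z Hz); destruct (S0 z Hz) as (_ & H & _); nra.
    - intros t e He.
      assert (Sing : forall a : R, (forall z, 0 < Im z -> s z <= ln (Cmod (z - a)%C)) ->
                at_boundary a (fun z => u z + h * s z <= e)).
      { intros a Ha; apply at_boundary_iff; exists (exp (- Rabs B / h)); split; [apply exp_pos |].
        intros z Hz Hd; specialize (HB z Hz); specialize (Ha z Hz).
        apply ln_increasing in Hd; [| apply Pos, Hz]; rewrite ln_exp in Hd.
        assert (s z * h <= - Rabs B / h * h) by (apply Rmult_le_compat_r; lra).
        replace (- Rabs B / h * h) with (- Rabs B) in H by (field; lra).
        pose proof (Rle_abs B); lra. }
      destruct (Req_dec t a1) as [-> | N1]; [apply Sing; intros; apply S0; assumption |].
      destruct (Req_dec t a2) as [-> | N2]; [apply Sing; intros; apply S0; assumption |].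
      destruct (proj1 (at_boundary_iff _ _) (Hbd t e N1 N2 He)) as [d [Hd H]].
      apply at_boundary_iff; exists d; split; [exact Hd |]; intros z Hz Dz.
      specialize (H z Hz Dz); destruct (S0 z Hz) as (_ & H' & _); nra.
    - intros e He; exists (exp (Rabs B / h) + 1); intros z Hz Hd.
      destruct (Cmod_plus_Ci z Hz) as [_ H1]; destruct (S0 z Hz) as (H2 & _).
      assert (H3 : Rabs B / h <= ln (Cmod (z + Ci)%C)).
      { rewrite <- (ln_exp (Rabs B / h)); apply ln_le; [apply exp_pos | lra]. }
      assert (h * s z <= h * (- (Rabs B / h))) by (apply Rmult_le_compat_l; lra).
      replace (h * (- (Rabs B / h))) with (- Rabs B) in H by (field; lra).
      specialize (HB z Hz); pose proof (Rle_abs B); lra. }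
  intros z Hz; apply Rnot_lt_le; intros L.
  destruct (S0 z Hz) as (_ & Sz & _).
  (* With this multiplier [h] one has h * s z >= - u z / 2, so u z + h * s z would stay positive. *)
  specialize (Key (u z / (2 * (1 - s z)))); specialize (Key ltac:(apply Rdiv_lt_0_compat; lra) z Hz).
  assert (E : u z / (2 * (1 - s z)) * s z = - (u z / 2) * (- s z / (1 - s z))) by (field; lra).
  assert (Q : - s z / (1 - s z) <= 1).
  { apply Rmult_le_reg_r with (1 - s z); [lra |]; field_simplify; lra. }
  rewrite E in Key; nra.
Qed.

(** * Arguments and angles *)

Lemma atan_sandwich (v : R) : 0 < v -> v / (1 + v ^ 2) <= atan v <= v.
Proof.
  intros Hv.
  destruct (MVT_cor2 atan (fun x => / (1 + x ^ 2)) 0 v Hv) as [c [Hc1 Hc2]].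
  { intros c _; apply derivable_pt_lim_atan. }
  rewrite atan_0, !Rminus_0_r in Hc1; rewrite Hc1; split.
  - unfold Rdiv; rewrite Rmult_comm; apply Rmult_le_compat_r; [lra |].
    apply Rinv_le_contravar; nra.
  - rewrite <- (Rmult_1_l v) at 2; apply Rmult_le_compat_r; [lra |].
    rewrite <- Rinv_1; apply Rinv_le_contravar; nra.
Qed.

Lemma Harg_Re_pos (z : C) : 0 < Im z -> 0 < Re z -> Harg z = atan (Im z / Re z).
Proof.
  intros HI HR; unfold Harg.
  replace (Re z / Im z) with (/ (Im z / Re z)) by (field; lra).
  rewrite atan_inv by (apply Rdiv_lt_0_compat; lra); ring.
Qed.

Lemma Harg_reflect (x y : R) : Harg (- x, y) = PI - Harg (x, y).
Proof.
  unfold Harg; simpl; replace (- x / y) with (- (x / y)) by (unfold Rdiv; ring).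
  rewrite atan_opp; field.
Qed.

Lemma Harg_le_iff (z w : C) : Harg z <= Harg w <-> Re w / Im w <= Re z / Im z.
Proof.
  unfold Harg; split; intros H.
  - apply Rnot_lt_le; intros L; apply atan_increasing in L; lra.
  - destruct H as [L | E]; [apply atan_increasing in L; lra | rewrite E; lra].
Qed.

Lemma Harg_polar (rho phi : R) (z : C) :
  0 < rho -> 0 < phi < PI -> Re z = rho * cos phi -> Im z = rho * sin phi -> Harg z = phi.
Proof.
  intros Hr Hp HR HI; unfold Harg; rewrite HR, HI.
  pose proof (sin_gt_0 phi (proj1 Hp) (proj2 Hp)) as Hs.
  replace (rho * cos phi / (rho * sin phi)) with (tan (PI / 2 - phi)).
  - rewrite atan_tan by lra; ring.
  - unfold tan; rewrite sin_shift, cos_shift; field; lra.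
Qed.

Lemma Harg_spec (z : C) :
  0 < Im z -> Re z = Cmod z * cos (Harg z) /\ Im z = Cmod z * sin (Harg z).
Proof.
  intros Hz; unfold Harg; rewrite cos_shift, sin_shift, sin_atan, cos_atan.
  pose proof (Cmod_pos_Im z Hz) as P.
  assert (S : sqrt (1 + (Re z / Im z)²) = Cmod z / Im z).
  { apply sqrt_lem_1.
    - unfold Rsqr; nra.
    - apply Rdiv_le_0_compat; lra.
    - replace (Cmod z / Im z * (Cmod z / Im z)) with (Cmod z * Cmod z / (Im z * Im z)) by (field; lra).
      rewrite Cmod_sqr; unfold Rsqr; field; lra. }
  rewrite S; split; field; lra.
Qed.

(** The difference lies in (0, PI), hence is the argument of w times the conjugate of z. This turns
    the angle under which a segment is seen into a rational expression. *)
Lemma Harg_minus (z w : C) :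
  0 < Im z -> 0 < Im w -> Harg z < Harg w ->
  Harg w - Harg z = Harg (w * Cconj z)%C.
Proof.
  intros Hz Hw Hlt; symmetry.
  destruct (Harg_spec z Hz) as [Z1 Z2]; destruct (Harg_spec w Hw) as [W1 W2].
  apply Harg_polar with (Cmod w * Cmod z).
  - apply Rmult_lt_0_compat; apply Cmod_pos_Im; assumption.
  - pose proof (Harg_bounds z); pose proof (Harg_bounds w); lra.
  - rewrite cos_minus, Re_mult.
    change (Re w * Re z - Im w * - Im z =
      Cmod w * Cmod z * (cos (Harg w) * cos (Harg z) + sin (Harg w) * sin (Harg z))).
    rewrite Z1 at 1; rewrite Z2 at 1; rewrite W1 at 1; rewrite W2 at 1; ring.
  - rewrite sin_minus, Im_mult.
    change (Re w * - Im z + Im w * Re z =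
      Cmod w * Cmod z * (sin (Harg w) * cos (Harg z) - cos (Harg w) * sin (Harg z))).
    rewrite Z1 at 1; rewrite Z2 at 1; rewrite W1 at 1; rewrite W2 at 1; ring.
Qed.

Lemma Harg_shift_lt (z : C) (c : R) : 0 < Im z -> 0 < c -> Harg z < Harg (z - c)%C.
Proof.
  intros Hz Hc; unfold Harg.
  change (Re (z - c)%C) with (Re z - c); change (Im (z - c)%C) with (Im z - 0).
  assert (L : (Re z - c) / (Im z - 0) < Re z / Im z).
  { rewrite Rminus_0_r; apply Rmult_lt_compat_r; [apply Rinv_0_lt_compat |]; lra. }
  apply atan_increasing in L; lra.
Qed.

(** * Boundary limits from the open half plane *)

Definition lim_boundary (F : C -> C) (t : R) (c : C) : Prop :=
  forall e, 0 < e -> at_boundary t (fun z => Cmod (F z - c)%C < e).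

Global Instance at_boundary_filter (t : R) : Filter (at_boundary t).
Proof. unfold at_boundary; apply within_filter, locally_filter. Qed.

Lemma at_boundary_H (t : R) : at_boundary t (fun z => 0 < Im z).
Proof. apply at_boundary_iff; exists 1; split; [lra | auto]. Qed.

Lemma at_boundary_and (t : R) (P Q : C -> Prop) :
  at_boundary t P -> at_boundary t Q -> at_boundary t (fun z => P z /\ Q z).
Proof. exact (@filter_and _ (at_boundary t) _ P Q). Qed.

Lemma lim_boundary_comp (F G : C -> C) (t : R) (c l : C) :
  lim_boundary G t c -> cderiv F c l -> lim_boundary (fun z => F (G z)) t (F c).
Proof.
  intros HG HF e He; destruct (cderiv_continuous F c l HF e He) as [d [Hd H]].
  apply filter_imp with (2 := HG d Hd); intros z Hz; apply H, Hz.
Qed.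

Lemma lim_boundary_id (t : R) : lim_boundary (fun z => z) t t.
Proof. intros e He; apply at_boundary_iff; exists e; auto. Qed.

Lemma lim_boundary_plus (F : C -> C) (t : R) (c k : C) :
  lim_boundary F t c -> lim_boundary (fun z => F z + k)%C t (c + k).
Proof.
  intros H e He; apply filter_imp with (2 := H e He); intros z Hz.
  replace (F z + k - (c + k))%C with (F z - c)%C by ring; exact Hz.
Qed.

Lemma Harg_lim_pos (F : C -> C) (t c e : R) :
  (forall z, 0 < Im z -> 0 < Im (F z)) -> lim_boundary F t c -> 0 < c -> 0 < e ->
  at_boundary t (fun z => Harg (F z) <= e).
Proof.
  intros HF Hlim Hc He.
  assert (P : 0 < Rmin (c / 2) (c / 2 * e)).
  { apply Rmin_pos; [lra | apply Rmult_lt_0_compat; lra]. }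
  apply filter_imp with (2 := at_boundary_and _ _ _ (Hlim _ P) (at_boundary_H t)).
  intros z [Hz Iz]; specialize (HF z Iz).
  apply Rmin_Rgt in Hz; destruct Hz as [Z1 Z2].
  pose proof (Rabs_Re_le (F z - c)%C) as R1; pose proof (Rabs_Im_le (F z - c)%C) as R2.
  change (Re (F z - c)%C) with (Re (F z) - c) in R1; change (Im (F z - c)%C) with (Im (F z) - 0) in R2.
  rewrite Rminus_0_r, Rabs_right in R2 by lra.
  assert (R3 := Rle_lt_trans _ _ _ R1 Z1); apply Rabs_lt_between in R3.
  rewrite Harg_Re_pos by lra.
  eapply Rle_trans; [apply atan_sandwich, Rdiv_lt_0_compat; lra |].
  apply Rmult_le_reg_r with (Re (F z)); [lra |].
  unfold Rdiv; rewrite Rmult_assoc, Rinv_l by lra; nra.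
Qed.

Lemma Harg_lim_neg (F : C -> C) (t c e : R) :
  (forall z, 0 < Im z -> 0 < Im (F z)) -> lim_boundary F t c -> c < 0 -> 0 < e ->
  at_boundary t (fun z => PI - e <= Harg (F z)).
Proof.
  intros HF Hlim Hc He.
  assert (H := Harg_lim_pos (fun z => (- Re (F z), Im (F z))) t (- c) e HF).
  assert (L : lim_boundary (fun z => (- Re (F z), Im (F z))) t (RtoC (- c))).
  { intros d Hd; apply filter_imp with (2 := Hlim d Hd); intros z Hz.
    rewrite <- Cmod_conj, <- Cmod_opp.
    match goal with |- Cmod ?a < d => replace a with (F z - c)%C; [exact Hz |] end.
    apply C_ext; simpl; unfold Re, Im; ring. }
  specialize (H L ltac:(lra) He).
  apply filter_imp with (2 := H); intros z Hz.
  rewrite Harg_reflect in Hz.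
  replace (Harg (F z)) with (Harg (Re (F z), Im (F z))) by reflexivity; lra.
Qed.

(** The hypotheses compare the angles subtended at [z] and at [W] by the arcs of the real line
    between [0], [1] and infinity. *)
Lemma modulus_comparison (z W : C) :
  0 < Im z -> 0 < Im W ->
  Harg z <= Harg W ->
  Harg (z - 1)%C - Harg z <= Harg (W - 1)%C - Harg W ->
  PI - Harg (z - 1)%C <= 2 * (PI - Harg (W - 1)%C + Harg (W + 1)%C) ->
  (Cmod z <= 1 / 2 -> Cmod W <= 2 * Cmod z) /\
  (Cmod W <= 1 / 12 -> Cmod z <= 24 * Cmod W).
Proof.
  intros Hz HW I1 I2 I3.
  assert (I12 : Harg (z - 1)%C <= Harg (W - 1)%C) by lra.
  assert (Iz1 : 0 < Im (z - 1)%C) by (change (0 < Im z - 0); lra).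
  assert (IW1 : 0 < Im (W - 1)%C) by (change (0 < Im W - 0); lra).
  rewrite !Harg_minus in I2 by (auto; apply Harg_shift_lt; auto; lra).
  apply Harg_le_iff in I1, I2, I12.
  pose proof (Cmod_sqr z) as Sz; pose proof (Cmod_sqr W) as SW.
  pose proof (Cmod_ge_0 W) as NW.
  pose proof (Rabs_Re_le z) as Rz; pose proof (Rabs_Re_le W) as RW.
  pose proof (Rabs_Im_le W) as YW; rewrite Rabs_right in YW by lra.
  apply Rabs_le_between in Rz; apply Rabs_le_between in RW.
  rewrite !Re_mult, !Im_mult in I2.
  set (w := Cmod W) in *; set (m := Cmod z) in *.
  change (Re (z - 1)%C) with (Re z - 1) in *; change (Im (z - 1)%C) with (Im z - 0) in *.
  change (Re (W - 1)%C) with (Re W - 1) in *; change (Im (W - 1)%C) with (Im W - 0) in *.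
  change (Re (Cconj z)) with (Re z) in *; change (Im (Cconj z)) with (- Im z) in *.
  change (Re (Cconj W)) with (Re W) in *; change (Im (Cconj W)) with (- Im W) in *.
  set (r := Im z / Im W).
  assert (Pr : 0 < r) by (apply Rdiv_lt_0_compat; lra).
  assert (Er : Im z = r * Im W) by (unfold r; field; lra).
  assert (J1 : Re W * r <= Re z).
  { apply Rmult_le_compat_r with (r := Im z) in I1; [| lra].
    replace (Re z / Im z * Im z) with (Re z) in I1 by (field; lra).
    replace (Re W / Im W * Im z) with (Re W * r) in I1 by (unfold r; field; lra); exact I1. }
  (* The angle of [0, 1] seen from [z] has cotangent (|z|^2 - Re z) / Im z. Adding [J1] gives |W|^2
     * r <= |z|^2. *)
  assert (J2 : (w * w - Re W) * r <= m * m - Re z).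
  { rewrite Sz, SW.
    apply Rmult_le_compat_r with (r := Im z) in I2; [| lra].
    match type of I2 with ?a <= ?b =>
      replace b with (Re z * Re z + Im z * Im z - Re z) in I2 by (field; lra);
      replace a with ((Re W * Re W + Im W * Im W - Re W) * r) in I2 by (unfold r; field; lra)
    end; exact I2. }
  assert (J12 : 1 - Re z <= (1 - Re W) * r).
  { apply Rmult_le_compat_r with (r := Im z) in I12; [| lra].
    replace ((Re z - 1) / (Im z - 0) * Im z) with (Re z - 1) in I12 by (field; lra).
    replace ((Re W - 1) / (Im W - 0) * Im z) with ((Re W - 1) * r) in I12 by (unfold r; field; lra).
    lra. }
  split.
  - intros Hm.

    (* From [J12] and 1 - Re z >= 1 / 2. The resulting w^2 <= 2 * (1 + w) * m^2 first gives w <= 1,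
       because m <= 1 / 2, and then w <= 2 * m. *)
    assert (K2 : 1 <= 2 * (1 + w) * r) by nra.
    assert (K3 : w * w <= 2 * (1 + w) * (m * m)).
    { apply Rle_trans with (w * w * (2 * (1 + w) * r)); [nra |].
      replace (w * w * (2 * (1 + w) * r)) with (2 * (1 + w) * (w * w * r)) by ring.
      apply Rmult_le_compat_l; nra. }
    assert (K4 : w <= 1) by nra.
    nra.
  - intros Hw.
    assert (Hw2 : w * w <= 1 / 144) by nra.
    (* The two rays beyond -1 and 1 are together seen from [W] under an angle with tangent 2 * Im W
       / (1 - |W|^2). *)
    assert (Q : PI - Harg (W - 1)%C + Harg (W + 1)%C <= 2 * Im W / (1 - w * w)).
    { assert (L : Harg (W + 1)%C < Harg (W - 1)%C).
      { replace (W - 1)%C with (W + 1 - 2)%C by ring.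
        apply Harg_shift_lt; [change (0 < Im W + 0); lra | lra]. }
      assert (E : Harg (W - 1)%C - Harg (W + 1)%C = Harg ((W - 1) * Cconj (W + 1))%C).
      { apply Harg_minus; [change (0 < Im W + 0); lra | exact IW1 | exact L]. }
      replace (PI - Harg (W - 1)%C + Harg (W + 1)%C)
        with (PI - Harg ((W - 1) * Cconj (W + 1))%C) by lra.
      replace ((W - 1) * Cconj (W + 1))%C with (- (1 - w * w), 2 * Im W).
      2: { rewrite SW; apply C_ext; simpl; unfold Re, Im; ring. }
      rewrite Harg_reflect, Harg_Re_pos by (simpl; nra); simpl.
      replace (PI - (PI - atan (2 * Im W / (1 - w * w)))) with (atan (2 * Im W / (1 - w * w))) by ring.
      apply atan_sandwich, Rdiv_lt_0_compat; nra. }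
    assert (Q2 : 2 * Im W / (1 - w * w) <= 2.1 * Im W).
    { apply Rmult_le_reg_r with (1 - w * w); [nra |].
      unfold Rdiv; rewrite Rmult_assoc, Rinv_l by nra.
      assert (Im W * (w * w) <= Im W * (1 / 144)) by (apply Rmult_le_compat_l; lra); lra. }
    assert (Q3 : PI - Harg (z - 1)%C <= 4.2 * Im W) by lra.
    replace (z - 1)%C with (- (1 - Re z), Im z) in Q3 by (apply C_ext; simpl; unfold Re, Im; ring).
    rewrite Harg_reflect in Q3.
    replace (PI - (PI - Harg (1 - Re z, Im z))) with (Harg (1 - Re z, Im z)) in Q3 by ring.
    pose proof PI2_1 as HPI.
    assert (Px : 0 < 1 - Re z).
    { apply Rnot_le_lt; intros Hneg.
      assert (PI / 2 <= Harg (1 - Re z, Im z)); [| unfold PI2 in *; lra].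
      unfold Harg; simpl.
      assert (atan ((1 - Re z) / Im z) <= 0); [| lra].
      assert (D : (1 - Re z) / Im z <= 0).
      { apply Rmult_le_reg_r with (Im z); [lra |].
        unfold Rdiv; rewrite Rmult_assoc, Rinv_l by lra; lra. }
      rewrite <- atan_0; destruct D as [D | ->]; [left; apply atan_increasing; exact D | lra]. }
    rewrite Harg_Re_pos in Q3 by (simpl; lra); simpl in Q3.
    (* Otherwise the ray beyond 1 would be seen from [z] under an angle with tangent above 6 * Im W,
       hence above 4.8 * Im W, while [Q3] allows only 4.2 * Im W. *)
    assert (J3 : r <= 6 * (1 - Re z)).
    { apply Rnot_lt_le; intros L.
      assert (A : 6 * Im W < Im z / (1 - Re z)).
      { apply Rmult_lt_reg_r with (1 - Re z); [lra |].
        replace (Im z / (1 - Re z) * (1 - Re z)) with (r * Im W) by (rewrite Er; field; lra).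
        apply Rmult_lt_compat_r with (r := Im W) in L; lra. }
      apply atan_increasing in A.
      destruct (atan_sandwich (6 * Im W)) as [A1 _]; [lra |].
      assert (A2 : 4.8 * Im W <= 6 * Im W / (1 + (6 * Im W) ^ 2)).
      { apply Rmult_le_reg_r with (1 + (6 * Im W) ^ 2); [nra |].
        replace (6 * Im W / (1 + (6 * Im W) ^ 2) * (1 + (6 * Im W) ^ 2))
          with (6 * Im W) by (field; nra).

        assert ((6 * Im W) ^ 2 <= 1 / 4) by nra.
        assert (Im W * (6 * Im W) ^ 2 <= Im W * (1 / 4)) by (apply Rmult_le_compat_l; lra).
        lra. }
      unfold Re, Im in *; lra. }
    assert (XW : - (w * r) <= Re W * r).
    { rewrite Ropp_mult_distr_l; apply Rmult_le_compat_r; lra. }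
    assert (XW2 : (Re W - w * w) * r <= w * r) by (apply Rmult_le_compat_r; nra).
    assert (wr : w * r <= 1 / 12 * r) by (apply Rmult_le_compat_r; lra).

    (* Here r <= 12, because r <= 6 * (1 - Re z) <= 6 + 6 * w * r <= 6 + r / 2. *)
    assert (wr12 : w * r <= w * 12) by (apply Rmult_le_compat_l; lra).
    assert (X2 : Re z * (1 - Re z) <= r * (Im z * Im W + w)).
    { assert (Im z * Im z = r * (Im z * Im W)) by (rewrite Er at 1; ring); lra. }
    assert (Y1 : Im z <= 12 * w).
    { rewrite Er; apply Rmult_le_compat; lra. }
    assert (YW1 : Im z * Im W <= 12 * w * (1 / 12)) by (apply Rmult_le_compat; lra).
    assert (P0 : 0 <= Im z * Im W) by (apply Rmult_le_pos; lra).
    assert (X3 : Re z <= 6 * (Im z * Im W + w)).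
    { apply Rmult_le_reg_r with (1 - Re z); [exact Px |].
      eapply Rle_trans; [exact X2 |].
      replace (6 * (Im z * Im W + w) * (1 - Re z)) with (6 * (1 - Re z) * (Im z * Im W + w)) by ring.
      apply Rmult_le_compat_r; lra. }
    eapply Rle_trans; [apply Cmod_le_sum |].
    rewrite (Rabs_right (Im z)) by lra.
    assert (Rabs (Re z) <= 12 * w) by (apply Rabs_le; lra); lra.
Qed.

(** * Complex powers and the estimate in a sector *)

Definition Cpower (z : C) (a : R) : C := Cexp (a * Clog z)%C.

Lemma exp_le_compat (x y : R) : x <= y -> exp x <= exp y.
Proof. intros [L | ->]; [left; apply exp_increasing, L | lra]. Qed.

Lemma Re_Im_scal (a : R) (z : C) : Re (a * z)%C = a * Re z /\ Im (a * z)%C = a * Im z.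
Proof. rewrite Re_mult, Im_mult; simpl; split; ring. Qed.

Lemma Cmod_Cpower (z : C) (a : R) : Cmod (Cpower z a) = Rpower (Cmod z) a.
Proof. unfold Cpower; rewrite Cmod_Cexp, (proj1 (Re_Im_scal _ _)); reflexivity. Qed.

Lemma Re_Cpower (z : C) (a : R) :
  Re (Cpower z a) = Rpower (Cmod z) a * cos (a * atan (Im z / Re z)).
Proof.
  unfold Cpower; rewrite Re_Cexp, (proj1 (Re_Im_scal _ _)), (proj2 (Re_Im_scal _ _)); reflexivity.
Qed.

Lemma Im_Cpower (z : C) (a : R) :
  Im (Cpower z a) = Rpower (Cmod z) a * sin (a * atan (Im z / Re z)).
Proof.
  unfold Cpower; rewrite Im_Cexp, (proj1 (Re_Im_scal _ _)), (proj2 (Re_Im_scal _ _)); reflexivity.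
Qed.

Lemma cderiv_Cpower (z : C) (a : R) : 0 < Re z -> exists l, cderiv (fun w => Cpower w a) z l.
Proof.
  intros Hz; eexists; unfold Cpower.
  apply (cderiv_comp Cexp (fun w => a * Clog w)%C); [| apply cderiv_exp].
  apply cderiv_scal, cderiv_Clog, Hz.
Qed.

(** Thales: from outside the unit disc the segment from -1 to 1 is seen under at most a right angle,
    so the two outer rays account for at least PI / 2 of the total PI. *)
Lemma Harg_bounds_Thales (z : C) :
  0 < Im z -> 1 <= Cmod z -> PI <= 2 * (PI - Harg (z - 1)%C + Harg (z + 1)%C).
Proof.
  intros Hz Hm.
  assert (L : Harg (z + 1)%C < Harg (z - 1)%C).
  { replace (z - 1)%C with (z + 1 - 2)%C by ring.
    apply Harg_shift_lt; [change (0 < Im z + 0); lra | lra]. }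
  assert (E : Harg (z - 1)%C - Harg (z + 1)%C = Harg ((z - 1) * Cconj (z + 1))%C).
  { apply Harg_minus; [change (0 < Im z + 0) | change (0 < Im z - 0) | exact L]; lra. }
  assert (Harg ((z - 1) * Cconj (z + 1))%C <= PI / 2); [| lra].
  replace ((z - 1) * Cconj (z + 1))%C with (Cmod z * Cmod z - 1, 2 * Im z).
  2: { rewrite Cmod_sqr; apply C_ext; simpl; unfold Re, Im; ring. }
  unfold Harg; simpl.
  assert (P : 0 <= (Cmod z * Cmod z - 1) / (2 * Im z)) by (apply Rdiv_le_0_compat; nra).
  destruct P as [P | <-]; [apply atan_increasing in P; rewrite atan_0 in P; lra |].
  rewrite atan_0; lra.
Qed.

(** [N] maps the half plane into the sector of opening [PI * b] at [0], and [W = N ^ (1 / b)] into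
    the half plane, with real boundary values over the two sides of the sector. *)
Lemma tip_estimate (N : C -> C) (kap : C) :
  0 < Im kap -> 0 < Re kap -> holomorphic_H N ->
  (forall z, 0 < Im z -> 0 < Im (N z) /\ Re kap * Im (N z) < Im kap * Re (N z)) ->
  (forall t, t < 0 -> exists s, 0 < s /\ lim_boundary N t (s * kap)%C) ->
  (forall t, 0 < t < 1 -> exists s, 0 < s < 1 /\ lim_boundary N t (RtoC s)) ->
  (forall t, 1 < t -> exists c, 1 < Cmod c /\ lim_boundary N t c) ->
  forall z, 0 < Im z ->
    let b := atan (Im kap / Re kap) / PI in
    (Cmod z <= 1 / 2 -> Cmod (N z) <= Rpower (2 * Cmod z) b) /\
    Rpower (Rmin (1 / 12) (Cmod z / 24)) b <= Cmod (N z).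
Proof.
  intros Ik Rk HN Hin Hneg Hmid Hright z0 Hz0 b.

  set (al := atan (Im kap / Re kap)) in *.
  assert (Pal : 0 < al < PI / 2).
  { split; [| apply atan_bound].
    rewrite <- atan_0; apply atan_increasing, Rdiv_lt_0_compat; lra. }
  assert (Pb : 0 < b) by (apply Rdiv_lt_0_compat; lra).
  assert (RN : forall z, 0 < Im z -> 0 < Re (N z)).
  { intros z Hz; destruct (Hin z Hz) as [H1 H2]; nra. }
  assert (AN : forall z, 0 < Im z -> 0 < atan (Im (N z) / Re (N z)) < al).
  { intros z Hz; destruct (Hin z Hz) as [H1 H2]; specialize (RN z Hz); split.
    - rewrite <- atan_0; apply atan_increasing, Rdiv_lt_0_compat; lra.
    - apply atan_increasing; apply Rmult_lt_reg_r with (Re (N z) * Re kap); [nra |].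
      field_simplify; lra. }
  set (W := fun z => Cpower (N z) (/ b)).
  assert (Hphi : forall z, 0 < Im z -> 0 < / b * atan (Im (N z) / Re (N z)) < PI).
  { intros z Hz; specialize (AN z Hz).
    assert (0 < / b) by (apply Rinv_0_lt_compat; lra).
    replace PI with (/ b * al) by (unfold b; field; lra).
    split; [apply Rmult_lt_0_compat; lra | apply Rmult_lt_compat_l; lra]. }
  assert (IW : forall z, 0 < Im z -> 0 < Im (W z)).
  { intros z Hz; unfold W; rewrite Im_Cpower; specialize (Hphi z Hz).
    apply Rmult_lt_0_compat; [apply exp_pos | apply sin_gt_0; lra]. }
  assert (HW : holomorphic_H W).
  { intros z Hz; destruct (HN z Hz) as [l Hl].
    destruct (cderiv_Cpower (N z) (/ b) (RN z Hz)) as [m Hm].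
    eexists; apply (cderiv_comp (fun w => Cpower w (/ b)) N); eassumption. }
  assert (HWc : forall c : R, holomorphic_H (fun z => W z + c)%C) by
    (intros; apply holomorphic_H_comp_plus, HW).
  assert (IWc : forall (c : R) z, 0 < Im z -> 0 < Im (W z + c)%C).
  { intros c z Hz; specialize (IW z Hz); change (0 < Im (W z) + 0); lra. }
  assert (Hzc : forall c : R, holomorphic_H (fun z => z + c)%C) by
    (intros; apply holomorphic_H_comp_plus, holomorphic_H_id).
  assert (Izc : forall (c : R) z, 0 < Im z -> 0 < Im (z + c)%C).
  { intros c z Hz; change (0 < Im z + 0); lra. }
  assert (Lz : forall t c : R, lim_boundary (fun z => z + c)%C t (RtoC (t + c))).
  { intros t c; rewrite RtoC_plus; apply lim_boundary_plus, lim_boundary_id. }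
  assert (LW : forall t c, 0 < Re c -> lim_boundary N t c -> lim_boundary W t (Cpower c (/ b))).
  { intros t c Hc HL; destruct (cderiv_Cpower c (/ b) Hc) as [m Hm].
    exact (lim_boundary_comp (fun w => Cpower w (/ b)) N t c m HL Hm). }
  assert (WL : forall t, t < 0 -> exists s, s < 0 /\ lim_boundary W t (RtoC s)).
  { intros t Ht; destruct (Hneg t Ht) as [s [Hs HL]].
    exists (- Rpower (Cmod (s * kap)%C) (/ b)); split.
    { pose proof (exp_pos (/ b * ln (Cmod (s * kap)%C))); unfold Rpower; lra. }
    assert (Hc : 0 < Re (s * kap)%C).
    { rewrite (proj1 (Re_Im_scal _ _)); apply Rmult_lt_0_compat; lra. }
    specialize (LW t _ Hc HL).
    replace (RtoC (- Rpower (Cmod (s * kap)%C) (/ b))) with (Cpower (s * kap) (/ b)); [exact LW |].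
    (* The upper side of the sector has argument PI * b; division by [b] makes it PI, so the power
       is a negative real number. *)
    assert (E : / b * atan (Im (s * kap)%C / Re (s * kap)%C) = PI).
    { rewrite (proj1 (Re_Im_scal _ _)), (proj2 (Re_Im_scal _ _)).
      replace (s * Im kap / (s * Re kap)) with (Im kap / Re kap) by (field; lra).
      fold al; unfold b; field; lra. }
    apply C_ext; rewrite ?Re_Cpower, ?Im_Cpower, E, ?cos_PI, ?sin_PI; simpl; ring. }
  assert (WM : forall t, 0 < t < 1 -> exists s, 0 < s < 1 /\ lim_boundary W t (RtoC s)).
  { intros t Ht; destruct (Hmid t Ht) as [s [Hs HL]].
    exists (Rpower s (/ b)); split.
    { split; [apply exp_pos |]; rewrite <- (exp_0); apply exp_increasing.
      assert (ln s < 0) by (rewrite <- ln_1; apply ln_increasing; lra).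
      assert (0 < / b) by (apply Rinv_0_lt_compat; lra); nra. }
    specialize (LW t (RtoC s) (proj1 Hs) HL).
    replace (RtoC (Rpower s (/ b))) with (Cpower s (/ b)); [exact LW |].
    apply C_ext; rewrite ?Re_Cpower, ?Im_Cpower, Cmod_R, Rabs_right by lra; simpl;
      unfold Rdiv; rewrite Rmult_0_l, atan_0, Rmult_0_r, ?cos_0, ?sin_0; ring. }
  assert (WR : forall t, 1 < t -> at_boundary t (fun z => 1 <= Cmod (W z))).
  { intros t Ht; destruct (Hright t Ht) as [c [Hc HL]].
    apply filter_imp with (2 := at_boundary_and _ _ _ (HL (Cmod c - 1) ltac:(lra)) (at_boundary_H t)).
    intros z [Hz Iz]; unfold W; rewrite Cmod_Cpower.
    pose proof (Rabs_Cmod_minus c (N z)) as B; apply Rabs_le_between in B.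
    rewrite <- exp_0; unfold Rpower; apply exp_le_compat.
    apply Rmult_le_pos; [left; apply Rinv_0_lt_compat; lra | apply ln_ge_0; lra]. }
  pose proof (fun (c : R) z => Harg_bounds (W z + c)%C) as BW.
  (* Over t < 0 the argument of [W] tends to PI, and over t > 0 the argument of [z] tends to 0. *)
  assert (I1 : forall z, 0 < Im z -> Harg z - Harg (W z) <= 0).
  { apply (maximum_principle _ 0 1 PI).
    - apply harmonic_H_minus; apply (harmonic_H_Harg _); auto; apply holomorphic_H_id.
    - intros z _; pose proof (Harg_bounds z); pose proof (Harg_bounds (W z)); lra.
    - intros t e N0 N1 He; destruct (Rtotal_order t 0) as [L | [E | G]]; [| lra |].
      + destruct (WL t L) as [s [Hs HL]].
        apply filter_imp with (2 := Harg_lim_neg W t s e IW HL Hs He).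
        intros z Hz; pose proof (Harg_bounds z); lra.
      + apply filter_imp with
          (2 := Harg_lim_pos (fun z => z) t t e (fun z H => H) (lim_boundary_id t) G He).
        intros z Hz; pose proof (Harg_bounds (W z)); lra. }
  (* Outside [0, 1] the angle of [0, 1] seen from [z] tends to 0; over (0, 1) the one seen from [W]
     tends to PI, the limits of [W] lying in (0, 1). *)
  assert (I2 : forall z, 0 < Im z ->
     (Harg (z + (-1)%R)%C - Harg z) - (Harg (W z + (-1)%R)%C - Harg (W z)) <= 0).
  { assert (Lt : forall z, 0 < Im z -> 0 <= Harg (z + (-1)%R)%C - Harg z).
    { intros z Hz; pose proof (Harg_shift_lt z 1 Hz Rlt_0_1) as H.
      replace (z + (-1)%R)%C with (z - 1)%C by (apply C_ext; simpl; ring); lra. }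
    apply (maximum_principle _ 0 1 PI).
    - apply harmonic_H_minus; apply harmonic_H_minus.
      + apply (harmonic_H_Harg (fun z => z + (-1)%R)%C); auto.
      + apply (harmonic_H_Harg (fun z => z)); auto; apply holomorphic_H_id.
      + apply (harmonic_H_Harg (fun z => W z + (-1)%R)%C); auto.
      + apply (harmonic_H_Harg W); auto.
    - intros z Hz; specialize (Lt (W z) (IW z Hz)).
      pose proof (Harg_bounds z); pose proof (Harg_bounds (z + (-1)%R)%C); lra.
    - intros t e N0 N1 He; destruct (Rtotal_order t 0) as [L | [E | G]]; [| lra |].
      + apply filter_imp with (2 := at_boundary_and _ _ _ (at_boundary_H t)
          (Harg_lim_neg (fun z => z) t t e (fun z H => H) (lim_boundary_id t) L He)).
        intros z [Hz Hz2]; specialize (Lt (W z) (IW z Hz)).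
        pose proof (Harg_bounds (z + (-1)%R)%C); lra.
      + destruct (Rtotal_order t 1) as [L1 | [E1 | G1]]; [| lra |].
        * destruct (WM t (conj G L1)) as [s [Hs HL]].
          assert (HL1 : lim_boundary (fun z => W z + (-1)%R)%C t (RtoC (s + -1))).
          { rewrite RtoC_plus; apply lim_boundary_plus, HL. }
          apply filter_imp with (2 := at_boundary_and _ _ _
            (Harg_lim_pos W t s (e / 2) IW HL ltac:(lra) ltac:(lra))
            (Harg_lim_neg _ t _ (e / 2) (IWc (-1)) HL1 ltac:(lra) ltac:(lra))).
          intros z [Hz1 Hz2]; pose proof (Harg_bounds (z + (-1)%R)%C); pose proof (Harg_bounds z); lra.
        * apply filter_imp with (2 := at_boundary_and _ _ _ (at_boundary_H t)
            (Harg_lim_pos _ t _ e (Izc (-1)) (Lz t (-1)) ltac:(lra) He)).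
          intros z [Hz Hz2]; specialize (Lt (W z) (IW z Hz)); pose proof (Harg_bounds z); lra. }
  (* Over t > 1 all that is known of [W] is that its modulus is at least 1. There
     [Harg_bounds_Thales] yields only half of PI, whence the factor 2. *)
  assert (I3 : forall z, 0 < Im z ->
     (PI - Harg (z + (-1)%R)%C) - 2 * ((PI - Harg (W z + (-1)%R)%C) + Harg (W z + 1%R)%C) <= 0).
  { apply (maximum_principle _ 0 1 PI).
    - apply harmonic_H_minus; [apply harmonic_H_minus; [apply harmonic_H_const |] |
        apply harmonic_H_scal, harmonic_H_plus; [apply harmonic_H_minus; [apply harmonic_H_const |] |]].
      + apply (harmonic_H_Harg (fun z => z + (-1)%R)%C); auto.
      + apply (harmonic_H_Harg (fun z => W z + (-1)%R)%C); auto.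
      + apply (harmonic_H_Harg (fun z => W z + 1%R)%C); auto.
    - intros z Hz; pose proof (Harg_bounds (z + (-1)%R)%C); pose proof (BW (-1) z); pose proof (BW 1 z); lra.
    - intros t e N0 N1 He; destruct (Rtotal_order t 1) as [L | [E | G]]; [| lra |].
      + apply filter_imp with (2 := Harg_lim_neg _ t _ e (Izc (-1)) (Lz t (-1)) ltac:(lra) He).
        intros z Hz; pose proof (BW (-1) z); pose proof (BW 1 z); lra.
      + apply filter_imp with (2 := at_boundary_and _ _ _ (at_boundary_H t) (WR t G)).
        intros z [Hz Hz2]; pose proof (Harg_bounds_Thales (W z) (IW z Hz) Hz2) as T.
        replace (W z + (-1)%R)%C with (W z - 1)%C by (apply C_ext; simpl; ring).
        pose proof (Harg_bounds (z + (-1)%R)%C); lra. }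
  specialize (I1 z0 Hz0); specialize (I2 z0 Hz0); specialize (I3 z0 Hz0).
  replace (z0 + (-1)%R)%C with (z0 - 1)%C in * by (apply C_ext; simpl; ring).
  replace (W z0 + (-1)%R)%C with (W z0 - 1)%C in * by (apply C_ext; simpl; ring).
  destruct (modulus_comparison z0 (W z0)) as [U L]; auto; try lra.
  assert (PN : 0 < Cmod (N z0)) by (apply Cmod_pos_Re, RN, Hz0).
  assert (EN : Cmod (N z0) = Rpower (Cmod (W z0)) b).
  { unfold W; rewrite Cmod_Cpower, Rpower_mult, Rinv_l, Rpower_1; lra. }
  assert (PW : 0 < Cmod (W z0)) by (apply Cmod_pos_Im, IW, Hz0).
  rewrite EN; split.
  - intros Hm; apply Rle_Rpower_l; [lra |]; split; [exact PW | apply U, Hm].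
  - apply Rle_Rpower_l; [lra |].
    split; [apply Rmin_pos; lra |].
    destruct (Rle_or_lt (Cmod (W z0)) (1 / 12)) as [H1 | H1].
    + specialize (L H1); eapply Rle_trans; [apply Rmin_r | lra].
    + eapply Rle_trans; [apply Rmin_l | lra].
Qed.

(** * Triangles *)

Definition cross (a b : C) : R := Re a * Im b - Im a * Re b.

(** Up to the positive factor [cross (x i2 - x i1) (x i3 - x i1)], the barycentric coordinate of
    the vertex opposite to the edge from [x i] to [x (nxt i)]. *)
Definition side (x : idx -> C) (i : idx) (z : C) : R := cross (x (nxt i) - x i)%C (z - x i)%C.

Lemma counterclockwise_rot (x : idx -> C) (i : idx) :
  counterclockwise x -> 0 < cross (x (nxt i) - x i)%C (x (nxt (nxt i)) - x i)%C.
Proof.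
  unfold counterclockwise, cross; destruct i; simpl nxt; simpl; unfold Re, Im; lra.
Qed.

Lemma side_sum (x : idx -> C) (i : idx) (z : C) :
  side x i z + side x (nxt i) z + side x (nxt (nxt i)) z =
  cross (x (nxt i) - x i)%C (x (nxt (nxt i)) - x i)%C.
Proof. unfold side, cross; destruct i; simpl nxt; simpl; unfold Re, Im; ring. Qed.

Lemma side_vertex (x : idx -> C) (i : idx) :
  side x i (x i) = 0 /\ side x i (x (nxt i)) = 0.
Proof. unfold side, cross; destruct i; simpl nxt; simpl; unfold Re, Im; split; ring. Qed.

Lemma side_plus (x : idx -> C) (i : idx) (z v : C) :
  side x i (z + v)%C = side x i z + cross (x (nxt i) - x i)%C v.
Proof. unfold side, cross; simpl; unfold Re, Im; ring. Qed.

Lemma side_segment (x : idx -> C) (i : idx) (s : R) (z v : C) :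
  side x i ((1 - s)%R * z + s * v)%C = (1 - s) * side x i z + s * side x i v.
Proof. unfold side, cross; simpl; unfold Re, Im; ring. Qed.

Lemma side_triangle (x : idx -> C) (z : C) :
  counterclockwise x -> Defs.triangle x z <-> forall i, 0 <= side x i z.
Proof.
  intros Hx; set (D := cross (x i2 - x i1)%C (x i3 - x i1)%C).
  assert (PD : 0 < D) by exact (counterclockwise_rot x i1 Hx).
  split.
  - intros (s & t & u & Hs & Ht & Hu & E & ->) i.
    assert (side x i (s * x i1 + t * x i2 + u * x i3)%C =
            match i with i1 => u | i2 => s | i3 => t end * D) as ->.
    { replace s with (1 - t - u) by lra; unfold D, side, cross; destruct i; simpl nxt; simpl;
        unfold Re, Im; ring. }
    destruct i; apply Rmult_le_pos; lra.
  - intros H; exists (side x i2 z / D), (side x i3 z / D), (side x i1 z / D).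
    pose proof (side_sum x i1 z) as S; simpl nxt in S; fold D in S.
    repeat split; try (apply Rdiv_le_0_compat; auto).
    + replace (side x i2 z / D + side x i3 z / D + side x i1 z / D)
        with ((side x i1 z + side x i2 z + side x i3 z) / D) by (field; lra).
      rewrite S; field; lra.
    + rewrite !RtoC_div by lra.
      assert (ND : RtoC D <> 0) by (intros E; apply RtoC_inj in E; lra).
      assert (E : (D * z = side x i2 z * x i1 + side x i3 z * x i2 + side x i1 z * x i3)%C).
      { unfold D, side, cross; simpl nxt; apply C_ext; simpl; unfold Re, Im; ring. }
      transitivity (/ D * (D * z))%C; [field; exact ND |].
      rewrite E; field; exact ND.
Qed.

Lemma cross_le (a b : C) : Rabs (cross a b) <= 2 * Cmod a * Cmod b.
Proof.
  unfold cross; eapply Rle_trans; [apply Rabs_triang |]; rewrite Rabs_Ropp, !Rabs_mult.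
  assert (Rabs (Re a) * Rabs (Im b) <= Cmod a * Cmod b).
  { apply Rmult_le_compat; try apply Rabs_pos; [apply Rabs_Re_le | apply Rabs_Im_le]. }
  assert (Rabs (Im a) * Rabs (Re b) <= Cmod a * Cmod b).
  { apply Rmult_le_compat; try apply Rabs_pos; [apply Rabs_Im_le | apply Rabs_Re_le]. }
  lra.
Qed.

Lemma edge_nonzero (x : idx -> C) (i : idx) :
  counterclockwise x -> 0 < Cmod (x (nxt i) - x i)%C.
Proof.
  intros Hx; apply Cmod_gt_0; intros E; pose proof (counterclockwise_rot x i Hx) as H.
  rewrite E in H; unfold cross in H; simpl in H; lra.
Qed.

Lemma side_interior (x : idx -> C) (z : C) :
  counterclockwise x -> Defs.interior (Defs.triangle x) z <-> forall i, 0 < side x i z.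
Proof.
  intros Hx; unfold Defs.interior; rewrite locally_Cmod; split.
  - intros [d [Hd H]] i.
    pose proof (edge_nonzero x i Hx) as Pe; set (e := (x (nxt i) - x i)%C) in *.
    set (k := d / (2 * Cmod e)); assert (Pk : 0 < k) by (apply Rdiv_lt_0_compat; lra).
    (* A step against the inward normal i * e of the edge lowers [side x i] by k * |e|^2. *)
    specialize (H (z + - k * Ci * e)%C).
    assert (Hd2 : Cmod (z + - k * Ci * e - z)%C < d).
    { replace (z + - k * Ci * e - z)%C with (- (k * Ci * e))%C by ring.
      rewrite Cmod_opp, !Cmod_mult, Cmod_Ci, Cmod_R, Rabs_right by lra.
      unfold k; replace (d / (2 * Cmod e) * 1 * Cmod e) with (d / 2) by (field; lra); lra. }
    apply H, (side_triangle x _ Hx) with (i := i) in Hd2.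
    rewrite side_plus in Hd2; fold e in Hd2.
    replace (cross e (- k * Ci * e)%C) with (- (k * (Cmod e * Cmod e))) in Hd2.
    2: { rewrite Cmod_sqr; unfold cross; simpl; unfold Re, Im; ring. }
    assert (0 < k * (Cmod e * Cmod e)) 
      by (apply Rmult_lt_0_compat; [exact Pk | apply Rmult_lt_0_compat; lra]); lra.
  - intros H.
    assert (Each : forall i, exists d, 0 < d /\ forall w, Cmod (w - z)%C < d -> 0 <= side x i w).
    { intros i; specialize (H i); pose proof (edge_nonzero x i Hx) as Pe.
      exists (side x i z / (2 * Cmod (x (nxt i) - x i)%C)); split;
        [apply Rdiv_lt_0_compat; lra |].
      intros w Hw; replace w with (z + (w - z))%C by ring; rewrite side_plus.
      pose proof (cross_le (x (nxt i) - x i)%C (w - z)%C) as B; apply Rabs_le_between in B.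
      apply Rmult_lt_compat_l with (r := 2 * Cmod (x (nxt i) - x i)%C) in Hw; [| lra].
      replace (2 * Cmod (x (nxt i) - x i)%C * (side x i z / (2 * Cmod (x (nxt i) - x i)%C)))
        with (side x i z) in Hw by (field; lra); lra. }
    destruct (Each i1) as [d1 [P1 H1]]; destruct (Each i2) as [d2 [P2 H2]];
      destruct (Each i3) as [d3 [P3 H3]].
    exists (Rmin d1 (Rmin d2 d3)); split; [repeat apply Rmin_pos; auto |].
    intros w Hw; apply side_triangle; [exact Hx |].
    pose proof (Rmin_l d1 (Rmin d2 d3)); pose proof (Rmin_r d1 (Rmin d2 d3));
      pose proof (Rmin_l d2 d3); pose proof (Rmin_r d2 d3).
    intros []; [apply H1 | apply H2 | apply H3]; lra.
Qed.

(** Cramer's rule: the offset from the vertex has zero cross product with two independent edge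
    directions. *)
Lemma side_two_zero (x : idx -> C) (i : idx) (z : C) :
  counterclockwise x -> side x i z = 0 -> side x (nxt i) z = 0 -> z = x (nxt i).
Proof.
  intros Hx H1 H2; pose proof (counterclockwise_rot x i Hx) as PD.
  assert (E1 : cross (x (nxt i) - x i)%C (z - x (nxt i))%C = 0).
  { rewrite <- H1; unfold side, cross; simpl; unfold Re, Im; ring. }
  unfold side in H2.
  set (a := (x (nxt i) - x i)%C) in *.
  set (b := (x (nxt (nxt i)) - x (nxt i))%C) in *; set (v := (z - x (nxt i))%C) in *.
  assert (PD' : 0 < cross a b).
  { replace (cross a b) with (cross a (x (nxt (nxt i)) - x i)%C); [exact PD |].
    unfold a, b, cross; simpl; unfold Re, Im; ring. }
  assert (V1 : Re v * cross a b = 0).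
  { replace (Re v * cross a b) with (Re b * cross a v - Re a * cross b v)
      by (unfold cross; ring); rewrite E1, H2; ring. }
  assert (V2 : Im v * cross a b = 0).
  { replace (Im v * cross a b) with (Im b * cross a v - Im a * cross b v)
      by (unfold cross; ring); rewrite E1, H2; ring. }
  apply Rmult_integral in V1; apply Rmult_integral in V2.
  assert (v = 0) as Ev.
  { apply C_ext; [change (Re v = 0); destruct V1 | change (Im v = 0); destruct V2]; lra. }
  replace z with (v + x (nxt i))%C by (unfold v; ring); rewrite Ev; ring.
Qed.

Lemma triangle_bounded (x : idx -> C) (z : C) :
  Defs.triangle x z -> Cmod z <= Cmod (x i1) + Cmod (x i2) + Cmod (x i3).
Proof.
  intros (s & t & u & Hs & Ht & Hu & E & ->).
  eapply Rle_trans; [apply Cmod_triangle |].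
  pose proof (Cmod_triangle (s * x i1) (t * x i2)) as T.
  rewrite !Cmod_mult, !Cmod_R, !Rabs_right in * by lra.
  assert (forall r y, r <= 1 -> r * Cmod y <= Cmod y).
  { intros r y Hr; rewrite <- (Rmult_1_l (Cmod y)) at 2.
    apply Rmult_le_compat_r; [apply Cmod_ge_0 | exact Hr]. }
  pose proof (H s (x i1) ltac:(lra)); pose proof (H t (x i2) ltac:(lra));
    pose proof (H u (x i3) ltac:(lra)); lra.
Qed.

(** * Boundary behaviour of conformal maps onto triangles *)

(** A Schwarz-Christoffel map rewritten with [side] and epsilons. The point at infinity is no longer
    an argument; its value survives as the limit [x i2] for large |u|. *)
Definition triangle_map (x : idx -> C) (W : C -> C) : Prop :=
  holomorphic_H W /\
  (forall z i, 0 < Im z -> 0 < side x i (W z)) /\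
  (exists g : C -> C,
     (forall v, (forall i, 0 < side x i v) ->
        0 < Im (g v) /\ W (g v) = v /\ exists l, cderiv g v l) /\
     (forall z, 0 < Im z -> g (W z) = z)) /\
  (forall z, 0 <= Im z -> forall e, 0 < e -> exists d, 0 < d /\ forall u, 0 <= Im u ->
     Cmod (u - z)%C < d -> Cmod (W u - W z)%C < e) /\
  (forall e, 0 < e -> exists M, forall u, 0 <= Im u -> M < Cmod u -> Cmod (W u - x i2)%C < e) /\
  W (RtoC 1) = x i1 /\ W (RtoC 0) = x i3.

Lemma schwarz_christoffel_triangle_map (x : idx -> C) (w : option C -> C) :
  counterclockwise x -> schwarz_christoffel zpt x w -> triangle_map x (fun z => w (Some z)).
Proof.
  intros Hx ((Hol & Hin & g & Hg & Hgin & Hgw & Hwg) & (Cont & Cinf) & V).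
  pose proof (V i1) as V1; pose proof (V i2) as V2; pose proof (V i3) as V3; simpl in V1, V2, V3.
  repeat split; auto.
  - intros z Hz; apply ex_derive_cderiv, Hol, Hz.
  - intros z i Hz; revert i; apply side_interior; [exact Hx | apply Hin, Hz].
  - exists g; split; [| exact Hgw].
    intros v Hv; apply side_interior in Hv; [| exact Hx].
    split; [apply Hgin, Hv | split; [apply Hwg, Hv | apply ex_derive_cderiv, Hg, Hv]].
  - intros z Hz e He.
    assert (L : @locally C_UniformSpace (w (Some z)) (fun v => Cmod (v - w (Some z))%C < e)).
    { apply locally_Cmod; exists e; auto. }
    apply (Cont z Hz) in L; unfold filtermap, within in L; apply locally_Cmod in L.
    destruct L as [d [Hd H]]; exists d; split; [exact Hd |]; intros u Hu Du; apply H; auto.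
  - intros e He.
    assert (L : @locally C_UniformSpace (w None) (fun v => Cmod (v - w None)%C < e)).
    { apply locally_Cmod; exists e; auto. }
    apply Cinf in L; unfold filtermap, within, nbhs_infty in L.
    destruct L as [M H]; exists M; intros u Hu Mu; rewrite <- V2; apply H; auto.
Qed.

Lemma triangle_map_boundary_ge (x : idx -> C) (W : C -> C) (t : R) (i : idx) :
  counterclockwise x -> triangle_map x W -> 0 <= side x i (W t).
Proof.
  intros Hx (_ & Hin & _ & Cont & _); apply Rnot_lt_le; intros L.
  pose proof (edge_nonzero x i Hx) as Pe; set (e := Cmod (x (nxt i) - x i)%C) in *.
  destruct (Cont t) with (e := - side x i (W t) / (2 * e)) as [d [Hd H]].
  { simpl; lra. }
  { apply Rdiv_lt_0_compat; lra. }
  specialize (H (t + (d / 2)%R * Ci)%C).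
  assert (I : Im (t + (d / 2)%R * Ci)%C = d / 2) by (simpl; field).
  specialize (Hin (t + (d / 2)%R * Ci)%C i ltac:(lra)).
  replace (t + (d / 2)%R * Ci - t)%C with ((d / 2)%R * Ci)%C in H by ring.
  rewrite Cmod_mult, Cmod_Ci, Cmod_R, Rabs_right in H by lra.
  specialize (H ltac:(lra) ltac:(lra)).
  set (v := W (t + (d / 2)%R * Ci)%C) in *.
  replace v with (W t + (v - W t))%C in Hin by ring; rewrite side_plus in Hin.
  pose proof (cross_le (x (nxt i) - x i)%C (v - W t)%C) as B; fold e in B.
  apply Rabs_le_between in B.
  apply Rmult_lt_compat_l with (r := 2 * e) in H; [| lra].
  replace (2 * e * (- side x i (W t) / (2 * e))) with (- side x i (W t)) in H by (field; lra); lra.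
Qed.

(** If W t were interior, the inverse [g] would be continuous there. For [u] just above [t], u = g
    (W u) would then be close to g (W t), whose imaginary part is positive. *)
Lemma triangle_map_boundary (x : idx -> C) (W : C -> C) (t : R) :
  counterclockwise x -> triangle_map x W -> exists i, side x i (W t) = 0.
Proof.
  intros Hx HW; apply NNPP; intros No.
  assert (Hv : forall i, 0 < side x i (W t)).
  { intros i; destruct (triangle_map_boundary_ge x W t i Hx HW); [assumption |].
    exfalso; apply No; exists i; auto. }
  destruct HW as (_ & _ & (g & Hg & HgW) & Cont & _).
  destruct (Hg _ Hv) as (Ig & _ & l & Hl).
  destruct (cderiv_continuous _ _ _ Hl (Im (g (W t)) / 2)) as [d [Hd Hg2]]; [lra |].
  destruct (Cont t ltac:(simpl; lra) d Hd) as [d2 [Hd2 H2]].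
  set (h := Rmin d2 (Im (g (W t))) / 4).
  assert (Ph : 0 < h) by (unfold h; assert (0 < Rmin d2 (Im (g (W t)))) by (apply Rmin_pos; lra); lra).
  assert (Lh : h < d2 /\ h <= Im (g (W t)) / 4).
  { unfold h; pose proof (Rmin_l d2 (Im (g (W t)))); pose proof (Rmin_r d2 (Im (g (W t))));
    unfold h in Ph; lra. }
  set (u := (t + h * Ci)%C).
  assert (Iu : Im u = h) by (unfold u; simpl; ring).
  assert (Du : Cmod (u - t)%C = h).
  { unfold u; replace (t + h * Ci - t)%C with (h * Ci)%C by ring.
    rewrite Cmod_mult, Cmod_Ci, Cmod_R, Rabs_right by lra; ring. }
  specialize (H2 u ltac:(lra) ltac:(lra)).
  specialize (Hg2 _ H2); rewrite HgW in Hg2 by lra.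
  pose proof (Rabs_Im_le (u - g (W t))%C) as B2.
  change (Im (u - g (W t))%C) with (Im u - Im (g (W t))) in B2.
  assert (B3 := Rle_lt_trans _ _ _ B2 Hg2); apply Rabs_lt_between in B3; lra.
Qed.

(** If [W] were constantly [q] on (a, b), then [ln |W - q|] would be below every multiple of minus
    the harmonic measure of (a, b). *)
Lemma triangle_map_not_constant (x : idx -> C) (W : C -> C) (a b : R) (q : C) :
  counterclockwise x -> triangle_map x W -> a < b ->
  exists t : R, a < t < b /\ W t <> q.
Proof.
  intros Hx HW Hab; apply NNPP; intros No.
  assert (Hq : forall t : R, a < t < b -> W t = q).
  { intros t Ht; apply NNPP; intros E; apply No; exists t; auto. }
  destruct (triangle_map_boundary x W ((a + b) / 2) Hx HW) as [i Hi].
  rewrite Hq in Hi by lra.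

  destruct HW as (Hol & Hin & _ & Cont & _).
  (* Chosen so that Re (c * v) is the cross product of the edge with [v]. The map G then takes
     values in the right half plane, where ln |G| is harmonic. *)
  set (c := (- Im (x (nxt i) - x i)%C, - Re (x (nxt i) - x i)%C) : C).
  set (G := fun z => (c * (W z + - q))%C).
  assert (RG : forall z, Re (G z) = side x i (W z)).
  { intros z; replace (W z) with (q + (W z + - q))%C at 1 by ring.
    rewrite side_plus, Hi; unfold G, c, cross; simpl; unfold Re, Im; simpl; ring. }
  assert (HG : holomorphic_H G) by (apply holomorphic_H_scal, holomorphic_H_comp_plus, Hol).
  assert (PG : forall z, 0 < Im z -> 0 < Re (G z)) by (intros z Hz; rewrite RG; auto).
  set (Bd := Cmod (x i1) + Cmod (x i2) + Cmod (x i3)).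
  set (K := Cmod c * (Bd + Cmod q) + 1).
  assert (BK : forall z, 0 < Im z -> Cmod (G z) <= K).
  { intros z Hz; unfold G, K; rewrite Cmod_mult.
    assert (Cmod (W z) <= Bd).
    { apply triangle_bounded, side_triangle; [exact Hx | intros j; left; apply Hin, Hz]. }
    pose proof (Cmod_triangle (W z) (- q)) as T; rewrite Cmod_opp in T.
    pose proof (Cmod_ge_0 c); nra. }
  assert (PK : 0 < K).
  { pose proof (BK (0, 1) ltac:(simpl; lra)); pose proof (Cmod_pos_Re _ (PG (0, 1) ltac:(simpl; lra))); lra. }
  assert (Hza : forall c : R, holomorphic_H (fun z => z + c)%C) by
    (intros; apply holomorphic_H_comp_plus, holomorphic_H_id).
  assert (Iza : forall (c : R) z, 0 < Im z -> 0 < Im (z + c)%C).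
  { intros r z Hz; change (0 < Im z + 0); lra. }
  assert (Lz : forall t c : R, lim_boundary (fun z => z + c)%C t (RtoC (t + c))).
  { intros t r; rewrite RtoC_plus; apply lim_boundary_plus, lim_boundary_id. }
  pose proof PI_RGT_0 as HPI.
  (* The angle of (a, b) seen from [z], that is PI times its harmonic measure. *)
  set (om := fun z : C => Harg (z + (- b)%R)%C - Harg (z + (- a)%R)%C).
  assert (Key : forall n, 0 < n -> forall z, 0 < Im z ->
            ln (Cmod (G z)) + (n * om z - ln K) <= 0).
  { intros n Hn; apply (maximum_principle _ a b (n * PI)).
    - apply harmonic_H_plus; [apply harmonic_H_ln_Re; auto |].
      apply harmonic_H_minus; [apply harmonic_H_scal | apply harmonic_H_const].
      apply harmonic_H_minus.
      + apply (harmonic_H_Harg (fun z => z + (- b)%R)%C); auto.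
      + apply (harmonic_H_Harg (fun z => z + (- a)%R)%C); auto.
    - intros z Hz; pose proof (ln_le _ _ (Cmod_pos_Re _ (PG z Hz)) (BK z Hz)).
      pose proof (Harg_bounds (z + (- b)%R)%C); pose proof (Harg_bounds (z + (- a)%R)%C).
      assert (om z <= PI) by (unfold om; lra); nra.
    - intros t e Na Nb He.
      assert (Pen : 0 < e / n) by (apply Rdiv_lt_0_compat; lra).
      assert (Small : forall z, 0 < Im z -> om z <= e / n -> ln (Cmod (G z)) + (n * om z - ln K) <= e).
      { intros z Hz Ho; pose proof (ln_le _ _ (Cmod_pos_Re _ (PG z Hz)) (BK z Hz)).
        apply Rmult_le_compat_l with (r := n) in Ho; [| lra].
        replace (n * (e / n)) with e in Ho by (field; lra); lra. }
      destruct (Rtotal_order t a) as [L | [E | L]]; [| lra |].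
      + apply filter_imp with (2 := at_boundary_and _ _ _ (at_boundary_H t)
          (Harg_lim_neg _ t _ (e / n) (Iza (- a)) (Lz t (- a)) ltac:(lra) Pen)).
        intros z [Hz H]; apply Small; [exact Hz |]; unfold om.
        pose proof (Harg_bounds (z + (- b)%R)%C); lra.
      + destruct (Rtotal_order t b) as [L2 | [E | L2]]; [| lra |].
        * destruct (Cont t ltac:(simpl; lra) (K * exp (- (n * PI)) / (Cmod c + 1))) as [d [Hd H]].
          { pose proof (Cmod_ge_0 c); apply Rdiv_lt_0_compat; [| lra].
            apply Rmult_lt_0_compat; [lra | apply exp_pos]. }
          apply at_boundary_iff; exists d; split; [exact Hd |]; intros z Hz Dz.
          specialize (H z ltac:(lra) Dz); rewrite Hq in H by lra.
          assert (GK : Cmod (G z) <= K * exp (- (n * PI))).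
          { unfold G; rewrite Cmod_mult; pose proof (Cmod_ge_0 c).
            apply Rle_trans with ((Cmod c + 1) * (K * exp (- (n * PI)) / (Cmod c + 1))).
            - apply Rmult_le_compat; try apply Cmod_ge_0; [lra | left; exact H].
            - apply Req_le; field; lra. }
          apply ln_le in GK; [| apply Cmod_pos_Re, PG, Hz].
          rewrite ln_mult, ln_exp in GK by (auto; apply exp_pos).
          pose proof (Harg_bounds (z + (- b)%R)%C); pose proof (Harg_bounds (z + (- a)%R)%C).
          assert (om z <= PI) by (unfold om; lra); nra.
        * apply filter_imp with (2 := at_boundary_and _ _ _ (at_boundary_H t)
            (Harg_lim_pos _ t _ (e / n) (Iza (- b)) (Lz t (- b)) ltac:(lra) Pen)).
          intros z [Hz H]; apply Small; [exact Hz |]; unfold om.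
          pose proof (Harg_bounds (z + (- a)%R)%C); lra. }
  set (z0 := (0, 1) : C).
  assert (Iz0 : 0 < Im z0) by (simpl; lra).
  assert (Po : 0 < om z0).
  { unfold om; pose proof (Harg_shift_lt (z0 + (- a)%R)%C (b - a) (Iza _ _ Iz0) ltac:(lra)) as H.
    replace (z0 + (- a)%R - (b - a)%R)%C with (z0 + (- b)%R)%C in H
      by (apply C_ext; simpl; ring); lra. }
  (* Large enough for n * om z0 to exceed ln K - ln |G z0|, against [Key] at z0 = i. *)
  set (n := (Rabs (ln K - ln (Cmod (G z0))) + 1) / om z0).
  pose proof (Rabs_pos (ln K - ln (Cmod (G z0)))) as P0.
  assert (Pn : 0 < n) by (apply Rdiv_lt_0_compat; lra).
  specialize (Key n Pn z0 Iz0).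
  replace (n * om z0) with (Rabs (ln K - ln (Cmod (G z0))) + 1) in Key by (unfold n; field; lra).
  pose proof (Rle_abs (ln K - ln (Cmod (G z0)))); lra.
Qed.

Lemma continuity_pt_eps (f : R -> R) (t : R) :
  (forall e, 0 < e -> exists d, 0 < d /\ forall s, Rabs (s - t) < d -> Rabs (f s - f t) < e) ->
  continuity_pt f t.
Proof.
  intros H e He; destruct (H e He) as [d [Hd K]]; exists d; split; [exact Hd |].
  intros s [_ Hs]; apply K; exact Hs.
Qed.

(** The minimum over the closed half circle is positive: its two ends avoid [q] by assumption, and
    its other points go to the interior of the triangle whereas [q] lies on the line of an edge. *)
Lemma half_circle_bound (x : idx -> C) (W : C -> C) (c1 c2 : R) (q : C) (i : idx) :
  counterclockwise x -> triangle_map x W -> c1 < c2 -> side x i q = 0 ->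
  W c1 <> q -> W c2 <> q ->
  exists rho, 0 < rho /\ forall z, 0 < Im z ->
    Cmod (z - ((c1 + c2) / 2)%R)%C = (c2 - c1) / 2 -> rho <= Cmod (W z - q)%C.
Proof.
  intros Hx (_ & Hin & _ & Cont & _) Hc Hq N1 N2.
  set (o := (c1 + c2) / 2) in *; set (r := (c2 - c1) / 2) in *.
  assert (Pr : 0 < r) by (unfold r; lra).
  (* The absolute value keeps the point in the closed half plane for every [th], so that continuity
     at 0 and [PI] is two-sided. *)
  set (P := fun th : R => (o + r * cos th, Rabs (r * sin th)) : C).
  assert (IP : forall th, Im (P th) = Rabs (r * sin th)) by reflexivity.
  set (f := fun th => Cmod (W (P th) - q)%C).
  pose proof PI_RGT_0 as HPI.
  assert (CP : forall th, 0 <= th <= PI -> continuity_pt f th).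
  { intros th _; apply continuity_pt_eps; intros e He.
    destruct (Cont (P th)) with (e := e) as [d [Hd H]]; [rewrite IP; apply Rabs_pos | exact He |].
    assert (C1 : continuity_pt (fun s => r * cos s) th) by reg.
    assert (C2 : continuity_pt (fun s => Rabs (r * sin s)) th) by reg.
    apply continuity_pt_filterlim in C1; apply continuity_pt_filterlim in C2.
    destruct (C1 (fun y => Rabs (y - r * cos th) < d / 2)) as [d1 H1].
    { assert (Pd : 0 < d / 2) by lra; exists (mkposreal _ Pd); intros y Hy; exact Hy. }
    destruct (C2 (fun y => Rabs (y - Rabs (r * sin th)) < d / 2)) as [d2 H2].
    { assert (Pd : 0 < d / 2) by lra; exists (mkposreal _ Pd); intros y Hy; exact Hy. }
    exists (Rmin d1 d2); split; [apply Rmin_pos; apply cond_pos |]; intros s Hs.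
    apply Rmin_Rgt in Hs; destruct Hs as [S1 S2]; specialize (H1 s S1); specialize (H2 s S2).
    assert (D : Cmod (P s - P th)%C < d).
    { eapply Rle_lt_trans; [apply Cmod_le_sum |].
      replace (Re (P s - P th)%C) with (r * cos s - r * cos th) by (unfold P; simpl; unfold Re; simpl; ring).
      change (Im (P s - P th)%C) with (Im (P s) - Im (P th)); rewrite !IP; lra. }
    specialize (H (P s) ltac:(rewrite IP; apply Rabs_pos) D).
    unfold f; eapply Rle_lt_trans; [apply Rabs_Cmod_minus |].
    replace (W (P s) - q - (W (P th) - q))%C with (W (P s) - W (P th))%C by ring; exact H. }
  destruct (continuity_ab_min f 0 PI ltac:(lra) CP) as [m [Hm Bm]].
  exists (f m); split.
  - apply Cmod_gt_0; intros E.
    assert (Eq : W (P m) = q) by (replace q with (W (P m) - (W (P m) - q))%C by ring; rewrite E; ring).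
    destruct Bm as [B0 B1].
    destruct (Req_dec m 0) as [-> | M0].
    { apply N2; rewrite <- Eq; f_equal; unfold P, o, r; rewrite sin_0, cos_0.
      apply C_ext; simpl; [field | rewrite Rmult_0_r, Rabs_R0; ring]. }
    destruct (Req_dec m PI) as [-> | M1].
    { apply N1; rewrite <- Eq; f_equal; unfold P, o, r; rewrite sin_PI, cos_PI.
      apply C_ext; simpl; [field | rewrite Rmult_0_r, Rabs_R0; ring]. }
    assert (0 < Im (P m)).
    { rewrite IP; apply Rabs_pos_lt; apply Rgt_not_eq, Rmult_lt_0_compat; [lra |].
      apply sin_gt_0; lra. }
    specialize (Hin (P m) i H); rewrite Eq in Hin; lra.
  - intros z Hz Hr.
    assert (Izo : 0 < Im (z - o)%C) by (change (0 < Im z - 0); lra).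
    destruct (Harg_spec (z - o)%C Izo) as [E1 E2]; rewrite Hr in E1, E2.
    pose proof (Harg_bounds (z - o)%C) as Hb.
    specialize (Hm (Harg (z - o)%C) ltac:(lra)); unfold f in Hm at 2.
    replace (P (Harg (z - o)%C)) with z in Hm; [exact Hm |].
    unfold P; rewrite <- E1, <- E2, Rabs_right by lra.
    apply C_ext; simpl; unfold Re, Im; ring.
Qed.

(** The segment between two interior points with images close to [q] stays close to [q], and its
    preimage under [W] has to cross the half circle. *)
Lemma half_circle_separation (x : idx -> C) (W : C -> C) (c1 c2 rho : R) (q za zb : C) :
  counterclockwise x -> triangle_map x W -> 0 < Im za -> 0 < Im zb ->
  Cmod (za - ((c1 + c2) / 2)%R)%C < (c2 - c1) / 2 ->
  (c2 - c1) / 2 < Cmod (zb - ((c1 + c2) / 2)%R)%C ->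
  Cmod (W za - q)%C < rho -> Cmod (W zb - q)%C < rho ->
  exists z, 0 < Im z /\ Cmod (z - ((c1 + c2) / 2)%R)%C = (c2 - c1) / 2 /\
            Cmod (W z - q)%C < rho.
Proof.
  intros Hx (_ & Hin & (g & Hg & HgW) & _) Ia Ib Da Db Qa Qb.
  set (o := (c1 + c2) / 2) in *; set (r := (c2 - c1) / 2) in *.
  set (v := fun s : R => ((1 - s)%R * W za + s * W zb)%C).
  assert (Hv : forall s, 0 <= s <= 1 -> forall i, 0 < side x i (v s)).
  { intros s Hs i; unfold v; rewrite side_segment.
    pose proof (Hin za i Ia); pose proof (Hin zb i Ib).
    destruct (Req_dec s 0) as [-> | S0]; [lra |].
    apply Rplus_le_lt_0_compat; [apply Rmult_le_pos; lra | apply Rmult_lt_0_compat; lra]. }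
  set (f := fun s => Cmod (g (v s) - o)%C - r).
  assert (Cf : forall s, 0 <= s <= 1 -> continuity_pt f s).
  { intros s Hs; apply continuity_pt_eps; intros e He.
    destruct (Hg (v s) (Hv s Hs)) as (_ & _ & l & Hl).
    destruct (cderiv_continuous _ _ _ Hl e He) as [d [Hd H]].
    set (k := Cmod (W zb - W za)%C + 1).
    assert (Pk : 0 < k) by (unfold k; pose proof (Cmod_ge_0 (W zb - W za)%C); lra).
    exists (d / k); split; [apply Rdiv_lt_0_compat; lra |]; intros s' Hs'.
    assert (Small : Cmod (v s' - v s)%C < d).
    { replace (v s' - v s)%C with ((s' - s)%R * (W zb - W za))%C
        by (unfold v; rewrite !RtoC_minus; ring).
      rewrite Cmod_mult, Cmod_R.
      apply Rmult_lt_compat_r with (r := k) in Hs'; [| exact Pk].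
      replace (d / k * k) with d in Hs' by (field; lra).
      eapply Rle_lt_trans; [| exact Hs'].
      apply Rmult_le_compat_l; [apply Rabs_pos | unfold k; lra]. }
    unfold f; replace (Cmod (g (v s') - o)%C - r - (Cmod (g (v s) - o)%C - r))
      with (Cmod (g (v s') - o)%C - Cmod (g (v s) - o)%C) by ring.
    eapply Rle_lt_trans; [apply Rabs_Cmod_minus |].
    replace (g (v s') - o - (g (v s) - o))%C with (g (v s') - g (v s))%C by ring.
    apply H, Small. }
  assert (V0 : v 0 = W za) by (unfold v; rewrite Rminus_0_r; ring).
  assert (V1 : v 1 = W zb).
  { unfold v; replace (1 - 1) with 0 by ring; ring. }
  destruct (IVT_interv f 0 1 Cf) as [s [Hs Es]]; try lra.
  { unfold f; rewrite V0, HgW by exact Ia; lra. }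
  { unfold f; rewrite V1, HgW by exact Ib; lra. }
  destruct (Hg (v s) (Hv s Hs)) as (Ig & Wg & _).
  exists (g (v s)); split; [exact Ig |]; split; [unfold f in Es; lra |].
  rewrite Wg; replace (v s - q)%C with ((1 - s)%R * (W za - q) + s * (W zb - q))%C
    by (unfold v; rewrite RtoC_minus; ring).
  eapply Rle_lt_trans; [apply Cmod_triangle |].
  rewrite !Cmod_mult, !Cmod_R, !Rabs_right by lra.
  destruct (Req_dec s 0) as [-> | S0]; [lra |].
  apply Rlt_le_trans with ((1 - s) * rho + s * rho); [| lra].
  apply Rplus_le_lt_compat; [apply Rmult_le_compat_l; lra | apply Rmult_lt_compat_l; lra].
Qed.

Lemma triangle_map_near_boundary (x : idx -> C) (W : C -> C) (t rho h0 : R) :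
  triangle_map x W -> 0 < rho -> 0 < h0 ->
  exists h, 0 < h < h0 /\ Cmod (W (t, h) - W t)%C < rho.
Proof.
  intros (_ & _ & _ & Cont & _) Hr Hh.
  destruct (Cont t ltac:(simpl; lra) rho Hr) as [d [Hd H]].
  exists (Rmin d h0 / 2); assert (0 < Rmin d h0) by (apply Rmin_pos; lra).
  pose proof (Rmin_l d h0); pose proof (Rmin_r d h0); split; [lra |].
  apply H; [simpl; lra |].
  replace ((t, (Rmin d h0 / 2)%R) - t)%C with ((Rmin d h0 / 2)%R * Ci)%C by (apply C_ext; simpl; ring).
  rewrite Cmod_mult, Cmod_Ci, Cmod_R, Rabs_right; lra.
Qed.

Lemma Cmod_center (t h o r : R) : Rabs (t - o) < r -> 0 < h < r - Rabs (t - o) ->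
  Cmod ((t, h) - o)%C < r.
Proof.
  intros H1 H2; eapply Rle_lt_trans; [apply Cmod_le_sum |].
  change (Rabs (t - o) + Rabs (h - 0) < r).
  rewrite Rminus_0_r, (Rabs_right h); lra.
Qed.

(** Were both values [q], take c1 < a < c2 < b not mapped to [q]; they exist as [W] is not constant
    on intervals. The half circle over (c1, c2) separates points near [a] from points near [b], with
    images as close to [q] as desired, so the crossing point violates [half_circle_bound]. *)
Lemma triangle_map_injective (x : idx -> C) (W : C -> C) (a b : R) :
  counterclockwise x -> triangle_map x W -> a < b -> W a <> W b.
Proof.
  intros Hx HW Hab Eq; set (q := W a) in *.
  destruct (triangle_map_boundary x W a Hx HW) as [i Hi]; fold q in Hi.
  destruct (triangle_map_not_constant x W a b q Hx HW Hab) as [c2 [Hc2 N2]].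
  destruct (triangle_map_not_constant x W (a - 1) a q Hx HW ltac:(lra)) as [c1 [Hc1 N1]].
  destruct (half_circle_bound x W c1 c2 q i Hx HW ltac:(lra) Hi N1 N2) as [rho [Pr Hrho]].
  set (o := (c1 + c2) / 2) in *; set (r := (c2 - c1) / 2) in *.
  assert (Ra : Rabs (a - o) < r) by (apply Rabs_lt_between; unfold o, r; lra).
  destruct (triangle_map_near_boundary x W a rho (r - Rabs (a - o)) HW Pr ltac:(lra)) as [h [Hh Qa]].
  destruct (triangle_map_near_boundary x W b rho 1 HW Pr ltac:(lra)) as [k [Hk Qb]].
  rewrite <- Eq in Qb.
  destruct (half_circle_separation x W c1 c2 rho q (a, h) (b, k) Hx HW) as (z & Iz & Dz & Qz);
    try (simpl; lra); auto.
  - apply Cmod_center; [exact Ra | exact Hh].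
  - fold o r; pose proof (Rabs_Re_le ((b, k) - o)%C) as B.
    change (Re ((b, k) - o)%C) with (b - o) in B; pose proof (Rle_abs (b - o)).
    unfold o, r in *; lra.
  - specialize (Hrho z Iz Dz); lra.
Qed.

(** The separation argument again, with a point high above the half circle in place of one near [b]:
    its image is close to [x i2]. *)
Lemma triangle_map_not_infty (x : idx -> C) (W : C -> C) (a : R) :
  counterclockwise x -> triangle_map x W -> W a <> x i2.
Proof.
  intros Hx HW Eq; set (q := W a) in *.
  destruct (triangle_map_boundary x W a Hx HW) as [i Hi]; fold q in Hi.
  destruct (triangle_map_not_constant x W a (a + 1) q Hx HW ltac:(lra)) as [c2 [Hc2 N2]].
  destruct (triangle_map_not_constant x W (a - 1) a q Hx HW ltac:(lra)) as [c1 [Hc1 N1]].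
  destruct (half_circle_bound x W c1 c2 q i Hx HW ltac:(lra) Hi N1 N2) as [rho [Pr Hrho]].
  set (o := (c1 + c2) / 2) in *; set (r := (c2 - c1) / 2) in *.
  assert (Ra : Rabs (a - o) < r) by (apply Rabs_lt_between; unfold o, r; lra).
  destruct (triangle_map_near_boundary x W a rho (r - Rabs (a - o)) HW Pr ltac:(lra)) as [h [Hh Qa]].
  pose proof HW as (_ & _ & _ & _ & Inf & _).
  destruct (Inf rho Pr) as [M HM].
  set (y := Rabs M + r + 1).
  pose proof (Rle_abs M); pose proof (Rabs_pos M).
  assert (Pr' : 0 < r) by (unfold r; lra).
  assert (Iy : Im (o, y) = y) by reflexivity.
  assert (By : M < Cmod (o, y)).
  { pose proof (Rabs_Im_le (o, y)) as B; rewrite Iy, Rabs_right in B by (unfold y; lra).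
    unfold y in *; lra. }
  specialize (HM (o, y) ltac:(simpl; unfold y; lra) By); rewrite <- Eq in HM.
  destruct (half_circle_separation x W c1 c2 rho q (a, h) (o, y) Hx HW) as (z & Iz & Dz & Qz);
    try (simpl; unfold y; lra); auto.
  - apply Cmod_center; [exact Ra | exact Hh].
  - fold o r; pose proof (Rabs_Im_le ((o, y) - o)%C) as B.
    change (Im ((o, y) - o)%C) with (y - 0) in B; rewrite Rminus_0_r in B.
    pose proof (Rle_abs y); unfold y in *; lra.
  - specialize (Hrho z Iz Dz); lra.
Qed.

(** * Arcs and edges: leaving an open edge through its ends *)

Lemma last_nonpositive (m : R -> R) (s t : R) :
  continuity m -> s < t -> m s <= 0 -> 0 < m t ->
  exists s0, s <= s0 < t /\ m s0 <= 0 /\ forall r, s0 < r <= t -> 0 < m r.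
Proof.
  intros Cm Hst Hs Ht.
  destruct (completeness (fun r => r <= t /\ m r <= 0)) as [s0 [U1 U2]].
  { exists t; intros r [H _]; exact H. }
  { exists s; split; lra. }
  assert (S1 : s <= s0) by (apply U1; split; lra).
  assert (S2 : s0 <= t) by (apply U2; intros r [H _]; exact H).
  assert (M0 : m s0 <= 0).
  { apply Rnot_lt_le; intros L.
    destruct (Cm s0 (m s0) L) as [d [Hd H]].
    assert (s0 <= s0 - d / 2); [| lra].
    apply U2; intros r [R1 R2]; apply Rnot_lt_le; intros L2.
    assert (r <= s0) by (apply U1; split; assumption).
    destruct (Req_dec r s0) as [-> | Nr]; [lra |].
    specialize (H r); unfold dist, R_met, Rlimit.dist in H; simpl in H.
    assert (Rabs (m r - m s0) < m s0).
    { apply H; split; [split; [exact I | auto] |]; unfold Rdist.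
      apply Rabs_lt_between; lra. }
    apply Rabs_lt_between in H1; lra. }
  exists s0; split; [split; [exact S1 |] |].
  - destruct S2 as [L | E]; [exact L | rewrite E in M0; lra].
  - split; [exact M0 |]; intros r Hr; apply Rnot_le_lt; intros L.
    assert (r <= s0) by (apply U1; split; lra); lra.
Qed.

(** On the boundary of the triangle, positive exactly on the open edge from [x k] to [x (nxt k)]. *)
Definition edge_depth (x : idx -> C) (W : C -> C) (k : idx) (t : R) : R :=
  Rmin (side x (nxt k) (W t)) (side x (nxt (nxt k)) (W t)).

Lemma side_continuity (x : idx -> C) (W : C -> C) (k : idx) :
  triangle_map x W -> continuity (fun t : R => side x k (W t)).
Proof.
  intros (_ & _ & _ & Cont & _) t; apply continuity_pt_eps; intros e He.
  set (n := 2 * Cmod (x (nxt k) - x k)%C + 1).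
  assert (Pn : 0 < n) by (unfold n; pose proof (Cmod_ge_0 (x (nxt k) - x k)%C); lra).
  destruct (Cont t ltac:(simpl; lra) (e / n)) as [d [Hd H]]; [apply Rdiv_lt_0_compat; lra |].
  exists d; split; [exact Hd |]; intros s Hs.
  specialize (H s ltac:(simpl; lra)); rewrite <- RtoC_minus, Cmod_R in H; specialize (H Hs).
  replace (W s) with (W t + (W s - W t))%C by ring; rewrite side_plus.
  replace (side x k (W t) + cross (x (nxt k) - x k)%C (W s - W t)%C - side x k (W t))
    with (cross (x (nxt k) - x k)%C (W s - W t)%C) by ring.
  eapply Rle_lt_trans; [apply cross_le |].
  apply Rle_lt_trans with (n * Cmod (W s - W t)%C).
  - apply Rmult_le_compat_r; [apply Cmod_ge_0 | unfold n; lra].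
  - apply Rmult_lt_compat_l with (r := n) in H; [| exact Pn].
    replace (n * (e / n)) with e in H by (field; lra); exact H.
Qed.

Lemma continuity_Rmin (f g : R -> R) :
  continuity f -> continuity g -> continuity (fun t => Rmin (f t) (g t)).
Proof.
  intros Hf Hg t; apply continuity_pt_ext with (fun t => (f t + g t - Rabs (f t - g t)) / 2).
  - intros s; unfold Rmin, Rabs; destruct (Rle_dec _ _); destruct (Rcase_abs _); lra.
  - specialize (Hf t); specialize (Hg t).
    apply continuity_pt_mult; [| apply continuity_pt_const; intros a b; reflexivity].
    apply continuity_pt_minus; [apply continuity_pt_plus; assumption |].
    apply (continuity_pt_comp (fun t => f t - g t) Rabs); [apply continuity_pt_minus; assumption |].
    apply Rcontinuity_abs.
Qed.

Lemma edge_depth_continuity (x : idx -> C) (W : C -> C) (k : idx) :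
  triangle_map x W -> continuity (edge_depth x W k).
Proof. intros HW; apply continuity_Rmin; apply side_continuity, HW. Qed.

Lemma edge_depth_pos (x : idx -> C) (W : C -> C) (k : idx) (t : R) :
  counterclockwise x -> triangle_map x W -> 0 < edge_depth x W k t ->
  side x k (W t) = 0 /\ forall j, j <> k -> 0 < side x j (W t).
Proof.
  intros Hx HW H; unfold edge_depth in H.
  pose proof (Rlt_le_trans _ _ _ H (Rmin_l _ _)) as H1.
  pose proof (Rlt_le_trans _ _ _ H (Rmin_r _ _)) as H2.
  destruct (triangle_map_boundary x W t Hx HW) as [i Hi].
  split.
  - destruct k, i; simpl nxt in *; lra.
  - intros j Hj; destruct k, j; simpl nxt in *; try lra; congruence.
Qed.

Lemma edge_endpoint (x : idx -> C) (W : C -> C) (k : idx) (t : R) :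
  counterclockwise x -> triangle_map x W -> side x k (W t) = 0 -> edge_depth x W k t <= 0 ->
  W t = x k \/ W t = x (nxt k).
Proof.
  intros Hx HW H0 H; unfold edge_depth in H.
  pose proof (triangle_map_boundary_ge x W t (nxt k) Hx HW) as G1.
  pose proof (triangle_map_boundary_ge x W t (nxt (nxt k)) Hx HW) as G2.
  unfold Rmin in H; destruct (Rle_dec _ _).
  - right; apply side_two_zero; auto; lra.
  - left; replace k with (nxt (nxt (nxt k))) by (destruct k; reflexivity).
    apply side_two_zero; auto; [lra |].
    replace (nxt (nxt (nxt k))) with k by (destruct k; reflexivity); exact H0.
Qed.

(** Followed backwards from [t], the boundary value stays on the open edge down to the last
    parameter of nonpositive depth. By continuity it is there still on the line of the edge, hence
    at one of its ends. *)
Lemma last_exit (x : idx -> C) (W : C -> C) (k : idx) (s t : R) :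
  counterclockwise x -> triangle_map x W -> s < t ->
  edge_depth x W k s <= 0 -> 0 < edge_depth x W k t ->
  exists s0, s <= s0 < t /\ (W s0 = x k \/ W s0 = x (nxt k)).
Proof.
  intros Hx HW Hst Hs Ht.
  destruct (last_nonpositive _ s t (edge_depth_continuity x W k HW) Hst Hs Ht)
    as (s0 & H1 & H2 & H3).
  exists s0; split; [exact H1 |]; apply edge_endpoint; auto.
  apply NNPP; intros Ne.
  assert (P : 0 < side x k (W s0)).
  { destruct (triangle_map_boundary_ge x W s0 k Hx HW); [assumption | congruence]. }
  destruct (side_continuity x W k HW s0 _ P) as [d [Hd H]].
  set (r := Rmin (s0 + d / 2) t).
  assert (Hr : s0 < r <= t /\ r < s0 + d).
  { pose proof (Rmin_l (s0 + d / 2) t); pose proof (Rmin_r (s0 + d / 2) t).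
    assert (s0 < r) by (apply Rmin_glb_lt; lra); unfold r in *; lra. }
  destruct (edge_depth_pos x W k r Hx HW (H3 r (proj1 Hr))) as [Z _].
  specialize (H r); unfold dist in H; simpl in H; unfold Rdist in H.
  assert (B : Rabs (side x k (W r) - side x k (W s0)) < side x k (W s0)).
  { apply H; split; [split; [exact I | lra] | apply Rabs_lt_between; lra]. }
  rewrite Z in B; apply Rabs_lt_between in B; lra.
Qed.

Lemma first_exit (x : idx -> C) (W : C -> C) (k : idx) (s t : R) :
  counterclockwise x -> triangle_map x W -> t < s ->
  edge_depth x W k s <= 0 -> 0 < edge_depth x W k t ->
  exists s0, t < s0 <= s /\ (W s0 = x k \/ W s0 = x (nxt k)).
Proof.
  intros Hx HW Hst Hs Ht.
  destruct (last_nonpositive (fun r => edge_depth x W k (- r)) (- s) (- t))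
    as (s0 & H1 & H2 & H3); rewrite ?Ropp_involutive; try lra.
  { intros r; apply (continuity_pt_comp Ropp); [| apply edge_depth_continuity, HW].
    apply continuity_pt_opp, continuity_pt_id. }
  exists (- s0); split; [lra |]; apply edge_endpoint; auto.
  apply NNPP; intros Ne.
  assert (P : 0 < side x k (W (- s0)%R)).
  { destruct (triangle_map_boundary_ge x W (- s0) k Hx HW); [assumption | congruence]. }
  destruct (side_continuity x W k HW (- s0) _ P) as [d [Hd H]].
  set (r := Rmin (s0 + d / 2) (- t)).
  assert (Hr : s0 < r <= - t /\ r < s0 + d).
  { pose proof (Rmin_l (s0 + d / 2) (- t)); pose proof (Rmin_r (s0 + d / 2) (- t)).
    assert (s0 < r) by (apply Rmin_glb_lt; lra); unfold r in *; lra. }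
  destruct (edge_depth_pos x W k (- r) Hx HW (H3 r (proj1 Hr))) as [Z _].
  specialize (H (- r)); unfold dist in H; simpl in H; unfold Rdist in H.
  assert (B : Rabs (side x k (W (- r)%R) - side x k (W (- s0)%R)) < side x k (W (- s0)%R)).
  { apply H; split; [split; [exact I | lra] | apply Rabs_lt_between; lra]. }
  rewrite Z in B; apply Rabs_lt_between in B; lra.
Qed.

(** The open boundary arc between the prescribed preimages of [x i] and [x (nxt i)]. *)
Definition arc (i : idx) (t : R) : Prop :=
  match i with i1 => 1 < t | i2 => t < 0 | i3 => 0 < t < 1 end.

(** By injectivity a vertex is attained only at its prescribed preimage, so a point of an arc goes
    to some open edge. From a wrong edge, moving along the real line towards a suitable end of the
    arc would lead out through an end of that edge, hence through a vertex at a parameter where it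
    is not attained. *)
Lemma triangle_map_arc (x : idx -> C) (W : C -> C) (i : idx) (t : R) :
  counterclockwise x -> triangle_map x W -> arc i t ->
  side x i (W t) = 0 /\ forall j, j <> i -> 0 < side x j (W t).
Proof.
  intros Hx HW Hi.
  pose proof HW as (_ & _ & _ & _ & Inf & W1 & W0).
  assert (Inj : forall s r : R, W s = W r -> s = r).
  { intros s r E; destruct (Rtotal_order s r) as [L | [L | L]]; auto; exfalso.
    - exact (triangle_map_injective x W s r Hx HW L E).
    - exact (triangle_map_injective x W r s Hx HW L (eq_sym E)). }
  assert (V1 : forall s : R, W s = x i1 -> s = 1) by (intros s E; apply Inj; congruence).
  assert (V3 : forall s : R, W s = x i3 -> s = 0) by (intros s E; apply Inj; congruence).
  assert (V2 : forall s : R, W s = x i2 -> False) by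
    (intros s E; exact (triangle_map_not_infty x W s Hx HW E)).
  assert (D0 : edge_depth x W i1 0 <= 0 /\ edge_depth x W i2 0 <= 0).
  { unfold edge_depth; rewrite W0; simpl nxt.
    pose proof (side_vertex x i2) as [A1 A2]; pose proof (side_vertex x i3) as [B1 B2].
    simpl nxt in *; rewrite A2, B1.
    split; [rewrite Rmin_left | eapply Rle_trans; [apply Rmin_l |]]; lra. }
  assert (D1 : edge_depth x W i2 1 <= 0).
  { unfold edge_depth; rewrite W1; simpl nxt; eapply Rle_trans; [apply Rmin_r |].
    rewrite (proj1 (side_vertex x i1)); lra. }
  (* Far out the boundary values are close to [x i2], the vertex off edge [i3]. This takes the place
     of a corner when an unbounded arc is followed to infinity. *)
  assert (Far : exists M, 0 < M /\ forall s, M < Rabs s -> edge_depth x W i3 s <= 0).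
  { pose proof (edge_nonzero x i3 Hx) as Pe; set (e := Cmod (x (nxt i3) - x i3)%C) in *.
    pose proof (counterclockwise_rot x i3 Hx) as PD.
    assert (E : side x i3 (x i2) = cross (x (nxt i3) - x i3)%C (x (nxt (nxt i3)) - x i3)%C) by reflexivity.
    rewrite <- E in PD.
    destruct (Inf (side x i3 (x i2) / (2 * e))) as [M HM]; [apply Rdiv_lt_0_compat; lra |].
    exists (Rabs M + 1); split; [pose proof (Rabs_pos M); lra |].
    intros s Hs; apply Rnot_lt_le; intros L.
    destruct (edge_depth_pos x W i3 s Hx HW L) as [Z _].
    specialize (HM s ltac:(simpl; lra)); rewrite Cmod_R in HM.
    specialize (HM ltac:(pose proof (Rle_abs M); lra)).
    replace (W s) with (x i2 + (W s - x i2))%C in Z by ring; rewrite side_plus in Z.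
    pose proof (cross_le (x (nxt i3) - x i3)%C (W s - x i2)%C) as B; fold e in B.
    apply Rabs_le_between in B.
    apply Rmult_lt_compat_l with (r := 2 * e) in HM; [| lra].
    replace (2 * e * (side x i3 (x i2) / (2 * e))) with (side x i3 (x i2)) in HM by (field; lra).
    lra. }
  destruct Far as (M & PM & HM).
  assert (Ex : exists k, 0 < edge_depth x W k t).
  { destruct (triangle_map_boundary x W t Hx HW) as [k Hk]; exists k.
    apply Rnot_le_lt; intros L.
    assert (Nv : W t <> x i1 /\ W t <> x i2 /\ W t <> x i3).
    { repeat split; intros E; [apply V1 in E | exact (V2 t E) | apply V3 in E];
        destruct i; simpl in Hi; lra. }
    destruct (edge_endpoint x W k t Hx HW Hk L); destruct k; simpl nxt in *; tauto. }
  destruct Ex as [k Hk].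
  assert (k = i) as ->; [| apply edge_depth_pos; auto].
  destruct i; simpl in Hi; destruct k; auto; exfalso.
  - destruct (last_exit x W i2 1 t Hx HW Hi D1 Hk) as (s0 & Hs & [E | E]);
      [exact (V2 _ E) | apply V3 in E; lra].
  - destruct (first_exit x W i3 (t + M + 1) t Hx HW) as (s0 & Hs & [E | E]); auto; try lra.
    + apply HM; rewrite Rabs_right; lra.
    + apply V3 in E; lra.
    + apply V1 in E; lra.
  - destruct (first_exit x W i1 0 t Hx HW Hi (proj1 D0) Hk) as (s0 & Hs & [E | E]);
      [apply V1 in E; lra | exact (V2 _ E)].
  - destruct (last_exit x W i3 (t - M - 1) t Hx HW) as (s0 & Hs & [E | E]); auto; try lra.
    + apply HM; rewrite Rabs_left; lra.
    + apply V3 in E; lra.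
    + apply V1 in E; lra.
  - destruct (last_exit x W i1 0 t Hx HW (proj1 Hi) (proj1 D0) Hk) as (s0 & Hs & [E | E]);
      [apply V1 in E; lra | exact (V2 _ E)].
  - destruct (first_exit x W i2 1 t Hx HW (proj2 Hi) D1 Hk) as (s0 & Hs & [E | E]);
      [exact (V2 _ E) | apply V3 in E; lra].
Qed.

(** * Moebius changes of coordinates *)

Definition dot (a b : C) : R := Re a * Re b + Im a * Im b.

(** The identity for [s = 1], complex conjugation for [s = -1]. *)
Definition conj_s (s : R) (z : C) : C := (Re z, s * Im z).

Lemma conj_s_minus (s : R) (z w : C) : (conj_s s z - conj_s s w)%C = conj_s s (z - w)%C.
Proof. apply C_ext; simpl; unfold Re, Im; ring. Qed.

Lemma conj_s_mult (s : R) (z w : C) :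
  s * s = 1 -> (conj_s s z * conj_s s w)%C = conj_s s (z * w)%C.
Proof.
  intros Hs; apply C_ext; simpl; [| unfold Re, Im; simpl; ring].
  replace (s * Im z * (s * Im w)) with (s * s * (Im z * Im w)) by ring; rewrite Hs.
  unfold Re, Im; ring.
Qed.

Lemma conj_s_invol (s : R) (z : C) : s * s = 1 -> conj_s s (conj_s s z) = z.
Proof.
  intros Hs; apply C_ext; simpl; [reflexivity |].
  unfold Im; simpl; rewrite <- Rmult_assoc, Hs; ring.
Qed.

Lemma Cmod_conj_s (s : R) (z : C) : s * s = 1 -> Cmod (conj_s s z) = Cmod z.
Proof.
  intros Hs; unfold Cmod; f_equal; simpl.
  replace (s * Im z * (s * Im z * 1)) with (s * s * (Im z * Im z)) by ring; rewrite Hs.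
  unfold Re, Im; ring.
Qed.

Lemma cderiv_conj_s (F : C -> C) (s : R) (z l : C) :
  s * s = 1 -> cderiv F (conj_s s z) l ->
  cderiv (fun w => conj_s s (F (conj_s s w))) z (conj_s s l).
Proof.
  intros Hs H e He; destruct (H e He) as [d [Hd K]]; exists d; split; [exact Hd |].
  intros h Hh; specialize (K (conj_s s h)).
  rewrite Cmod_conj_s in K by exact Hs; specialize (K Hh).
  replace (conj_s s (z + h)%C) with (conj_s s z + conj_s s h)%C
    by (apply C_ext; simpl; unfold Re, Im; ring).
  rewrite <- (Cmod_conj_s s) in K by exact Hs.
  rewrite <- !conj_s_minus, <- conj_s_mult, conj_s_invol in K by exact Hs; exact K.
Qed.

Definition mobius (a b c d : R) (z : C) : C := ((a * z + b) / (c * z + d))%C.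

Lemma mobius_den (c d : R) (z : C) : Im z <> 0 -> c <> 0 \/ d <> 0 -> (c * z + d)%C <> 0.
Proof.
  intros Hz Hcd E.
  assert (E1 : c * Im z = 0) by (apply (f_equal Im) in E; simpl in E; unfold Im in *; lra).
  assert (c = 0) as Ec by (apply Rmult_integral in E1; tauto).
  destruct Hcd as [Nc | Nd]; [contradiction |].
  apply Nd; apply (f_equal Re) in E; rewrite Ec in E; simpl in E; lra.
Qed.

Lemma Im_mobius (a b c d : R) (z : C) :
  (c * z + d)%C <> 0 ->
  Im (mobius a b c d z) * (Cmod (c * z + d)%C * Cmod (c * z + d)%C) = (a * d - b * c) * Im z.
Proof.
  intros H.
  assert (E : (mobius a b c d z * RtoC (Cmod (c * z + d) ^ 2)
               = (a * z + b) * Cconj (c * z + d))%C).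
  { rewrite Cmod2_conj; unfold mobius; field; exact H. }
  remember (mobius a b c d z) as q; remember (Cmod (c * z + d)%C) as M.
  apply (f_equal Im) in E; rewrite !Im_mult in E; simpl in E; unfold Re, Im in *; simpl in E.
  lra.
Qed.

Lemma mobius_cderiv (a b c d : R) (z : C) :
  (c * z + d)%C <> 0 -> exists l, cderiv (mobius a b c d) z l.
Proof.
  intros H; assert (Pd : 0 < Cmod (c * z + d)%C) by (apply Cmod_gt_0; exact H).
  assert (L : forall p q : R, cderiv (fun w => p * w + q)%C z (p * 1 + 0)%C).
  { intros p q; apply cderiv_plus; [apply cderiv_scal, cderiv_id | apply cderiv_const]. }
  pose proof (cderiv_comp (fun w => / w)%C _ z _ _ (L c d) (cderiv_inv _ H)) as Hinv.
  destruct (Req_dec c 0) as [Ec | Nc].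
  - assert (Nd : d <> 0).
    { intros Ed; apply H; rewrite Ec, Ed; ring. }
    eexists; apply cderiv_ext_loc with (d := 1) (F := fun w => (/ d * (a * w + b))%C); [lra | |].
    + intros w _; unfold mobius; rewrite Ec; field.
      intros E; apply RtoC_inj in E; contradiction.
    + apply cderiv_scal, L.
  - assert (Nc' : RtoC c <> 0) by (intros E; apply RtoC_inj in E; contradiction).
    (* Partial fractions reduce this case to an inversion; the radius keeps the denominator away
       from zero. *)
    eexists; apply cderiv_ext_loc with (d := Cmod (c * z + d)%C / (Rabs c + 1))
      (F := fun w => (((b - a * d / c) * / (c * w + d)) + a / c)%C).
    + apply Rdiv_lt_0_compat; [exact Pd | pose proof (Rabs_pos c); lra].
    + intros w Hw; unfold mobius; field; split; [| exact Nc'].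
      intros E; pose proof (Rabs_pos c).
      assert (E2 : (c * z + d)%C = (c * (z - w))%C).
      { transitivity (c * (z - w) + (c * w + d))%C; [ring | rewrite E; ring]. }
      rewrite E2, Cmod_mult, Cmod_R in Hw.
      replace (w - z)%C with (- (z - w))%C in Hw by ring; rewrite Cmod_opp in Hw.
      assert (Pw : 0 < Cmod (z - w)%C).
      { rewrite E2, Cmod_mult, Cmod_R in Pd; nra. }
      apply Rmult_lt_compat_r with (r := Rabs c + 1) in Hw; [| lra].
      replace (Rabs c * Cmod (z - w)%C / (Rabs c + 1) * (Rabs c + 1))
        with (Rabs c * Cmod (z - w)%C) in Hw by (field; lra); nra.
    + apply cderiv_plus; [apply cderiv_scal, Hinv | apply cderiv_const].
Qed.

Lemma mobius_real (a b c d t : R) :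
  c * t + d <> 0 -> mobius a b c d t = RtoC ((a * t + b) / (c * t + d)).
Proof.
  intros H; unfold mobius; rewrite RtoC_div by exact H; rewrite !RtoC_plus, !RtoC_mult; reflexivity.
Qed.

Lemma barycentric_interior (x : idx -> C) (v m u : idx) (z : C) :
  counterclockwise x -> v <> m -> m <> u -> u <> v -> (forall i, 0 < side x i z) ->
  exists p q : R, 0 < p /\ 0 < q /\
    (z - x v)%C = (p * (x m - x v) + q * (x u - x v))%C.
Proof.
  intros Hx N1 N2 N3 Hz.
  set (D := cross (x i2 - x i1)%C (x i3 - x i1)%C).
  assert (PD : 0 < D) by exact (counterclockwise_rot x i1 Hx).
  (* The barycentric coordinate of vertex [j], since the edge opposite to [j] starts at [nxt j]. *)
  set (lam := fun j => side x (nxt j) z / D).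
  assert (Pl : forall j, 0 < lam j) by (intros j; apply Rdiv_lt_0_compat; auto).
  exists (lam m), (lam u); split; [apply Pl | split; [apply Pl |]].
  apply C_ext.
  - apply Rmult_eq_reg_l with D; [| lra]; unfold lam.
    destruct v, m, u; try contradiction; simpl nxt; simpl Re; unfold Re, Im; simpl;
      field_simplify; try lra; unfold D, side, cross; simpl nxt; simpl; unfold Re, Im; ring.
  - apply Rmult_eq_reg_l with D; [| lra]; unfold lam.
    destruct v, m, u; try contradiction; simpl nxt; simpl Im; unfold Re, Im; simpl;
      field_simplify; try lra; unfold D, side, cross; simpl nxt; simpl; unfold Re, Im; ring.
Qed.

Lemma barycentric_edge (x : idx -> C) (k p q : idx) (z : C) :
  counterclockwise x -> p <> q -> p <> nxt (nxt k) -> q <> nxt (nxt k) ->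
  side x k z = 0 -> (forall j, j <> k -> 0 < side x j z) ->
  exists s : R, 0 < s < 1 /\ z = (x p + s * (x q - x p))%C.
Proof.
  intros Hx N1 N2 N3 H0 Hz.
  set (D := cross (x i2 - x i1)%C (x i3 - x i1)%C).
  assert (PD : 0 < D) by exact (counterclockwise_rot x i1 Hx).
  pose proof (side_sum x i1 z) as S; simpl nxt in S; fold D in S.
  assert (ND : RtoC D <> 0) by (intros E; apply RtoC_inj in E; lra).
  assert (B : (D * z = side x i2 z * x i1 + side x i3 z * x i2 + side x i1 z * x i3)%C).
  { unfold D, side, cross; simpl nxt; apply C_ext; simpl; unfold Re, Im; ring. }
  exists (side x (nxt q) z / D).
  assert (Pq : 0 < side x (nxt q) z).
  { apply Hz; intros E; apply N3; rewrite <- E; destruct q; reflexivity. }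
  assert (Pp : 0 < side x (nxt p) z).
  { apply Hz; intros E; apply N2; rewrite <- E; destruct p; reflexivity. }
  assert (S2 : side x (nxt p) z + side x (nxt q) z = D).
  { destruct k, p, q; simpl nxt in *; try contradiction; lra. }
  split.
  - split; [apply Rdiv_lt_0_compat; lra |].
    apply Rmult_lt_reg_r with D; [lra |]; field_simplify; lra.
  - rewrite RtoC_div by lra.
    assert (B2 : (D * z = side x (nxt p) z * x p + side x (nxt q) z * x q)%C).
    { rewrite B; destruct k, p, q; simpl nxt in *; try contradiction; rewrite H0; ring. }
    transitivity (/ D * (D * z))%C; [field; exact ND |].
    rewrite B2; replace (side x (nxt p) z) with (D - side x (nxt q) z) by lra.
    rewrite RtoC_minus; field; exact ND.
Qed.

Definition opposite (k : idx) : idx := nxt (nxt k).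

Lemma conj_s_add_scal (s p q : R) (z : C) :
  conj_s s (p + q * z)%C = (p + q * conj_s s z)%C.
Proof. apply C_ext; simpl; unfold Re, Im; simpl; ring. Qed.

(** The affine map z -> (z - x v) / (x m - x v) puts the tip at 0 and the middle vertex at 1, and a
    Moebius map normalises the half plane. If [v], [m], [u] run clockwise, s = -1 conjugates on both
    sides: [N] stays holomorphic and the third vertex moves to the upper half plane. *)
Lemma tip_transfer (x : idx -> C) (W : C -> C) (v m u kvm kvu kmu : idx) (s a b c d : R) :
  counterclockwise x -> triangle_map x W -> s * s = 1 ->
  v <> m -> m <> u -> u <> v ->
  opposite kvm = u -> opposite kvu = m -> opposite kmu = v ->
  0 < s * (a * d - b * c) -> 0 < s * cross (x m - x v)%C (x u - x v)%C ->
  0 < dot (x m - x v)%C (x u - x v)%C -> 0 <= dot (x m - x v)%C (x u - x m)%C ->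
  (forall t, t < 0 -> c * t + d <> 0 /\ arc kvu ((a * t + b) / (c * t + d))) ->
  (forall t, 0 < t < 1 -> c * t + d <> 0 /\ arc kvm ((a * t + b) / (c * t + d))) ->
  (forall t, 1 < t -> c * t + d <> 0 /\ arc kmu ((a * t + b) / (c * t + d))) ->
  forall zeta, 0 < Im zeta ->
    let beta := atan (s * cross (x m - x v)%C (x u - x v)%C / dot (x m - x v)%C (x u - x v)%C) / PI in
    let z := conj_s s (mobius a b c d zeta) in
    (Cmod zeta <= 1 / 2 ->
       Cmod (W z - x v)%C <= Cmod (x m - x v)%C * Rpower (2 * Cmod zeta) beta) /\
    Cmod (x m - x v)%C * Rpower (Rmin (1 / 12) (Cmod zeta / 24)) beta <= Cmod (W z - x v)%C.
Proof.
  intros Hx HW Hs N1 N2 N3 Ko1 Ko2 Ko3 Hdet Hcr Hdot Hdot2 Aneg Amid Aright zeta Hzeta beta z.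
  set (M := (x m - x v)%C) in *; set (Q := (x u - x v)%C) in *.
  assert (PM : 0 < Cmod M).
  { apply Cmod_gt_0; intros E; rewrite E in Hdot; unfold dot in Hdot; simpl in Hdot; lra. }
  assert (NM : M <> 0) by (apply Cmod_gt_0; exact PM).
  pose proof HW as (Hol & Hin & _ & Cont & _).
  assert (Hcd : c <> 0 \/ d <> 0).
  { destruct (Req_dec c 0) as [Ec | Nc]; [| auto]; right; intros Ed.
    rewrite Ec, Ed in Hdet; lra. }
  set (T := fun z => conj_s s (mobius a b c d z)).
  assert (HT : forall z, 0 < Im z -> 0 < Im (T z)).
  { intros y Hy; pose proof (mobius_den c d y ltac:(lra) Hcd) as Nd.
    pose proof (Im_mobius a b c d y Nd) as E; change (0 < s * Im (mobius a b c d y)).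
    apply Cmod_gt_0 in Nd.
    apply Rmult_lt_reg_r with (Cmod (c * y + d)%C * Cmod (c * y + d)%C); [nra |].
    rewrite Rmult_0_l, Rmult_assoc, E; rewrite <- Rmult_assoc; apply Rmult_lt_0_compat; lra. }
  set (N := fun y => conj_s s ((W (T y) - x v) / M)%C).
  set (kap := conj_s s (Q / M)%C).
  assert (QM : forall y : C, Re (y / M)%C * (Cmod M * Cmod M) = dot M y /\
                             Im (y / M)%C * (Cmod M * Cmod M) = cross M y).
  { intros y; assert (E : ((y / M) * RtoC (Cmod M ^ 2) = y * Cconj M)%C).
    { rewrite Cmod2_conj; field; exact NM. }
    remember (y / M)%C as q; remember (Cmod M) as r.
    pose proof (f_equal Re E) as E1; pose proof (f_equal Im E) as E2.
    rewrite Re_mult in E1; rewrite Im_mult in E2; simpl in E1, E2; unfold dot, cross.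
    unfold Re, Im in *; simpl in *; split; lra. }
  assert (PMM : 0 < Cmod M * Cmod M) by nra.
  assert (Rk : 0 < Re kap).
  { unfold kap; change (0 < Re (Q / M)%C); destruct (QM Q) as [E _].
    apply Rmult_lt_reg_r with (Cmod M * Cmod M); [exact PMM | lra]. }
  assert (Ik : 0 < Im kap).
  { change (0 < s * Im (Q / M)%C); destruct (QM Q) as [_ E].
    apply Rmult_lt_reg_r with (Cmod M * Cmod M); [exact PMM |].
    rewrite Rmult_assoc, E; lra. }
  (* The angle at the middle vertex is not acute. Hence the open edge from 1 to [kap] lies outside
     the unit disc, as [tip_estimate] requires over t > 1. *)
  assert (Rk1 : 1 <= Re kap).
  { change (1 <= Re (Q / M)%C); destruct (QM Q) as [E _].
    apply Rmult_le_reg_r with (Cmod M * Cmod M); [exact PMM |]; rewrite E, Cmod_sqr.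
    replace (x u - x m)%C with (Q - M)%C in Hdot2 by (unfold Q, M; ring).
    unfold dot in Hdot2 |- *; change (Re (Q - M)%C) with (Re Q - Re M) in Hdot2.
    change (Im (Q - M)%C) with (Im Q - Im M) in Hdot2; lra. }
  assert (HN : forall y p q, W (T y) = (x v + (RtoC p * M + RtoC q * Q))%C -> N y = (p + q * kap)%C).
  { intros y p q E; unfold N, kap; rewrite E, <- conj_s_add_scal; f_equal; field; exact NM. }
  assert (LimT : forall t, c * t + d <> 0 -> lim_boundary T t (RtoC ((a * t + b) / (c * t + d)))).
  { intros t Ht.
    assert (Ht' : (c * t + d)%C <> 0).
    { intros E; apply Ht; apply (f_equal Re) in E; simpl in E; lra. }
    destruct (mobius_cderiv a b c d t Ht') as [l Hl].
    pose proof (lim_boundary_comp (mobius a b c d) (fun z => z) t t l (lim_boundary_id t) Hl) as L.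
    rewrite mobius_real in L by exact Ht.
    intros e He; apply filter_imp with (2 := L e He); intros y Hy.
    unfold T; rewrite <- (Cmod_conj_s s) in Hy by exact Hs.
    rewrite <- conj_s_minus in Hy.
    match goal with |- Cmod (_ - ?k)%C < e => replace (conj_s s k) with k in Hy; [exact Hy |] end.
    apply C_ext; simpl; ring. }
  assert (LimN : forall t p q, c * t + d <> 0 ->
     W (RtoC ((a * t + b) / (c * t + d))) = (x v + (RtoC p * M + RtoC q * Q))%C ->
     lim_boundary N t (p + q * kap)%C).
  { intros t p q Ht E e He; set (r := (a * t + b) / (c * t + d)) in *.
    destruct (Cont (RtoC r) ltac:(simpl; lra) (e * Cmod M)) as [h [Hh H]]; [nra |].
    apply filter_imp with (2 := at_boundary_and _ _ _ (LimT t Ht h Hh) (at_boundary_H t)).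
    intros y [Hy Iy]; fold r in Hy.
    specialize (H (T y) ltac:(left; apply HT, Iy) Hy).
    replace (p + q * kap)%C with (conj_s s ((W r - x v) / M)%C).
    2: { unfold kap; rewrite E, <- conj_s_add_scal; f_equal; field; exact NM. }
    unfold N; rewrite conj_s_minus, Cmod_conj_s by exact Hs.
    replace ((W (T y) - x v) / M - (W r - x v) / M)%C with ((W (T y) - W r) / M)%C
      by (field; exact NM).
    rewrite Cmod_div by exact NM; apply Rmult_lt_reg_r with (Cmod M); [exact PM |].
    unfold Rdiv; rewrite Rmult_assoc, Rinv_l, Rmult_1_r by lra; exact H. }
  assert (Edge : forall k t p q, arc k t -> opposite k <> p -> opposite k <> q -> p <> q ->
            exists r : R, 0 < r < 1 /\ W t = (x p + r * (x q - x p))%C).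
  { intros k t p q Hk K1 K2 K3.
    destruct (triangle_map_arc x W k t Hx HW Hk) as [Z P].
    apply (barycentric_edge x k p q (W t) Hx); auto. }
  destruct (tip_estimate N kap Ik Rk) with (z := zeta) as [U L]; auto.
  - intros y Hy.
    destruct (Hol (T y) (HT y Hy)) as [l1 H1].
    destruct (mobius_cderiv a b c d y (mobius_den c d y ltac:(lra) Hcd)) as [l2 H2].
    assert (D1 : cderiv (fun z => conj_s s (W (conj_s s z))) (mobius a b c d y) (conj_s s l1)).
    { apply cderiv_conj_s; [exact Hs | exact H1]. }
    pose proof (cderiv_comp _ _ _ _ _ H2 D1) as D2.
    eexists; apply cderiv_ext_loc with (d := 1)
      (F := fun y => (conj_s s (/ M) * (conj_s s (W (T y)) + - conj_s s (x v)))%C); [lra | |].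
    + intros y' _; unfold N.
      replace ((W (T y') - x v) / M)%C with (/ M * (W (T y') - x v))%C by (field; exact NM).
      rewrite <- conj_s_mult, <- conj_s_minus by exact Hs; reflexivity.
    + apply cderiv_scal, cderiv_plus; [exact D2 | apply cderiv_const].
  - intros y Hy.
    destruct (barycentric_interior x v m u (W (T y)) Hx N1 N2 N3 (fun i => Hin _ i (HT y Hy)))
      as (p & q & Pp & Pq & E).
    rewrite (HN y p q).
    2: { fold M Q in E; rewrite <- E; ring. }
    rewrite Re_plus, Im_plus, (proj1 (Re_Im_scal _ _)), (proj2 (Re_Im_scal _ _)).
    change (Re (RtoC p)) with p; change (Im (RtoC p)) with 0.
    assert (0 < q * Im kap) by (apply Rmult_lt_0_compat; lra).
    assert (0 < p * Im kap) by (apply Rmult_lt_0_compat; lra).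
    split; [lra |].
    replace (Im kap * (p + q * Re kap)) with (p * Im kap + Re kap * (q * Im kap)) by ring; lra.
  - intros t Ht; destruct (Aneg t Ht) as [Hd Ha].
    destruct (Edge kvu _ v u Ha) as (r & Hr & E); try congruence.
    exists r; split; [lra |].
    replace (r * kap)%C with (0 + r * kap)%C by ring; apply (LimN t 0 r Hd).
    rewrite E; fold Q; ring.
  - intros t Ht; destruct (Amid t Ht) as [Hd Ha].
    destruct (Edge kvm _ v m Ha) as (r & Hr & E); try congruence.
    exists r; split; [lra |].
    replace (RtoC r) with (r + 0 * kap)%C by ring; apply (LimN t r 0 Hd).
    rewrite E; fold M; ring.
  - intros t Ht; destruct (Aright t Ht) as [Hd Ha].
    destruct (Edge kmu _ m u Ha) as (r & Hr & E); try congruence.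
    exists ((1 - r)%R + r * kap)%C; split.
    2: { apply (LimN t (1 - r) r Hd); rewrite E, RtoC_minus; unfold M, Q; ring. }
    assert (B : 1 < Cmod ((1 - r)%R + r * kap)%C * Cmod ((1 - r)%R + r * kap)%C).
    { rewrite Cmod_sqr, Re_plus, Im_plus, (proj1 (Re_Im_scal _ _)), (proj2 (Re_Im_scal _ _)).
      change (Re (RtoC (1 - r))) with (1 - r); change (Im (RtoC (1 - r))) with 0.
      assert (0 < r * Im kap) by (apply Rmult_lt_0_compat; lra).
      assert (1 <= 1 - r + r * Re kap) by nra.
      nra. }
    pose proof (Cmod_ge_0 ((1 - r)%R + r * kap)%C); nra.
  - assert (Eb : atan (Im kap / Re kap) / PI = beta).
    { unfold beta; do 2 f_equal; destruct (QM Q) as [E1 E2].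
      rewrite <- E1, <- E2; change (Im kap) with (s * Im (Q / M)%C); change (Re kap) with (Re (Q / M)%C).
      assert (Rk' : 0 < Re (Q / M)%C) by exact Rk; field; split; lra. }
    rewrite Eb in U, L.
    assert (EN : Cmod (N zeta) = Cmod (W z - x v)%C / Cmod M).
    { unfold N; rewrite Cmod_conj_s, Cmod_div by assumption; reflexivity. }
    rewrite EN in U, L; split.
    + intros Hm; specialize (U Hm).
      apply Rmult_le_compat_l with (r := Cmod M) in U; [| lra].
      replace (Cmod M * (Cmod (W z - x v)%C / Cmod M)) with (Cmod (W z - x v)%C) in U by (field; lra).
      exact U.
    + apply Rmult_le_compat_l with (r := Cmod M) in L; [| lra].
      replace (Cmod M * (Cmod (W z - x v)%C / Cmod M)) with (Cmod (W z - x v)%C) in L by (field; lra).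
      exact L.
Qed.

(** [size v z / size u z] is the modulus of the cross ratio vanishing at the preimage of [x v], with
    a pole at that of [x u] and modulus one at that of the third vertex. *)
Definition size (i : idx) (z : C) : R :=
  match i with i1 => Cmod (z - 1)%C | i2 => 1 | i3 => Cmod z end.

Lemma mobius_inverse (a b c d s : R) (z : C) :
  s * s = 1 -> 0 < s * (a * d - b * c) -> 0 < Im z ->
  exists zeta, 0 < Im zeta /\ conj_s s (mobius a b c d zeta) = z /\
    Cmod zeta = Cmod (d * z - b)%C / Cmod (a - c * z)%C.
Proof.
  intros Hs Hdet Hz; set (y := conj_s s z).
  assert (Ns : s <> 0) by (intros E; rewrite E in Hs; lra).
  assert (Iy : Im y = s * Im z) by reflexivity.
  assert (Ny : Im y <> 0) by (rewrite Iy; apply Rmult_integral_contrapositive; split; lra).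
  assert (Hca : - c <> 0 \/ a <> 0).
  { destruct (Req_dec c 0) as [Ec | Nc]; [right | left; lra]; intros Ea.
    rewrite Ec, Ea in Hdet; lra. }
  pose proof (mobius_den (- c) a y Ny Hca) as Nd.
  assert (Ndet : (a * d - b * c)%C <> 0).
  { rewrite <- !RtoC_mult, <- RtoC_minus; intros E; apply RtoC_inj in E; rewrite E in Hdet; lra. }
  exists (mobius d (- b) (- c) a y); split; [| split].
  - pose proof (Im_mobius d (- b) (- c) a y Nd) as E; rewrite Iy in E.
    apply Cmod_gt_0 in Nd.
    apply Rmult_lt_reg_r with (Cmod ((- c)%R * y + a)%C * Cmod ((- c)%R * y + a)%C); [nra |].
    rewrite E, Rmult_0_l; replace ((d * a - - b * - c) * (s * Im z))
      with (s * (a * d - b * c) * Im z) by ring.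
    apply Rmult_lt_0_compat; lra.
  - rewrite <- (conj_s_invol s z) by exact Hs; f_equal; fold y.
    rewrite RtoC_opp in Nd; unfold mobius; rewrite !RtoC_opp; field.
    split; [exact Nd |].
    replace (c * (d * y + - b) + d * (- c * y + a))%C with (a * d - b * c)%C by ring; exact Ndet.
  - unfold mobius; rewrite Cmod_div by exact Nd.
    replace (d * y + (- b)%R)%C with (conj_s s (d * z - b)%C).
    2: { unfold y; apply C_ext; simpl; unfold Re, Im; simpl; ring. }
    replace ((- c)%R * y + a)%C with (conj_s s (a - c * z)%C).
    2: { unfold y; apply C_ext; simpl; unfold Re, Im; simpl; ring. }
    rewrite !Cmod_conj_s by exact Hs; reflexivity.
Qed.

(** For each of the six orders of the vertices, a real Moebius map sends 0, 1 and infinity to the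
    preimages of [x v], [x m] and [x u]. Its determinant has the sign [s] of the orientation, and
    its inverse, composed with conjugation if s = -1, has modulus [X]. *)
Lemma tip_bound (x : idx -> C) (W : C -> C) (v m u : idx) (z : C) :
  counterclockwise x -> triangle_map x W -> v <> m -> m <> u -> u <> v ->
  0 < dot (x m - x v)%C (x u - x v)%C -> 0 <= dot (x m - x v)%C (x u - x m)%C ->
  0 < Im z ->
  let X := size v z / size u z in
  let beta := atan (Rabs (cross (x m - x v)%C (x u - x v)%C) /
                    dot (x m - x v)%C (x u - x v)%C) / PI in
  (X <= 1 / 2 -> Cmod (W z - x v)%C <= Cmod (x m - x v)%C * Rpower (2 * X) beta) /\
  Cmod (x m - x v)%C * Rpower (Rmin (1 / 12) (X / 24)) beta <= Cmod (W z - x v)%C.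
Proof.
  intros Hx HW N1 N2 N3 Hd1 Hd2 Hz X beta.
  assert (Main : exists s a b c d kvm kvu kmu, s * s = 1 /\ 0 < s * (a * d - b * c) /\
     0 < s * cross (x m - x v)%C (x u - x v)%C /\
     opposite kvm = u /\ opposite kvu = m /\ opposite kmu = v /\
     (forall t, t < 0 -> c * t + d <> 0 /\ arc kvu ((a * t + b) / (c * t + d))) /\
     (forall t, 0 < t < 1 -> c * t + d <> 0 /\ arc kvm ((a * t + b) / (c * t + d))) /\
     (forall t, 1 < t -> c * t + d <> 0 /\ arc kmu ((a * t + b) / (c * t + d))) /\
     Cmod (d * z - b)%C / Cmod (a - c * z)%C = X).
  { pose proof (counterclockwise_rot x v Hx) as Hv.

    assert (Neg : cross (x (nxt (nxt v)) - x v)%C (x (nxt v) - x v)%C < 0).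
    { replace (cross (x (nxt (nxt v)) - x v)%C (x (nxt v) - x v)%C)
        with (- cross (x (nxt v) - x v)%C (x (nxt (nxt v)) - x v)%C) by (unfold cross; ring); lra. }
    assert (Lt : forall p q r, 0 < r -> p < q * r -> p / r < q).
    { intros p q r Hr H; apply Rmult_lt_reg_r with r; [exact Hr |].
      unfold Rdiv; rewrite Rmult_assoc, Rinv_l by lra; lra. }
    assert (Gt : forall p q r, 0 < r -> q * r < p -> q < p / r).
    { intros p q r Hr H; apply Rmult_lt_reg_r with r; [exact Hr |].
      unfold Rdiv; rewrite Rmult_assoc, Rinv_l by lra; lra. }
    assert (Ng : forall p r, p / r = (- p) / (- r)).
    { intros p r; unfold Rdiv; rewrite Rinv_opp; ring. }
    destruct v, m, u; try contradiction; simpl nxt in *.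
    - exists 1, 0, 1, (-1), 1, i1, i3, i2; repeat split; auto; try lra; intros; simpl; try lra.
      + apply Gt; lra.
      + apply Lt; lra.
      + apply Gt; lra.
      + rewrite Ng; apply Lt; lra.
      + unfold X; simpl; f_equal; [f_equal | ]; [ring | f_equal; ring].
    - exists (-1), (-1), 1, 0, 1, i3, i1, i2; repeat split; auto; try lra; intros; simpl; try lra.
      + apply Gt; lra.
      + apply Gt; lra.
      + apply Lt; lra.
      + apply Lt; lra.
      + unfold X; simpl; f_equal; [f_equal; ring |].
        replace (-1 - 0 * z)%C with (- (1))%C by ring; apply Cmod_m1.
    - exists (-1), 0, 1, 1, 0, i1, i2, i3; repeat split; auto; try lra; intros; simpl; try lra.
      + rewrite Ng; apply Lt; lra.
      + apply Gt; lra.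
      + apply Gt; lra.
      + apply Lt; lra.
      + unfold X; simpl.
        replace (0 * z - 1)%C with (- (1))%C by ring; rewrite Cmod_m1.
        replace (0 - 1 * z)%C with (- z)%C by ring; rewrite Cmod_opp; reflexivity.
    - exists 1, 1, (-1), 1, 0, i2, i1, i3; repeat split; auto; try lra; intros; simpl; try lra.
      + rewrite Ng; apply Gt; lra.
      + apply Lt; lra.
      + apply Gt; lra.
      + apply Lt; lra.
      + unfold X; simpl.
        replace (0 * z - -1)%C with (RtoC 1) by ring; rewrite Cmod_1.
        replace (1 - 1 * z)%C with (- (z - 1))%C by ring; rewrite Cmod_opp; reflexivity.
    - exists 1, 1, 0, 0, 1, i3, i2, i1; repeat split; auto; try lra; intros; simpl; try lra.
      + apply Lt; lra.
      + apply Gt; lra.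
      + apply Lt; lra.
      + apply Gt; lra.
      + unfold X; simpl.
        replace (1 - 0 * z)%C with (RtoC 1) by ring; rewrite Cmod_1.
        replace (1 * z - 0)%C with z by ring; reflexivity.
    - exists (-1), 1, 0, 1, (-1), i2, i3, i1; repeat split; auto; try lra; intros; simpl; try lra.
      + rewrite Ng; apply Gt; lra.
      + rewrite Ng; apply Lt; lra.
      + rewrite Ng; apply Lt; lra.
      + apply Gt; lra.
      + unfold X; simpl.
        replace (-1 * z - 0)%C with (- z)%C by ring.
        replace (1 - 1 * z)%C with (- (z - 1))%C by ring; rewrite !Cmod_opp; reflexivity. }
  destruct Main as (s & a & b & c & d & kvm & kvu & kmu & Hs & Hdet & Hcr & K1 & K2 & K3 & A1 & A2 & A3 & EX).
  destruct (mobius_inverse a b c d s z Hs Hdet Hz) as (zeta & Iz & Ez & Cz).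
  pose proof (tip_transfer x W v m u kvm kvu kmu s a b c d Hx HW Hs N1 N2 N3 K1 K2 K3 Hdet Hcr
                Hd1 Hd2 A1 A2 A3 zeta Iz) as T; cbv zeta in T.
  assert (Rabs (cross (x m - x v)%C (x u - x v)%C) = s * cross (x m - x v)%C (x u - x v)%C) as Eab.
  { assert (Hs1 : s = 1 \/ s = -1).
    { assert ((s - 1) * (s + 1) = 0) as E by lra; apply Rmult_integral in E; lra. }
    destruct Hs1 as [-> | ->]; [rewrite Rabs_right | rewrite Rabs_left]; lra. }
  rewrite Ez, Cz, EX, <- Eab in T; exact T.
Qed.

(** * Thin triangles *)

Lemma triangle_half_plane (x : idx -> C) (z : C) (al be B : R) :
  Defs.triangle x z -> (forall i, al * Re (x i) + be * Im (x i) <= B) ->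
  al * Re z + be * Im z <= B.
Proof.
  intros (s & t & u & Hs & Ht & Hu & E & ->) H.
  pose proof (Rmult_le_compat_l s _ _ Hs (H i1)); pose proof (Rmult_le_compat_l t _ _ Ht (H i2));
    pose proof (Rmult_le_compat_l u _ _ Hu (H i3)).
  rewrite !Re_plus, !Im_plus, !(fun r z => proj1 (Re_Im_scal r z)), !(fun r z => proj2 (Re_Im_scal r z)).
  replace B with (s * B + t * B + u * B) by (rewrite <- !Rmult_plus_distr_r, E; ring).
  lra.
Qed.

(** The argument of [atan] is the tangent of the angle at a tip, cross product over dot product,
    after the fibres are scaled by [e]. With lam = ln L, the bound on a * lam brings the power of
    [L] close to one; the last two bounds are a relative error, as [exp_neg_close] needs. *)
Lemma angle_asymptotics (c d k lam mu : R) :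
  0 < c -> 0 < d -> 0 <= lam -> 0 < mu <= 1 ->
  exists e0, 0 < e0 /\ forall e, 0 < e < e0 ->
    let a := atan (e * c / (d + e ^ 2 * k)) in
    0 < d + e ^ 2 * k /\ 0 < a /\ a * lam <= mu / 2 /\
    a <= (1 + mu) * (e * (c / d)) /\ e * (c / d) <= (1 + mu) * a.
Proof.
  intros Pc Pd Pl Pm.
  set (K := (Rabs k + 1) * (c + 1) * (lam + 1)).
  pose proof (Rabs_pos k) as Pk.
  assert (PK : 1 <= K).
  { assert (1 <= (Rabs k + 1) * (c + 1)) by nra.
    unfold K; assert (0 <= (Rabs k + 1) * (c + 1) * lam) by (apply Rmult_le_pos; lra); lra. }
  assert (K1 : Rabs k <= K /\ c <= K /\ c * lam <= K).
  { unfold K; repeat split.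
    - assert (0 <= Rabs k * (c + lam + c * lam)) by (repeat apply Rmult_le_pos; nra).
      nra.
    - assert (0 <= (Rabs k * (c + 1) + 1) * (lam + 1)) by (repeat apply Rmult_le_pos; nra).
      nra.
    - assert (0 <= Rabs k * (c + 1) * (lam + 1)) by (repeat apply Rmult_le_pos; nra).
      nra. }
  destruct K1 as (K1 & K2 & K3).
  set (e0 := Rmin 1 (mu * d * (3 / 16) / K)).
  assert (Pmd : 0 < mu * d) by (apply Rmult_lt_0_compat; lra).
  assert (Pe0 : 0 < e0) by (apply Rmin_pos; [lra | apply Rdiv_lt_0_compat; lra]).
  exists e0; split; [exact Pe0 |]; intros e He a.
  pose proof (Rmin_l 1 (mu * d * (3 / 16) / K)) as M1; pose proof (Rmin_r 1 (mu * d * (3 / 16) / K)) as M2.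
  fold e0 in M1, M2.
  assert (HeK : e * K <= mu * d * (3 / 16)).
  { apply Rle_trans with (mu * d * (3 / 16) / K * K); [apply Rmult_le_compat_r; lra |].
    apply Req_le; field; lra. }
  assert (Hek : e * Rabs k <= mu * d * (3 / 16)) by nra.
  assert (Hec : e * c <= mu * d * (3 / 16)) by nra.
  assert (Hecl : e * (c * lam) <= mu * d * (3 / 16)) by nra.
  assert (Hk2 : Rabs (e ^ 2 * k) <= mu * d * (3 / 16)).
  { rewrite Rabs_mult, (Rabs_right (e ^ 2)) by nra.
    apply Rle_trans with (e * Rabs k); [| exact Hek].
    apply Rmult_le_compat_r; [exact Pk | nra]. }
  apply Rabs_le_between in Hk2.
  assert (Pq : d * (13 / 16) <= d + e ^ 2 * k) by nra.
  assert (Pq0 : 0 < d + e ^ 2 * k) by nra.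
  set (r := e * c / (d + e ^ 2 * k)) in *.
  assert (Er : r * (d + e ^ 2 * k) = e * c) by (unfold r; field; lra).
  assert (Pec : 0 < e * c) by (apply Rmult_lt_0_compat; lra).
  assert (Pr : 0 < r) by (apply Rdiv_lt_0_compat; assumption).
  destruct (atan_sandwich r Pr) as [S1 S2]; fold a in S1, S2.
  assert (Pa : 0 < a).
  { eapply Rlt_le_trans; [| exact S1]; apply Rdiv_lt_0_compat; nra. }
  assert (Rm : r <= mu / 4).
  { apply Rmult_le_reg_r with (d * (13 / 16)); [lra |].
    apply Rle_trans with (r * (d + e ^ 2 * k)); [apply Rmult_le_compat_l; lra |]; rewrite Er; lra. }
  repeat split; auto.
  - apply Rle_trans with (r * lam); [apply Rmult_le_compat_r; lra |].
    apply Rmult_le_reg_r with (d * (13 / 16)); [lra |].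
    apply Rle_trans with (r * lam * (d + e ^ 2 * k)).
    + apply Rmult_le_compat_l; [apply Rmult_le_pos; lra | exact Pq].
    + replace (r * lam * (d + e ^ 2 * k)) with (lam * (r * (d + e ^ 2 * k))) by ring.
      rewrite Er; lra.
  - apply Rle_trans with r; [exact S2 |].
    apply Rmult_le_reg_r with d; [exact Pd |].
    replace ((1 + mu) * (e * (c / d)) * d) with ((1 + mu) * (e * c)) by (field; lra).
    rewrite <- Er; replace ((1 + mu) * (r * (d + e ^ 2 * k))) with (r * ((1 + mu) * (d + e ^ 2 * k))) by ring.
    apply Rmult_le_compat_l; [lra |].
    assert (mu * (mu * d) <= 1 * (mu * d)) by (apply Rmult_le_compat_r; lra).
    assert (mu * (- (mu * d * (3 / 16))) <= mu * (e ^ 2 * k)) by (apply Rmult_le_compat_l; lra).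
    lra.
  - assert (S3 : r <= (1 + mu / 4) * a).
    { apply Rmult_le_compat_r with (r := 1 + r ^ 2) in S1; [| nra].
      replace (r / (1 + r ^ 2) * (1 + r ^ 2)) with r in S1 by (field; nra).
      eapply Rle_trans; [exact S1 |]; rewrite Rmult_comm; apply Rmult_le_compat_r; [lra |].

      nra. }
    apply Rmult_le_reg_r with d; [exact Pd |].
    replace (e * (c / d) * d) with (e * c) by (field; lra); rewrite <- Er.
    apply Rle_trans with (r * (d * (1 + mu / 4))); [apply Rmult_le_compat_l; lra |].
    apply Rle_trans with ((1 + mu / 4) * a * (d * (1 + mu / 4))).
    + apply Rmult_le_compat_r; [apply Rmult_le_pos; lra | exact S3].
    + replace ((1 + mu / 4) * a * (d * (1 + mu / 4))) with ((1 + mu / 4) * (1 + mu / 4) * (a * d)) by ring.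
      replace ((1 + mu) * a * d) with ((1 + mu) * (a * d)) by ring.
      apply Rmult_le_compat_r; [apply Rmult_le_pos; lra | nra].
Qed.

(** A relative error of the rates suffices for all s <= 0 at once: with r = - a * s, the difference
    is at most mu * r * exp (- r), and r * exp (- r) <= 1. *)
Lemma exp_neg_close (a b mu s : R) :
  0 <= a -> 0 <= b -> 0 <= mu -> a <= (1 + mu) * b -> b <= (1 + mu) * a -> s <= 0 ->
  Rabs (exp (a * s) - exp (b * s)) <= mu.
Proof.
  assert (Half : forall p q t, 0 <= p <= q -> q <= (1 + mu) * p -> 0 <= mu -> t <= 0 ->
            0 <= exp (p * t) - exp (q * t) <= mu).
  { intros p q t Hpq Hq Hmu Ht; split.
    - assert (exp (q * t) <= exp (p * t)); [| lra]. apply exp_le_compat; nra.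
    - replace (exp (q * t)) with (exp (p * t) * exp ((q - p) * t)) by (rewrite <- exp_plus; f_equal; ring).
      pose proof (exp_ineq1_le ((q - p) * t)) as I1.
      pose proof (exp_ineq1_le (- (p * t))) as I2; rewrite exp_Ropp in I2.
      pose proof (exp_pos (p * t)) as P.
      assert (I3 : exp (p * t) * (- (p * t)) <= 1).
      { apply Rle_trans with (exp (p * t) * / exp (p * t)); [apply Rmult_le_compat_l; lra |].
        rewrite Rinv_r; lra. }
      assert (I4 : - ((q - p) * t) <= mu * (- (p * t))) by nra.
      apply Rle_trans with (exp (p * t) * (mu * (- (p * t)))); [nra |].
      replace (exp (p * t) * (mu * - (p * t))) with (mu * (exp (p * t) * (- (p * t)))) by ring.
      rewrite <- (Rmult_1_r mu) at 2; apply Rmult_le_compat_l; assumption. }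
  intros Ha Hb Hmu H1 H2 Hs; destruct (Rle_or_lt a b) as [L | L].
  - destruct (Half a b s); try lra; apply Rabs_le; lra.
  - destruct (Half b a s); try lra; apply Rabs_le; lra.
Qed.

Lemma Rpower_near_1 (L b mu : R) :
  1 <= L -> 0 <= b -> b * ln L <= mu / 2 -> 0 < mu <= 1 ->
  1 - mu <= Rpower (/ L) b /\ Rpower L b <= 1 + mu.
Proof.
  intros HL Hb Hbl Hmu; unfold Rpower.

  pose proof (exp_ineq1_le (- (b * ln L))) as I.
  rewrite ln_Rinv by lra; replace (b * - ln L) with (- (b * ln L)) by ring; split; [lra |].
  pose proof (exp_pos (b * ln L)) as P2; rewrite exp_Ropp in I.
  apply Rmult_le_compat_l with (r := exp (b * ln L)) in I; [| lra].
  rewrite Rinv_r in I by lra; nra.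
Qed.

Lemma size_pos (i : idx) (z : C) : 0 < Im z -> 0 < size i z.
Proof.
  intros Hz; destruct i; simpl; [| lra |]; apply Cmod_pos_Im; [change (0 < Im z - 0) |]; lra.
Qed.

Lemma Rpower_mult_exp (L b s : R) : 0 < L -> Rpower (L * exp s) b = Rpower L b * exp (b * s).
Proof.
  intros HL; unfold Rpower; rewrite ln_mult, ln_exp, <- exp_plus by (auto; apply exp_pos).
  f_equal; ring.
Qed.

(** Twice the area of the unscaled triangle; scaling the fibres multiplies it by [e]. *)
Definition area2 (p y : idx -> R) (v m u : idx) : R :=
  Rabs ((p m - p v) * (y u - y v) - (y m - y v) * (p u - p v)).

Lemma dot_vertices (x : idx -> C) (p y : idx -> R) (a b c d : idx) (e : R) :
  (forall i, Re (x i) = p i /\ Im (x i) = e * y i) ->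
  dot (x a - x b)%C (x c - x d)%C =
  (p a - p b) * (p c - p d) + e ^ 2 * ((y a - y b) * (y c - y d)).
Proof.
  intros H; unfold dot; rewrite !Re_minus, !Im_minus.
  rewrite !(fun i => proj1 (H i)), !(fun i => proj2 (H i)); ring.
Qed.

Lemma tip_angle (x : idx -> C) (p y : idx -> R) (v m u : idx) (e : R) :
  0 < e -> (forall i, Re (x i) = p i /\ Im (x i) = e * y i) ->
  Rabs (cross (x m - x v)%C (x u - x v)%C) / dot (x m - x v)%C (x u - x v)%C =
  e * area2 p y v m u /
    ((p m - p v) * (p u - p v) + e ^ 2 * ((y m - y v) * (y u - y v))).
Proof.
  intros He H; rewrite (dot_vertices x p y _ _ _ _ e H); f_equal.
  unfold area2; rewrite <- (Rabs_right e) at 1 by lra; rewrite <- Rabs_mult; f_equal.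
  unfold cross; rewrite !Re_minus, !Im_minus.
  rewrite !(fun i => proj1 (H i)), !(fun i => proj2 (H i)); ring.
Qed.

(** [t] is the horizontal distance of [W z] to the tip, and [D], [Du] are those of the middle vertex
    to the two tips; [q] is the expected value of [t / D]. *)
Lemma tip_arithmetic (D Du t q Y mu P Q Q' : R) :
  0 < D -> 0 < Du -> 0 <= Y <= D -> 0 < mu <= 1 / 2 -> 0 < q <= 1 -> Rabs (P - q) <= mu ->
  1 - mu <= Q -> 0 < P -> D * (Q * P) <= t + Y ->
  (0 <= Q' /\ Q' <= 1 + mu /\ t <= (D + Y) * (Q' * P) \/
   1 - mu <= P /\ Du * (1 - mu) <= D + Du - t + Y) ->
  Rabs (t - D * q) <= 4 * mu * (D + Du) + 3 * Y.
Proof.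
  intros PD PDu HY Hmu Hq HP HQ PP Low Up; apply Rabs_le_between in HP; apply Rabs_le; split.
  - assert (L1 : q - 2 * mu <= (1 - mu) * P) by nra.
    assert (L2 : (1 - mu) * P <= Q * P) by (apply Rmult_le_compat_r; lra).
    assert (L3 : D * (q - 2 * mu) <= D * (Q * P)) by (apply Rmult_le_compat_l; lra).
    assert (0 <= mu * Du) by (apply Rmult_le_pos; lra).
    assert (0 <= mu * D) by (apply Rmult_le_pos; lra).
    lra.
  - assert (0 <= mu * Du) by (apply Rmult_le_pos; lra).
    assert (0 <= mu * D) by (apply Rmult_le_pos; lra).
    destruct Up as [(Q0 & Q1 & U) | (P1 & U)].
    + assert (U1 : Q' * P <= (1 + mu) * (q + mu)) by (apply Rmult_le_compat; lra).
      assert (U2 : (1 + mu) * (q + mu) <= q + 2.5 * mu) by nra.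
      assert (U3 : (D + Y) * (Q' * P) <= (D + Y) * (q + 2.5 * mu)) by (apply Rmult_le_compat_l; lra).
      assert (U4 : Y * (q + 2.5 * mu) <= Y * 3) by (apply Rmult_le_compat_l; lra).
      lra.
    + assert (D * (1 - 2 * mu) <= D * q) by (apply Rmult_le_compat_l; lra).
      lra.
Qed.

Lemma thin_triangle (p y : idx -> R) (v m u : idx) (K eta : R) :
  v <> m -> m <> u -> u <> v -> 0 < (p m - p v) * (p u - p m) ->
  0 < area2 p y v m u -> 0 < area2 p y u m v -> 1 <= K -> 0 < eta ->
  exists e0, 0 < e0 /\ forall e x W, 0 < e < e0 ->
    (forall i, Re (x i) = p i /\ Im (x i) = e * y i) ->
    counterclockwise x -> triangle_map x W ->
    forall z tau, 0 < Im z -> tau <= 0 ->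
      exp (PI * tau) / K <= size v z / size u z <= K * exp (PI * tau) ->
      Cmod (W z - RtoC (p v + (p m - p v) *
        exp (e * (area2 p y v m u / ((p m - p v) * (p u - p v))) * tau)))%C <= eta.
Proof.
  intros N1 N2 N3 Hmid A1 A2 HK Heta.
  (* [s] is the direction from the tip [v] to the tip [u]; it makes [D] and [Du] positive
     distances. *)
  assert (Sg : exists s, s * s = 1 /\ 0 < s * (p m - p v) /\ 0 < s * (p u - p m)).
  { destruct (Rlt_or_le 0 (p m - p v)) as [L | L]; [exists 1 | exists (-1)].
    - assert (0 < p u - p m) by nra; lra.
    - assert (p m - p v <> 0) by (intros E; rewrite E in Hmid; lra).
      assert (p u - p m < 0) by nra; lra. }
  destruct Sg as (s & Ss & PD & PDu).
  set (D := s * (p m - p v)) in *; set (Du := s * (p u - p m)) in *.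
  assert (ED : p m - p v = s * D) by (unfold D; rewrite <- Rmult_assoc, Ss; ring).
  assert (EDu : p u - p m = s * Du) by (unfold Du; rewrite <- Rmult_assoc, Ss; ring).
  assert (Ed1 : (p m - p v) * (p u - p v) = D * (D + Du)).
  { replace (p u - p v) with (s * (D + Du)) by lra; rewrite ED.
    replace (s * D * (s * (D + Du))) with (s * s * (D * (D + Du))) by ring; rewrite Ss; ring. }
  assert (Ed2 : (p m - p u) * (p v - p u) = Du * (D + Du)).
  { replace (p m - p u) with (s * - Du) by lra; replace (p v - p u) with (s * - (D + Du)) by lra.
    replace (s * - Du * (s * - (D + Du))) with (s * s * (Du * (D + Du))) by ring; rewrite Ss; ring. }
  (* The 24 is the one in the lower bound of [tip_bound]; it also covers the factor 2 of the upper
     bound and the cut-off 1 / 12. *)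
  set (L := 24 * K); assert (HL : 24 <= L) by (unfold L; lra).
  (* Leaves a quarter of [eta] to the term 4 * mu * (D + Du) of [tip_arithmetic]. *)
  set (mu := Rmin (1 / 2) (eta / (16 * (D + Du)))).
  assert (Pmu : 0 < mu) by (apply Rmin_pos; [lra | apply Rdiv_lt_0_compat; lra]).
  assert (Hmu1 : mu <= 1 / 2) by apply Rmin_l.
  assert (Hmu2 : 4 * mu * (D + Du) <= eta / 4).
  { apply Rle_trans with (4 * (eta / (16 * (D + Du))) * (D + Du)).
    - apply Rmult_le_compat_r; [lra |]; apply Rmult_le_compat_l; [lra | apply Rmin_r].
    - apply Req_le; field; lra. }
  pose proof (ln_ge_0 L ltac:(lra)) as PlnL.
  destruct (angle_asymptotics (area2 p y v m u) ((p m - p v) * (p u - p v))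
    ((y m - y v) * (y u - y v)) (ln L) mu) as [e1 [Pe1 He1]]; auto; try lra.
  { rewrite Ed1; apply Rmult_lt_0_compat; lra. }
  destruct (angle_asymptotics (area2 p y u m v) ((p m - p u) * (p v - p u))
    ((y m - y u) * (y v - y u)) (ln L) mu) as [e2 [Pe2 He2]]; auto; try lra.
  { rewrite Ed2; apply Rmult_lt_0_compat; lra. }
  (* Supplies the sign of the dot product at the middle vertex, whose angle is thus obtuse for small
     [e]. *)
  destruct (angle_asymptotics 1 ((p m - p v) * (p u - p m))
    ((y m - y v) * (y u - y m)) 0 mu) as [e3 [Pe3 He3]]; try lra.
  set (Ym := Rabs (y i1) + Rabs (y i2) + Rabs (y i3) + 1).
  assert (HYm : forall i, Rabs (y i) <= Ym).
  { pose proof (Rabs_pos (y i1)); pose proof (Rabs_pos (y i2)); pose proof (Rabs_pos (y i3)).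
    intros []; unfold Ym; lra. }
  assert (PYm : 0 < Ym) by (pose proof (Rabs_pos (y i1)); specialize (HYm i1); unfold Ym in *;
    pose proof (Rabs_pos (y i2)); pose proof (Rabs_pos (y i3)); lra).
  set (e4 := Rmin (eta / (16 * Ym)) (Rmin (D / (2 * Ym)) (Du / (2 * Ym)))).
  assert (Pe4 : 0 < e4) by (repeat apply Rmin_pos; apply Rdiv_lt_0_compat; lra).
  exists (Rmin (Rmin e1 e2) (Rmin e3 e4)); split; [apply Rmin_pos; apply Rmin_pos; assumption |].
  intros e x W He Hxy Hx HW z tau Hz Htau HX.
  assert (He' : e < e1 /\ e < e2 /\ e < e3 /\ e < e4).
  { pose proof (Rmin_l (Rmin e1 e2) (Rmin e3 e4)); pose proof (Rmin_r (Rmin e1 e2) (Rmin e3 e4)).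
    pose proof (Rmin_l e1 e2); pose proof (Rmin_r e1 e2); pose proof (Rmin_l e3 e4);
      pose proof (Rmin_r e3 e4); lra. }
  destruct He' as (L1 & L2 & L3 & L4).
  destruct (He1 e (conj (proj1 He) L1)) as (B1 & B2 & B3 & B4 & B5).
  destruct (He2 e (conj (proj1 He) L2)) as (C1 & C2 & C3 & _ & _).
  destruct (He3 e (conj (proj1 He) L3)) as (D1 & _).
  (* Bounds every difference of heights, hence the gap between a distance and its horizontal
     part. *)
  set (Y := 2 * (e * Ym)).
  assert (HY : 0 <= Y /\ Y <= eta / 8 /\ Y <= D /\ Y <= Du).
  { assert (M1 : e4 <= eta / (16 * Ym)) by apply Rmin_l.
    assert (M2 : e4 <= D / (2 * Ym)) by (eapply Rle_trans; [apply Rmin_r | apply Rmin_l]).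
    assert (M3 : e4 <= Du / (2 * Ym)) by (eapply Rle_trans; [apply Rmin_r | apply Rmin_r]).
    unfold Y; repeat split.
    - assert (0 < e * Ym) by (apply Rmult_lt_0_compat; lra); lra.
    - apply Rle_trans with (2 * (eta / (16 * Ym) * Ym)); [| apply Req_le; field; lra].
      apply Rmult_le_compat_l; [lra |]; apply Rmult_le_compat_r; lra.
    - apply Rle_trans with (2 * (D / (2 * Ym) * Ym)); [| apply Req_le; field; lra].
      apply Rmult_le_compat_l; [lra |]; apply Rmult_le_compat_r; lra.
    - apply Rle_trans with (2 * (Du / (2 * Ym) * Ym)); [| apply Req_le; field; lra].
      apply Rmult_le_compat_l; [lra |]; apply Rmult_le_compat_r; lra. }
  destruct HY as (HY0 & HY1 & HY2 & HY3).
  set (X := size v z / size u z) in *.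
  pose proof (size_pos v z Hz) as Pv; pose proof (size_pos u z Hz) as Pu.
  assert (PX : 0 < X) by (apply Rdiv_lt_0_compat; assumption).
  assert (Einv : size u z / size v z = / X) by (unfold X; field; lra).
  assert (Q1 : 0 < dot (x m - x v)%C (x u - x v)%C) by (rewrite (dot_vertices x p y _ _ _ _ e Hxy); exact B1).
  assert (Q2 : 0 <= dot (x m - x v)%C (x u - x m)%C) by (rewrite (dot_vertices x p y _ _ _ _ e Hxy); lra).
  assert (Q3 : 0 < dot (x m - x u)%C (x v - x u)%C) by (rewrite (dot_vertices x p y _ _ _ _ e Hxy); exact C1).
  assert (Q4 : 0 <= dot (x m - x u)%C (x v - x m)%C).
  { rewrite (dot_vertices x p y _ _ _ _ e Hxy); lra. }
  destruct (tip_bound x W v m u z Hx HW N1 N2 N3 Q1 Q2 Hz) as [U Low].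
  destruct (tip_bound x W u m v z Hx HW ltac:(congruence) ltac:(congruence) ltac:(congruence) Q3 Q4 Hz)
    as [_ Low'].
  rewrite (tip_angle x p y v m u e (proj1 He) Hxy) in U, Low.
  rewrite (tip_angle x p y u m v e (proj1 He) Hxy) in Low'.
  rewrite Einv in Low'; fold X in U, Low.
  set (a := atan (e * area2 p y v m u /
    ((p m - p v) * (p u - p v) + e ^ 2 * ((y m - y v) * (y u - y v))))) in *.
  set (a' := atan (e * area2 p y u m v /
    ((p m - p u) * (p v - p u) + e ^ 2 * ((y m - y u) * (y v - y u))))) in *.
  set (G := area2 p y v m u / ((p m - p v) * (p u - p v))) in *.
  assert (PI1 : 1 <= PI) by (pose proof PI2_1; lra).
  assert (Div : forall r, 0 < r -> r * ln L <= mu / 2 -> 0 <= r / PI /\ r / PI * ln L <= mu / 2).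
  { intros r Hr Hrl; split; [apply Rdiv_le_0_compat; lra |].
    apply Rle_trans with (r * ln L); [| exact Hrl].
    apply Rmult_le_compat_r; [exact PlnL |].
    apply Rmult_le_reg_r with PI; [lra |]; replace (r / PI * PI) with r by (field; lra).
    rewrite <- (Rmult_1_r r) at 1; apply Rmult_le_compat_l; lra. }
  destruct (Div a B2 B3) as [Pb Hb]; destruct (Div a' C2 C3) as [Pb' Hb'].
  set (b := a / PI) in *; set (b' := a' / PI) in *.
  destruct (Rpower_near_1 L b mu ltac:(lra) Pb Hb ltac:(lra)) as [R1 R2].
  destruct (Rpower_near_1 L b' mu ltac:(lra) Pb' Hb' ltac:(lra)) as [R3 _].
  assert (Tri : Defs.triangle x (W z)).
  { apply side_triangle; [exact Hx | intros i; left; apply HW, Hz]. }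
  assert (Yx : forall i, Rabs (Im (x i)) <= Y / 2).
  { intros i; rewrite (proj2 (Hxy i)), Rabs_mult, (Rabs_right e) by lra; unfold Y.
    replace (2 * (e * Ym) / 2) with (e * Ym) by field; apply Rmult_le_compat_l; [lra | apply HYm]. }
  assert (ImW : Rabs (Im (W z)) <= Y / 2).
  { apply Rabs_le; split.
    - pose proof (triangle_half_plane x (W z) 0 (-1) (Y / 2) Tri) as T.
      enough (0 * Re (W z) + -1 * Im (W z) <= Y / 2) by lra.
      apply T; intros i; specialize (Yx i); apply Rabs_le_between in Yx; lra.
    - pose proof (triangle_half_plane x (W z) 0 1 (Y / 2) Tri) as T.
      enough (0 * Re (W z) + 1 * Im (W z) <= Y / 2) by lra.
      apply T; intros i; specialize (Yx i); apply Rabs_le_between in Yx; lra. }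
  set (t := s * (Re (W z) - p v)).
  assert (Et : Re (W z) - p v = s * t) by (unfold t; rewrite <- Rmult_assoc, Ss; ring).
  assert (Pall : forall P : idx -> Prop, P v -> P m -> P u -> forall i, P i).
  { intros P V1 V2 V3 i; destruct v, m, u, i; try contradiction; assumption. }
  assert (Pt : 0 <= t).
  { pose proof (triangle_half_plane x (W z) (- s) 0 (- s * p v) Tri) as T.
    enough (- s * Re (W z) + 0 * Im (W z) <= - s * p v) by (unfold t; lra).
    apply T; apply Pall; rewrite (proj1 (Hxy _)); unfold D, Du in *; lra. }
  assert (Pt' : t <= D + Du).
  { pose proof (triangle_half_plane x (W z) s 0 (s * p u) Tri) as T.
    enough (s * Re (W z) + 0 * Im (W z) <= s * p u) by (unfold t, D, Du in *; lra).
    apply T; apply Pall; rewrite (proj1 (Hxy _)); unfold D, Du in *; lra. }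
  assert (Abs_s : forall r, 0 <= r -> Rabs (s * r) = r).
  { intros r Hr; rewrite Rabs_mult, (Rabs_right r) by lra.
    assert (E : (s - 1) * (s + 1) = 0) by lra; apply Rmult_integral in E.
    destruct E as [E | E]; [replace s with 1 by lra; rewrite Rabs_R1; ring |].
    replace s with (- (1)) by lra; rewrite Rabs_Ropp, Rabs_R1; ring. }
  assert (Vert : forall c : C, forall i, Rabs (Im c) <= Y / 2 ->
            Rabs (Re c - p i) <= Cmod (c - x i)%C <= Rabs (Re c - p i) + Y).
  { intros c i Hc; pose proof (Rabs_Re_le (c - x i)%C) as V1; pose proof (Cmod_le_sum (c - x i)%C) as V2.
    change (Re (c - x i)%C) with (Re c - Re (x i)) in *; change (Im (c - x i)%C) with (Im c - Im (x i)) in *.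
    rewrite (proj1 (Hxy i)) in *; split; [exact V1 |].
    specialize (Yx i); pose proof (Rabs_triang (Im c) (- Im (x i))) as T; rewrite Rabs_Ropp in T.
    unfold Rminus in *; lra. }
  destruct (Vert (W z) v ImW) as [V1 V2]; rewrite Et, Abs_s in V1, V2 by exact Pt.
  destruct (Vert (W z) u ImW) as [_ V3].
  replace (Re (W z) - p u) with (s * - (D + Du - t)) in V3
    by (replace (s * - (D + Du - t)) with (s * t - s * D - s * Du) by ring;
        rewrite <- Et, <- ED, <- EDu; ring).
  rewrite Ropp_mult_distr_r_reverse, Rabs_Ropp, Abs_s in V3 by lra.
  destruct (Vert (x m) v (Yx m)) as [V4 V5]; rewrite (proj1 (Hxy m)), ED, Abs_s in V4, V5 by lra.
  destruct (Vert (x m) u (Yx m)) as [V6 _]; rewrite (proj1 (Hxy m)) in V6.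
  replace (p m - p u) with (- (s * Du)) in V6 by lra; rewrite Rabs_Ropp, Abs_s in V6 by lra.
  pose proof (exp_pos (PI * tau)) as PE.
  assert (E1 : exp (PI * tau) <= 1) by 
    (rewrite <- exp_0; apply exp_le_compat; assert (0 <= PI * - tau) by (apply Rmult_le_pos; lra); lra).
  assert (Ea : forall M, 0 < M -> Rpower (M * exp (PI * tau)) b = Rpower M b * exp (a * tau)).
  { intros M HM; rewrite Rpower_mult_exp by exact HM; do 2 f_equal; unfold b; field; lra. }
  set (q := exp (e * G * tau)).
  assert (Pq : 0 < q <= 1).
  { split; [apply exp_pos |]; unfold q; rewrite <- exp_0; apply exp_le_compat.
    assert (0 < e * G) by (apply Rmult_lt_0_compat; [lra | apply Rdiv_lt_0_compat; [lra |]];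
      rewrite Ed1; apply Rmult_lt_0_compat; lra).
    assert (0 <= e * G * - tau) by (apply Rmult_le_pos; lra); lra. }
  assert (Main : Rabs (t - D * q) <= 4 * mu * (D + Du) + 3 * Y).
  { apply (tip_arithmetic D Du t q Y mu (exp (a * tau)) (Rpower (/ L) b) (Rpower L b)); auto; try lra.
    - apply exp_neg_close; try lra; try (unfold G; lra).
      unfold G; apply Rmult_le_pos; [lra |]; apply Rdiv_le_0_compat; [lra |].
      rewrite Ed1; apply Rmult_lt_0_compat; lra.
    - apply exp_pos.
    - rewrite <- Ea by (apply Rinv_0_lt_compat; lra).
      eapply Rle_trans; [| exact V2].
      eapply Rle_trans; [| exact Low].
      apply Rmult_le_compat; [lra | left; apply exp_pos | exact V4 |].
      apply Rle_Rpower_l; [exact Pb |].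
      split; [apply Rmult_lt_0_compat; [apply Rinv_0_lt_compat; lra | exact PE] |].
      apply Rmin_glb.
      + apply Rle_trans with (/ 24 * 1); [| lra].
        apply Rmult_le_compat; try lra; [left; apply Rinv_0_lt_compat; lra | apply Rinv_le_contravar; lra].
      + apply Rle_trans with (exp (PI * tau) / K / 24); [| lra].
        apply Req_le; unfold L; field; lra.
    (* Beyond 1 / 2 the estimate at [v] has no upper half. The lower bound at the other tip replaces
       it, and exp (PI * tau) > 1 / (2 * K) keeps the expected value close to [D]. *)
    - destruct (Rle_or_lt X (1 / 2)) as [HX2 | HX2]; [left | right].
      + split; [left; apply exp_pos | split; [exact R2 |]].
        eapply Rle_trans; [exact V1 |]; eapply Rle_trans; [apply U, HX2 |].
        rewrite <- Ea by lra.
        apply Rmult_le_compat; [apply Cmod_ge_0 | left; apply exp_pos | exact V5 |].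
        apply Rle_Rpower_l; [exact Pb |]; split; [lra |].
        apply Rle_trans with (2 * (K * exp (PI * tau))); [lra |].
        unfold L; assert (0 < K * exp (PI * tau)) by (apply Rmult_lt_0_compat; lra); lra.
      + split.
        * replace (exp (a * tau)) with (Rpower (exp (PI * tau)) b).
          2: { pose proof (Ea 1 Rlt_0_1) as E; rewrite Rmult_1_l in E; rewrite E.
               unfold Rpower; rewrite ln_1, Rmult_0_r, exp_0; ring. }
          eapply Rle_trans; [exact R1 |]; apply Rle_Rpower_l; [exact Pb |].
          split; [apply Rinv_0_lt_compat; lra |].
          apply Rmult_le_reg_l with L; [lra |]; rewrite Rinv_r by lra; unfold L; lra.
        * eapply Rle_trans; [| exact V3]; eapply Rle_trans; [| exact Low'].
          apply Rmult_le_compat; [lra | lra | exact V6 |].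
          eapply Rle_trans; [exact R3 |]; apply Rle_Rpower_l; [exact Pb' |].
          split; [apply Rinv_0_lt_compat; lra |].
          assert (XK : X <= K).
          { eapply Rle_trans; [apply HX |]; rewrite <- (Rmult_1_r K) at 2.
            apply Rmult_le_compat_l; lra. }
          apply Rmin_glb.
          -- apply Rle_trans with (/ 24); [apply Rinv_le_contravar; lra | lra].
          -- apply Rle_trans with (/ K / 24); [apply Req_le; unfold L; field; lra |].
             unfold Rdiv; apply Rmult_le_compat_r; [lra | apply Rinv_le_contravar; lra]. }
  eapply Rle_trans; [apply Cmod_le_sum |].
  change (Re (W z - RtoC (p v + (p m - p v) * q))%C) with (Re (W z) - (p v + (p m - p v) * q)).
  change (Im (W z - RtoC (p v + (p m - p v) * q))%C) with (Im (W z) - 0).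
  replace (Re (W z) - (p v + (p m - p v) * q)) with (s * (t - D * q))
    by (replace (s * (t - D * q)) with (s * t - s * D * q) by ring; rewrite <- Et, <- ED; ring).
  rewrite Rminus_0_r, Rabs_mult.
  assert (As : Rabs s = 1) by (rewrite <- (Rmult_1_r s); apply Abs_s; lra).
  rewrite As; lra.
Qed.

(** * Closed half plane, gradient flow and the regions of the statement *)

Lemma size_shift (i : idx) (z : C) (h : R) :
  0 <= h -> Rabs (size i (z + h * Ci)%C - size i z) <= h.
Proof.
  intros Hh.
  assert (E : Cmod (h * Ci)%C = h) by (rewrite Cmod_mult, Cmod_Ci, Cmod_R, Rabs_right; lra).
  destruct i; simpl.
  - eapply Rle_trans; [apply Rabs_Cmod_minus |].
    replace (z + h * Ci - 1 - (z - 1))%C with (h * Ci)%C by ring; lra.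
  - rewrite Rminus_diag, Rabs_R0; exact Hh.
  - eapply Rle_trans; [apply Rabs_Cmod_minus |].
    replace (z + h * Ci - z)%C with (h * Ci)%C by ring; lra.
Qed.

(** Raising [z] by a small [h] changes each of the two sizes by at most a quarter, so 2 * K serves
    for the raised point; continuity of [W] costs the other half of [eta]. *)
Lemma thin_triangle_closed (p y : idx -> R) (v m u : idx) (K eta : R) :
  v <> m -> m <> u -> u <> v -> 0 < (p m - p v) * (p u - p m) ->
  0 < area2 p y v m u -> 0 < area2 p y u m v -> 1 <= K -> 0 < eta ->
  exists e0, 0 < e0 /\ forall e x W, 0 < e < e0 ->
    (forall i, Re (x i) = p i /\ Im (x i) = e * y i) ->
    counterclockwise x -> triangle_map x W ->
    forall z tau, 0 <= Im z -> 0 < size v z -> 0 < size u z -> tau <= 0 ->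
      exp (PI * tau) / K <= size v z / size u z <= K * exp (PI * tau) ->
      Cmod (W z - RtoC (p v + (p m - p v) *
        exp (e * (area2 p y v m u / ((p m - p v) * (p u - p v))) * tau)))%C <= eta.
Proof.
  intros N1 N2 N3 Hmid A1 A2 HK Heta.
  destruct (thin_triangle p y v m u (2 * K) (eta / 2) N1 N2 N3 Hmid A1 A2 ltac:(lra) ltac:(lra))
    as [e0 [Pe0 H]].
  exists e0; split; [exact Pe0 |]; intros e x W He Hxy Hx HW z tau Hz Pv Pu Htau HX.
  destruct HW as (HW1 & HW2 & HW3 & Cont & HW5).
  destruct (Cont z Hz (eta / 2) ltac:(lra)) as [d [Hd Hc]].
  assert (HW : triangle_map x W) by (repeat split; auto; apply HW5).
  set (h := Rmin (d / 2) (Rmin (size v z / 4) (size u z / 4))).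
  assert (Ph : 0 < h) by (apply Rmin_pos; [lra | apply Rmin_pos; lra]).
  assert (Hh : h <= d / 2 /\ h <= size v z / 4 /\ h <= size u z / 4).
  { unfold h; pose proof (Rmin_l (d / 2) (Rmin (size v z / 4) (size u z / 4)));
      pose proof (Rmin_r (d / 2) (Rmin (size v z / 4) (size u z / 4)));
      pose proof (Rmin_l (size v z / 4) (size u z / 4));
      pose proof (Rmin_r (size v z / 4) (size u z / 4)); lra. }
  destruct Hh as (H1 & H2 & H3).
  set (z' := (z + h * Ci)%C).
  assert (Iz' : Im z' = Im z + h) by (unfold z'; rewrite Im_plus, Im_mult; simpl; ring).
  pose proof (size_shift v z h ltac:(lra)) as S1; apply Rabs_le_between in S1.
  pose proof (size_shift u z h ltac:(lra)) as S2; apply Rabs_le_between in S2.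
  fold z' in S1, S2.
  set (E := exp (PI * tau)) in *; pose proof (exp_pos (PI * tau)) as PE; fold E in PE.
  assert (X1 : E * size u z <= K * size v z).
  { destruct HX as [L _]; apply Rmult_le_compat_r with (r := K * size u z) in L.
    - replace (E / K * (K * size u z)) with (E * size u z) in L by (field; lra).
      replace (size v z / size u z * (K * size u z)) with (K * size v z) in L by (field; lra); exact L.
    - apply Rmult_le_pos; lra. }
  assert (X2 : size v z <= K * E * size u z).
  { destruct HX as [_ U]; apply Rmult_le_compat_r with (r := size u z) in U; [| lra].
    replace (size v z / size u z * size u z) with (size v z) in U by (field; lra); exact U. }
  specialize (H e x W He Hxy Hx HW z' tau ltac:(lra) Htau).
  assert (HX' : E / (2 * K) <= size v z' / size u z' <= 2 * K * E).
  { assert (PKE : 0 < K * E) by (apply Rmult_lt_0_compat; lra).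
    split; apply Rmult_le_reg_r with (size u z'); try lra.
    - replace (size v z' / size u z' * size u z') with (size v z') by (field; lra).
      apply Rmult_le_reg_r with (2 * K); [lra |].
      replace (E / (2 * K) * size u z' * (2 * K)) with (E * size u z') by (field; lra).
      apply Rle_trans with (E * (5 / 4 * size u z)); [apply Rmult_le_compat_l; lra |].
      apply Rle_trans with (3 / 4 * size v z * (2 * K)).
      + assert (0 <= K * size v z) by (apply Rmult_le_pos; lra); lra.
      + apply Rmult_le_compat_r; lra.
    - replace (size v z' / size u z' * size u z') with (size v z') by (field; lra).
      apply Rle_trans with (2 * K * E * (3 / 4 * size u z)).
      + assert (0 <= K * E * size u z) by (apply Rmult_le_pos; lra); lra.
      + apply Rmult_le_compat_l; lra. }
  specialize (H HX'); specialize (Hc z' ltac:(lra)).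
  assert (Dz : Cmod (z' - z)%C < d).
  { unfold z'; replace (z + h * Ci - z)%C with (h * Ci)%C by ring.
    rewrite Cmod_mult, Cmod_Ci, Cmod_R, Rabs_right; lra. }
  specialize (Hc Dz).
  match goal with |- Cmod (W z - ?c)%C <= _ => set (c0 := c) in * end.
  replace (W z - c0)%C with (- (W z' - W z) + (W z' - c0))%C by ring.
  eapply Rle_trans; [apply Cmod_triangle |]; rewrite Cmod_opp; lra.
Qed.

(** The witness [t0] keeps the supremum from being minus infinity, hence makes it finite. *)
Lemma tends_to_0_of_uniform {T : Type} (D : T -> Prop) (h : R -> T -> R) (t0 : T) :
  D t0 -> (forall e t, 0 <= h e t) ->
  (forall eta, 0 < eta -> exists e0, 0 < e0 /\ forall e, 0 < e < e0 -> forall t, D t -> h e t <= eta) ->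
  tends_to_0_at_0plus (fun e => sup_over D (h e)).
Proof.
  intros D0 Pos Unif.
  assert (Key : forall eta, 0 < eta -> exists e0, 0 < e0 /\ forall e, 0 < e < e0 ->
            is_finite (sup_over D (h e)) /\ 0 <= real (sup_over D (h e)) <= eta).
  { intros eta He; destruct (Unif eta He) as [e0 [P H]]; exists e0; split; [exact P |].
    intros e Hlt; specialize (H e Hlt).
    destruct (Lub_Rbar_correct (fun r => exists x, D x /\ r = h e x)) as [U L].
    assert (B : Rbar_le (sup_over D (h e)) eta).
    { apply L; intros r [x [Dx ->]]; apply H, Dx. }
    assert (B' : Rbar_le (h e t0) (sup_over D (h e))) by (apply U; exists t0; auto).
    unfold sup_over in *; specialize (Pos e t0).
    destruct (Lub_Rbar _) as [r | |]; simpl in *; try contradiction.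
    split; [reflexivity | lra]. }
  split.
  - destruct (Key 1 Rlt_0_1) as [e0 [P H]]; exists (mkposreal e0 P); intros e He Pe.
    apply H; split; [exact Pe |]; revert He; unfold ball; simpl;
      unfold AbsRing_ball, abs, minus, plus, opp; simpl.
    rewrite Rabs_right; lra.
  - intros P [d Hd]; destruct (Key (d / 2) ltac:(pose proof (cond_pos d); lra)) as [e0 [P0 H]].
    exists (mkposreal e0 P0); intros e He Pe; apply Hd.
    destruct (H e) as [_ B].
    { split; [exact Pe |]; revert He; unfold ball; simpl;
      unfold AbsRing_ball, abs, minus, plus, opp; simpl.
      rewrite Rabs_right; lra. }
    unfold ball; simpl;
      unfold AbsRing_ball, abs, minus, plus, opp; simpl.
    pose proof (cond_pos d); rewrite Rabs_right; lra.
Qed.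

(** (J t - p) * exp (A * t) is constant on t < 0, and the one-sided derivative makes [J] continuous
    up to 0. For A > 0 the factor exp (- A * t) is at least 1, so convergence to [p] at minus
    infinity forces the constant to vanish. *)
Lemma linear_flow (J : R -> R) (A p : R) :
  (forall t, t <= 0 ->
     filterdiff (K := R_AbsRing) (U := R_NormedModule) (V := R_NormedModule)
       J (within (fun s => s <= 0) (locally t)) (fun h => h * - (A * (J t - p)))) ->
  is_lim J m_infty p ->
  (forall t, t <= 0 -> J t = p + (J 0 - p) * exp (- A * t)) /\ (0 < A -> J 0 = p).
Proof.
  intros HJ Hlim.
  assert (Loc : forall t, t <= 0 -> forall e, 0 < e -> exists d, 0 < d /\ forall s, s <= 0 ->
            Rabs (s - t) < d -> Rabs (J s - J t - (s - t) * - (A * (J t - p))) <= e * Rabs (s - t)).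
  { intros t Ht e He; destruct (HJ t Ht) as [_ Hd].
    assert (FL : is_filter_lim (within (fun s => s <= 0) (locally t)) t).
    { intros P HP; unfold within; apply filter_imp with (2 := HP); auto. }
    destruct (Hd t FL (mkposreal e He)) as [d H]; exists d; split; [apply cond_pos |].
    intros s Hs Hst; exact (H s Hst Hs). }
  assert (Der : forall t, t < 0 -> is_derive J t (- (A * (J t - p)))).
  { intros t Ht; apply is_derive_Reals; intros e He.
    destruct (Loc t ltac:(lra) (e / 2) ltac:(lra)) as [d [Hd H]].
    assert (Pm : 0 < Rmin d (- t)) by (apply Rmin_pos; lra).
    exists (mkposreal _ Pm); simpl; intros h Nh Hh.
    pose proof (Rmin_l d (- t)); pose proof (Rmin_r d (- t)).
    assert (t + h <= 0) by (pose proof (Rle_abs h); lra).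
    specialize (H (t + h) ltac:(assumption)).
    replace (t + h - t) with h in H by ring; specialize (H ltac:(lra)).
    replace ((J (t + h) - J t) / h - - (A * (J t - p)))
      with ((J (t + h) - J t - h * - (A * (J t - p))) * / h) by (field; exact Nh).
    pose proof (Rabs_pos_lt h Nh) as Ph.
    rewrite Rabs_mult, Rabs_inv; apply Rmult_lt_reg_r with (Rabs h); [exact Ph |].
    rewrite Rmult_assoc, Rinv_l, Rmult_1_r by lra.
    eapply Rle_lt_trans; [exact H |]; apply Rmult_lt_compat_r; lra. }
  set (g := fun t => (J t - p) * exp (A * t)).
  assert (Const : forall s t, s < t -> t < 0 -> g s = g t).
  { intros s t Hst Ht; apply (eq_is_derive g s t); [| exact Hst].
    intros r Hr; unfold g.
    assert (D1 := proj1 (is_derive_Reals _ _ _) (Der r ltac:(lra))).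
    assert (D2 : derivable_pt_lim (fun t => exp (A * t)) r (A * exp (A * r))).
    { apply is_derive_Reals; auto_derive; [exact I | ring]. }
    assert (D3 : derivable_pt_lim (fun t => J t - p) r (- (A * (J r - p)) - 0)).
    { apply (derivable_pt_lim_minus J (fun _ => p)); [exact D1 | apply derivable_pt_lim_const]. }
    pose proof (derivable_pt_lim_mult _ _ _ _ _ D3 D2) as D4; apply is_derive_Reals.
    change (derivable_pt_lim (fun t => (J t - p) * exp (A * t)) r 0).
    replace 0 with ((- (A * (J r - p)) - 0) * exp (A * r) + (J r - p) * (A * exp (A * r)));
      [exact D4 | ring]. }
  set (c := g (-1)).
  assert (Form : forall t, t < 0 -> J t = p + c * exp (- A * t)).
  { intros t Ht.
    assert (Eg : g t = c).
    { unfold c; destruct (Rtotal_order t (-1)) as [L | [-> | L]].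
      - apply Const; lra.
      - reflexivity.
      - symmetry; apply Const; lra. }
    rewrite <- Eg; unfold g.
    rewrite Rmult_assoc, <- exp_plus; replace (A * t + - A * t) with 0 by ring.
    rewrite exp_0; ring. }
  assert (Ec : J 0 = p + c).
  { apply NNPP; intros Ne.
    set (gap := Rabs (J 0 - (p + c))).
    assert (Pg : 0 < gap) by (apply Rabs_pos_lt; lra).
    destruct (Loc 0 (Rle_refl 0) 1 Rlt_0_1) as [d [Hd H]].
    set (M := Rabs (A * (J 0 - p)) + 1).
    assert (PM : 1 <= M) by (unfold M; pose proof (Rabs_pos (A * (J 0 - p))); lra).
    assert (Cg : continuity_pt (fun t => p + c * exp (- A * t)) 0) by reg.
    destruct (Cg (gap / 2) ltac:(lra)) as [d2 [Hd2 H2]].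
    set (s := - (Rmin (Rmin d d2) (gap / (2 * M)) / 2)).
    assert (Pm : 0 < Rmin (Rmin d d2) (gap / (2 * M))).
    { apply Rmin_pos; [apply Rmin_pos; lra | apply Rdiv_lt_0_compat; lra]. }
    pose proof (Rmin_l (Rmin d d2) (gap / (2 * M))); pose proof (Rmin_r (Rmin d d2) (gap / (2 * M))).
    pose proof (Rmin_l d d2); pose proof (Rmin_r d d2).
    assert (As : Rabs s = - s) by (apply Rabs_left; unfold s; lra).
    assert (Hs : s < 0 /\ - s < d /\ - s < d2 /\ - s < gap / (2 * M)) by (unfold s; lra).
    specialize (H s ltac:(lra)); rewrite Rminus_0_r in H; specialize (H ltac:(lra)).
    specialize (H2 s); unfold dist in H2; simpl in H2; unfold Rdist in H2.
    specialize (H2 ltac:(split; [split; [exact I | lra] | rewrite Rminus_0_r; lra])).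
    rewrite <- Form in H2 by lra; rewrite Rmult_0_r, exp_0, Rmult_1_r in H2.
    assert (B : Rabs (J s - J 0) <= M * - s).
    { replace (J s - J 0) with ((J s - J 0 - s * - (A * (J 0 - p))) + s * - (A * (J 0 - p))) by ring.
      eapply Rle_trans; [apply Rabs_triang |]; rewrite (Rabs_mult s), Rabs_Ropp, As in *.
      unfold M; lra. }
    assert (B2 : M * - s < gap / 2).
    { apply Rlt_le_trans with (M * (gap / (2 * M))); [apply Rmult_lt_compat_l; lra |].
      apply Req_le; field; lra. }
    assert (T : gap <= Rabs (J s - J 0) + Rabs (J s - (p + c))).
    { unfold gap; replace (J 0 - (p + c)) with (- (J s - J 0) + (J s - (p + c))) by ring.
      eapply Rle_trans; [apply Rabs_triang |]; rewrite Rabs_Ropp; lra. }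
    lra. }
  assert (Ecp : J 0 - p = c) by lra.
  split.
  - intros t Ht; rewrite Ecp; destruct Ht as [L | ->]; [apply Form, L |].
    rewrite Rmult_0_r, exp_0; lra.
  - intros PA; apply NNPP; intros Ne.
    assert (Pc : 0 < Rabs c) by (apply Rabs_pos_lt; lra).
    assert (Hn : Rbar_locally p (fun r => Rabs (r - p) < Rabs c)).
    { exists (mkposreal _ Pc); intros r Hr; exact Hr. }
    destruct (Hlim _ Hn) as [M HM].
    set (t := Rmin M 0 - 1).
    assert (t < M /\ t < 0) as [T1 T2].
    { unfold t; pose proof (Rmin_l M 0); pose proof (Rmin_r M 0); lra. }
    specialize (HM t T1); simpl in HM; rewrite Form in HM by exact T2.
    replace (p + c * exp (- A * t) - p) with (c * exp (- A * t)) in HM by ring.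
    rewrite Rabs_mult, (Rabs_right (exp (- A * t))) in HM by (left; apply exp_pos).
    assert (1 <= exp (- A * t)).
    { rewrite <- exp_0; apply exp_le_compat; assert (0 <= A * - t) by (apply Rmult_le_pos; lra); lra. }
    assert (Rabs c * 1 <= Rabs c * exp (- A * t)) by (apply Rmult_le_compat_l; lra); lra.
Qed.

(** Put r = delta * exp (PI * tau) <= 1 / 2. At a finite end the size is [r] and the others lie in
    [1/2, 3/2]; at infinity the size is 1 and the others are within 1 of 1 / r. *)
Lemma end_sizes (i j : idx) (delta tau sigma : R) :
  0 < delta <= 1 / 2 -> tau < 0 -> 0 <= sigma <= 1 -> j <> i ->
  let z := phi (zpt i) delta (tau, sigma) in
  0 <= Im z /\ 0 < size i z /\ 0 < size j z /\
  delta * exp (PI * tau) / 2 <= size i z / size j z <= 2 * (delta * exp (PI * tau)).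
Proof.
  intros Hd Ht Hs Hj z; pose proof PI_RGT_0 as HPI.
  set (r := delta * exp (PI * tau)).
  pose proof (exp_pos (PI * tau)) as PE.
  assert (E1 : exp (PI * tau) <= 1).
  { rewrite <- exp_0; apply exp_le_compat; assert (0 <= PI * - tau) by (apply Rmult_le_pos; lra); lra. }
  assert (Pr : 0 < r) by (apply Rmult_lt_0_compat; lra).
  assert (Hr : r <= 1 / 2).
  { apply Rle_trans with (delta * 1); [apply Rmult_le_compat_l |]; lra. }
  assert (Ss : 0 <= sin (PI * sigma)).
  { apply sin_ge_0; [apply Rmult_le_pos; lra |].
    rewrite <- (Rmult_1_r PI) at 2; apply Rmult_le_compat_l; lra. }
  set (q := (PI * (tau + Ci * sigma))%C).
  assert (Rq : Re q = PI * tau /\ Im q = PI * sigma).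
  { unfold q; simpl; unfold Re, Im; simpl; split; ring. }
  destruct Rq as [Rq Iq].
  assert (Cq : Cmod (delta * Cexp q)%C = r).
  { rewrite Cmod_mult, Cmod_R, Rabs_right, Cmod_Cexp, Rq by lra; reflexivity. }
  assert (Imq : 0 <= Im (delta * Cexp q)%C).
  { rewrite (proj2 (Re_Im_scal _ _)), Im_Cexp, Rq, Iq.
    apply Rmult_le_pos; [lra | apply Rmult_le_pos; lra]. }
  assert (Ratio : forall w, 1 / 2 <= w <= 3 / 2 -> r / 2 <= r / w <= 2 * r).
  { intros w Hw; split; unfold Rdiv.
    - apply Rmult_le_compat_l; [lra |]; apply Rinv_le_contravar; lra.
    - rewrite (Rmult_comm 2); apply Rmult_le_compat_l; [lra |].
      apply Rmult_le_reg_r with w; [lra |]; rewrite Rinv_l by lra; lra. }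
  assert (Dist : forall a b : C, Cmod (a - b)%C = r -> Cmod b = 1 -> 1 / 2 <= Cmod a <= 3 / 2).
  { intros a b Hab Hb; pose proof (Rabs_Cmod_minus b a) as T; rewrite Hab, Hb in T.
    apply Rabs_le_between in T; lra. }
  destruct i.
  - assert (Ez : z = (1 + delta * Cexp q)%C) by reflexivity.
    assert (S1 : Cmod (z - 1)%C = r).
    { rewrite Ez; replace (1 + delta * Cexp q - 1)%C with (delta * Cexp q)%C by ring; exact Cq. }
    assert (S3 : 1 / 2 <= Cmod z <= 3 / 2) by (apply (Dist z 1); [exact S1 | apply Cmod_1]).
    assert (Iz : 0 <= Im z) by 
      (rewrite Ez; change (0 <= 0 + Im (delta * Cexp q)%C); lra).
    split; [exact Iz |]; destruct j; [contradiction | |]; simpl; rewrite S1;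
      (split; [lra | split; [lra | apply Ratio; lra]]).
  - assert (Ez : z = (- (/ delta) * Cexp (- q))%C) by reflexivity.
    assert (Cz : Cmod z = / r).
    { rewrite Ez, Cmod_mult, Cmod_opp, <- RtoC_inv, Cmod_R, Cmod_Cexp by lra.
      change (Re (- q)%C) with (- Re q); rewrite Rq, exp_Ropp, Rabs_right.
      - unfold r; rewrite Rinv_mult; reflexivity.
      - left; apply Rinv_0_lt_compat; lra. }
    assert (Iz : 0 <= Im z).
    { rewrite Ez, <- RtoC_inv, <- RtoC_opp, (proj2 (Re_Im_scal _ _)), Im_Cexp by lra.
      change (Re (- q)%C) with (- Re q); change (Im (- q)%C) with (- Im q).
      rewrite Iq, sin_neg.
      replace (- / delta * (exp (- Re q) * - sin (PI * sigma)))
        with (/ delta * (exp (- Re q) * sin (PI * sigma))) by ring.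
      apply Rmult_le_pos; [left; apply Rinv_0_lt_compat; lra |].
      apply Rmult_le_pos; [left; apply exp_pos | exact Ss]. }
    assert (R2 : 2 <= / r).
    { replace 2 with (/ (1 / 2)) by field; apply Rinv_le_contravar; lra. }
    split; [exact Iz |]; destruct j; [| contradiction |]; simpl.
    + pose proof (Rabs_Cmod_minus z (z - 1)%C) as T.
      replace (z - 1 - z)%C with (- (1))%C in T by ring; rewrite Cmod_m1, Cz in T.
      apply Rabs_le_between in T.
      split; [lra | split; [lra |]].
      replace (1 / Cmod (z - 1)%C) with (r / (r * Cmod (z - 1)%C)) by (field; lra).
      apply Ratio; assert (Er : r * / r = 1) by (apply Rinv_r; lra).
      assert (r * (/ r - 1) <= r * Cmod (z - 1)%C) by (apply Rmult_le_compat_l; lra).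
      assert (r * Cmod (z - 1)%C <= r * (/ r + 1)) by (apply Rmult_le_compat_l; lra).
      lra.
    + rewrite Cz; split; [lra | split; [lra |]].
      replace (1 / / r) with (r / 1) by (field; lra); apply Ratio; lra.
  - assert (Ez : z = (delta * Cexp q)%C) by (unfold z; simpl; fold q; ring).
    assert (S3 : Cmod z = r) by (rewrite Ez; exact Cq).
    assert (S1 : 1 / 2 <= Cmod (z - 1)%C <= 3 / 2).
    { apply (Dist _ (- (1))%C); [| apply Cmod_m1].
      replace (z - 1 - - (1))%C with z by ring; exact S3. }
    assert (Iz : 0 <= Im z) by (rewrite Ez; exact Imq).
    split; [exact Iz |]; destruct j; [| | contradiction]; simpl; rewrite S3;
      (split; [lra | split; [lra | apply Ratio; lra]]).
Qed.

Lemma thick_sizes (delta : R) (z : C) :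
  0 < delta <= 1 / 2 -> thick_part delta z ->
  0 <= Im z /\ forall i, delta <= size i z <= 2 / delta.
Proof.
  intros Hd [Hz H]; split; [exact Hz |].
  pose proof (H i1) as H1; pose proof (H i2) as H2; pose proof (H i3) as H3; simpl in H1, H2, H3.
  unfold closed_half_plane in Hz.

  assert (B3 : delta <= Cmod z).
  { apply Rnot_lt_le; intros L; apply H3; split; [| exact Hz].
    replace (z - 0)%C with z by ring; exact L. }
  assert (Id : 2 <= / delta).
  { replace 2 with (/ (1 / 2)) by field; apply Rinv_le_contravar; lra. }
  assert (B2 : Cmod z <= / delta).
  { apply Rnot_lt_le; intros L; apply H2; split; [apply Cmod_gt_0; lra | split; [| exact Hz]].
    apply Rmult_lt_reg_l with (Cmod z); [lra |]; rewrite Rinv_r by lra.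
    apply Rmult_lt_compat_r with (r := delta) in L; [| lra]; rewrite Rinv_l in L; lra. }
  assert (B4 : Cmod (z - 1)%C <= / delta + 1).
  { pose proof (Cmod_triangle z (- (1))%C) as T; rewrite Cmod_m1 in T.
    eapply Rle_trans; [exact T | lra]. }
  intros []; simpl; unfold Rdiv; lra.
Qed.

(** * Slopes, Morse index and orientation of the affine data *)

Lemma idx_choice {T : Type} (P : idx -> T -> Prop) :
  (forall i, exists t, P i t) -> exists g, forall i, P i (g i).
Proof.
  intros H; destruct (H i1) as [t1 H1]; destruct (H i2) as [t2 H2]; destruct (H i3) as [t3 H3].
  exists (fun i => match i with i1 => t1 | i2 => t2 | i3 => t3 end); intros []; assumption.
Qed.

Lemma affine_slopes (L : idx -> C -> Prop) (f : idx -> R -> R) :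
  (forall i, affine_section (L i)) -> (forall i, same_set (L i) (graph (Derive (f i)))) ->
  exists a b : idx -> R, forall i,
    (forall t, Derive (f i) t = a i * t + b i) /\ (forall z, L i z <-> Im z = a i * Re z + b i).
Proof.
  intros HL Hf.
  destruct (idx_choice (fun i (ab : R * R) => (forall t, Derive (f i) t = fst ab * t + snd ab) /\
              (forall z, L i z <-> Im z = fst ab * Re z + snd ab))) as [g Hg].
  - intros i; destruct (HL i) as (a & b & Hab); exists (a, b); simpl; split; [| exact Hab].
    intros t; apply (Hab (t, Derive (f i) t)), (Hf i); reflexivity.
  - exists (fun i => fst (g i)), (fun i => snd (g i)); exact Hg.
Qed.

(** The list of negative eigenvalues is empty, while a negative [A] would be one, with eigenvector
    1. *)
Lemma morse_index_zero (g : R -> R) (A B p : R) :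
  (forall t, is_derive g t (A * t + B)) -> A <> 0 -> has_morse_index g p 0 -> 0 < A.
Proof.
  intros Hg NA (_ & _ & s & _ & Hs & H).
  destruct s; [| discriminate].
  apply Rnot_le_lt; intros L.
  apply (proj2 (H A)); split; [| lra].
  exists 1; split; [lra |]; unfold hessian; rewrite Rmult_1_r; f_equal.
  assert (D1 : forall t, Derive g t = A * t + B) by (intros t; apply is_derive_unique, Hg).
  simpl; rewrite (Derive_ext _ (fun t => A * t + B)) by exact D1.
  rewrite Rmult_1_r; apply is_derive_unique; auto_derive; [exact I | ring].
Qed.

(** The two edges at [x i] run along the lines [i] and [nxt i], so their cross product is the
    product of the horizontal displacements and the slope difference. Its sign tells which vertex
    lies horizontally between the others: the one where the slope increases. *)
Lemma affine_triangle_turn (x : idx -> C) (p a b : idx -> R) (i : idx) :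
  counterclockwise x -> (forall i, Re (x i) = p i) ->
  (forall i, Im (x i) = a i * p i + b i /\ Im (x i) = a (nxt i) * p i + b (nxt i)) ->
  0 < (p (nxt i) - p i) * (p (nxt (nxt i)) - p i) * - (a (nxt i) - a i).
Proof.
  intros Hx Hp Hy; pose proof (counterclockwise_rot x i Hx) as H; unfold cross in H.
  rewrite !Re_minus, !Im_minus, !Hp in H.
  assert (E1 : Im (x (nxt i)) - Im (x i) = a (nxt i) * (p (nxt i) - p i)).
  { rewrite (proj1 (Hy (nxt i))), (proj2 (Hy i)); ring. }
  assert (E2 : Im (x (nxt (nxt i))) - Im (x i) = a i * (p (nxt (nxt i)) - p i)).
  { rewrite (proj2 (Hy (nxt (nxt i)))), (proj1 (Hy i)).
    replace (nxt (nxt (nxt i))) with i by (destruct i; reflexivity); ring. }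
  rewrite E1, E2 in H; lra.
Qed.

(** The edge slopes again; this identifies the rate found for thin triangles with that of the
    gradient flow. *)
Lemma area2_slope (x : idx -> C) (p a b : idx -> R) (v m u : idx) :
  v <> m -> m <> u -> u <> v ->
  (forall i, Im (x i) = a i * p i + b i /\ Im (x i) = a (nxt i) * p i + b (nxt i)) ->
  0 < (p m - p v) * (p u - p v) -> a (nxt v) - a v < 0 ->
  area2 p (fun i => Im (x i)) v m u = (p m - p v) * (p u - p v) * - (a (nxt v) - a v).
Proof.
  intros N1 N2 N3 Hy Hp Ha; unfold area2.
  assert (P : 0 < (p m - p v) * (p u - p v) * - (a (nxt v) - a v)) by (apply Rmult_lt_0_compat; lra).
  assert (E1 : Im (x (nxt v)) - Im (x v) = a (nxt v) * (p (nxt v) - p v)).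
  { rewrite (proj1 (Hy (nxt v))), (proj2 (Hy v)); ring. }
  assert (E2 : Im (x (nxt (nxt v))) - Im (x v) = a v * (p (nxt (nxt v)) - p v)).
  { rewrite (proj2 (Hy (nxt (nxt v)))), (proj1 (Hy v)).
    replace (nxt (nxt (nxt v))) with v by (destruct v; reflexivity); ring. }
  assert (Cases : m = nxt v /\ u = nxt (nxt v) \/ m = nxt (nxt v) /\ u = nxt v).
  { destruct v, m, u; simpl; try contradiction; auto. }
  destruct Cases as [[-> ->] | [-> ->]]; rewrite E1, E2.
  - replace ((p (nxt v) - p v) * (a v * (p (nxt (nxt v)) - p v)) -
             a (nxt v) * (p (nxt v) - p v) * (p (nxt (nxt v)) - p v))
      with ((p (nxt v) - p v) * (p (nxt (nxt v)) - p v) * - (a (nxt v) - a v)) by ring.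
    apply Rabs_right; lra.
  - replace ((p (nxt (nxt v)) - p v) * (a (nxt v) * (p (nxt v) - p v)) -
             a v * (p (nxt (nxt v)) - p v) * (p (nxt v) - p v))
      with (- ((p (nxt (nxt v)) - p v) * (p (nxt v) - p v) * - (a (nxt v) - a v))) by ring.
    rewrite Rabs_Ropp; apply Rabs_right; lra.
Qed.

Theorem theorem3p1 :
  forall (L : idx -> C -> Prop) (f : idx -> R -> R) (x : idx -> C)
    (p : idx -> R) (I : idx -> R -> R)
    (xeps : R -> idx -> C) (w : R -> option C -> C) (delta p0 : R),
  (forall i, affine_section (L i)) ->
  (forall i j, i <> j -> exists z, L i z /\ L j z) ->
  (forall i j, i <> j -> ~ same_set (L i) (L j)) ->
  (forall i t, ex_derive (f i) t) ->
  (forall i, same_set (L i) (graph (Derive (f i)))) ->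
  (forall i, L i (x i) /\ L (nxt i) (x i)) ->
  pairwise_distinct x ->
  counterclockwise x ->
  (forall i, critical_point (diff f i) (p i)) ->
  gradient_tree f p I ->
  (forall e, 0 < e -> forall i,
     graph (fun t => e * Derive (f i) t) (xeps e i) /\
     graph (fun t => e * Derive (f (nxt i)) t) (xeps e i)) ->
  (forall e, 0 < e -> schwarz_christoffel zpt (xeps e) (w e)) ->
  0 < delta ->
  (forall i j, i <> j -> forall z,
     ~ (half_disc (zpt i) delta z /\ half_disc (zpt j) delta z)) ->
  (exists i, p0 = p i /\ has_morse_index (diff f i) (p i) 0) ->
  tends_to_0_at_0plus (fun e =>
    sup_over (thick_part delta)
      (fun z => Cmod (w e (Some z) - RtoC p0)%C)) /\
  (forall i,
    I i 0 = p0 /\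
    tends_to_0_at_0plus (fun e =>
      sup_over Theta_ext
        (fun q => Cmod (w e (Some (phi (zpt i) delta q))
                        - RtoC (I i (e * fst q)%R))%C))).
Proof.
  intros L f x p I xeps w delta p0 HL Hcap Hne Hdf Hgraph Hx Hdist Hccw Hcrit Htree Hxe Hsc
    Hdelta Hdisj (m & Ep0 & Hm).
  destruct (affine_slopes L f HL Hgraph) as (a & b & Hab).
  set (A := fun i => a (nxt i) - a i).
  assert (NA : forall i, A i <> 0).
  { intros i E; unfold A in E; assert (Ea : a (nxt i) = a i) by lra.
    assert (Ni : i <> nxt i) by (destruct i; discriminate).
    destruct (Hcap i (nxt i) Ni) as (z & Z1 & Z2).
    apply (proj2 (Hab i)) in Z1; apply (proj2 (Hab (nxt i))) in Z2.
    apply (Hne i (nxt i) Ni); intros z'; rewrite (proj2 (Hab i)), (proj2 (Hab (nxt i))).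
    rewrite Ea in *; replace (b (nxt i)) with (b i) by lra; tauto. }
  assert (Ddiff : forall i t, is_derive (diff f i) t (A i * t + (b (nxt i) - b i))).
  { intros i t; unfold diff.
    replace (A i * t + (b (nxt i) - b i)) with (minus (Derive (f (nxt i)) t) (Derive (f i) t)).
    - apply (is_derive_minus (f (nxt i)) (f i)); apply Derive_correct, Hdf.
    - rewrite (proj1 (Hab i)), (proj1 (Hab (nxt i))); unfold minus, plus, opp, A; simpl; ring. }
  assert (Hp : forall i, A i * p i + (b (nxt i) - b i) = 0).
  { intros i; pose proof (is_derive_unique _ _ _ (Hcrit i)) as E1.
    rewrite (is_derive_unique _ _ _ (Ddiff i (p i))) in E1; exact E1. }
  assert (Base : forall i r, A i * r + (b (nxt i) - b i) = 0 -> r = p i).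
  { intros i r Hr; specialize (Hp i); apply Rmult_eq_reg_l with (A i); [lra | apply NA]. }
  assert (Rx : forall i, Re (x i) = p i).
  { intros i; destruct (Hx i) as [H1 H2]; apply (proj2 (Hab i)) in H1.
    apply (proj2 (Hab (nxt i))) in H2; apply Base; unfold A; lra. }
  assert (Ix : forall i, Im (x i) = a i * p i + b i /\ Im (x i) = a (nxt i) * p i + b (nxt i)).
  { intros i; destruct (Hx i) as [H1 H2]; apply (proj2 (Hab i)) in H1.
    apply (proj2 (Hab (nxt i))) in H2; rewrite Rx in H1, H2; auto. }
  set (y := fun i => Im (x i)).
  assert (Hxy : forall e, 0 < e -> forall i, Re (xeps e i) = p i /\ Im (xeps e i) = e * y i).
  { intros e He i; destruct (Hxe e He i) as [H1 H2]; unfold graph in H1, H2.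
    rewrite (proj1 (Hab i)) in H1; rewrite (proj1 (Hab (nxt i))) in H2.
    assert (R1 : Re (xeps e i) = p i).
    { apply Base; unfold A; apply Rmult_eq_reg_l with e; lra. }
    split; [exact R1 |]; rewrite H1, R1; unfold y; rewrite (proj1 (Ix i)); reflexivity. }
  assert (Hccwe : forall e, 0 < e -> counterclockwise (xeps e)).
  { intros e He; unfold counterclockwise in *.
    rewrite !(fun i => proj1 (Hxy e He i)), !(fun i => proj2 (Hxy e He i)).
    rewrite !Rx in Hccw; change (Im (x i1)) with (y i1) in Hccw.
    change (Im (x i2)) with (y i2) in Hccw; change (Im (x i3)) with (y i3) in Hccw.
    apply Rmult_lt_compat_l with (r := e) in Hccw; lra. }
  assert (HW : forall e, 0 < e -> triangle_map (xeps e) (fun z => w e (Some z))).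
  { intros e He; apply schwarz_christoffel_triangle_map; auto. }
  assert (Am : 0 < A m) by (apply (morse_index_zero _ _ _ _ (Ddiff m) (NA m) Hm)).
  destruct Htree as (Hode & Hlim & J1 & J2).
  assert (Flow : forall i, (forall t, t <= 0 -> I i t = p i + (I i 0 - p i) * exp (- A i * t)) /\
                           (0 < A i -> I i 0 = p i)).
  { intros i; apply linear_flow; [| apply Hlim].
    intros t Ht; specialize (Hode i t Ht).
    rewrite (is_derive_unique _ _ _ (Ddiff i (I i t))) in Hode.
    replace (A i * (I i t - p i)) with (A i * I i t + (b (nxt i) - b i)); [exact Hode |].
    specialize (Hp i); lra. }
  (* The edge at [m] issues from a minimum, so [linear_flow] makes it end at p0, and the three
     curves agree at 0. *)
  assert (I0 : forall i, I i 0 = p0).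
  { assert (Im0 : I m 0 = p0) by (rewrite Ep0; apply Flow, Am).
    intros i; destruct m, i; congruence. }
  (* Since A m > 0, the horizontal displacements from [x m] to the two other vertices have opposite
     signs, so [x m] is the middle vertex. *)
  assert (Hmid : forall v u, v <> m -> m <> u -> u <> v -> 0 < (p m - p v) * (p u - p m)).
  { intros v u N1 N2 N3.
    pose proof (affine_triangle_turn x p a b m Hccw Rx Ix) as T; fold (A m) in T.
    assert (T2 : (p (nxt m) - p m) * (p (nxt (nxt m)) - p m) < 0).
    { apply Rmult_lt_reg_r with (A m); [exact Am | lra]. }
    assert (Cases : v = nxt m /\ u = nxt (nxt m) \/ v = nxt (nxt m) /\ u = nxt m).
    { destruct v, m, u; simpl; try contradiction; auto. }
    destruct Cases as [[-> ->] | [-> ->]]; lra. }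
  assert (Hout : forall v u, v <> m -> m <> u -> u <> v -> 0 < (p m - p v) * (p u - p v)).
  { intros v u N1 N2 N3; specialize (Hmid v u N1 N2 N3).
    replace (p u - p v) with ((p u - p m) + (p m - p v)) by ring.
    pose proof (Rle_0_sqr (p m - p v)) as S; unfold Rsqr in S; rewrite Rmult_plus_distr_l; lra. }
  assert (Av : forall v u, v <> m -> m <> u -> u <> v -> A v < 0).
  { intros v u N1 N2 N3; specialize (Hout v u N1 N2 N3).
    pose proof (affine_triangle_turn x p a b v Hccw Rx Ix) as T; fold (A v) in T.
    apply Ropp_lt_cancel; rewrite Ropp_0.
    apply Rmult_lt_reg_l with ((p m - p v) * (p u - p v)); [exact Hout |]; rewrite Rmult_0_r.
    assert (Cases : m = nxt v /\ u = nxt (nxt v) \/ m = nxt (nxt v) /\ u = nxt v).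
    { destruct v, m, u; simpl; try contradiction; auto. }
    destruct Cases as [[-> ->] | [-> ->]]; lra. }
  assert (Gam : forall v u, v <> m -> m <> u -> u <> v ->
            0 < area2 p y v m u /\ area2 p y v m u / ((p m - p v) * (p u - p v)) = - A v).
  { intros v u N1 N2 N3; pose proof (Hout v u N1 N2 N3) as P1; pose proof (Av v u N1 N2 N3) as P2.
    unfold y; rewrite (area2_slope x p a b v m u N1 N2 N3 Ix P1 P2); fold (A v).
    split; [apply Rmult_lt_0_compat; lra | field].
    split; intros E; [rewrite E in P1 |]; [| rewrite E in P1]; lra. }
  (* By [Flow] the comparison curve is the gradient line [I v] at time e * tau. *)
  assert (Tip : forall v u, v <> m -> m <> u -> u <> v -> forall K eta, 1 <= K -> 0 < eta ->
     exists e0, 0 < e0 /\ forall e, 0 < e < e0 -> forall z tau,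
       0 <= Im z -> 0 < size v z -> 0 < size u z -> tau <= 0 ->
       exp (PI * tau) / K <= size v z / size u z <= K * exp (PI * tau) ->
       Cmod (w e (Some z) - RtoC (p v + (p0 - p v) * exp (- A v * (e * tau))))%C <= eta).
  { intros v u N1 N2 N3 K eta HK Heta.
    destruct (Gam v u N1 N2 N3) as [G1 G2].
    destruct (Gam u v ltac:(congruence) ltac:(congruence) ltac:(congruence)) as [G3 _].
    destruct (thin_triangle_closed p y v m u K eta N1 N2 N3 (Hmid v u N1 N2 N3) G1 G3 HK Heta)
      as [e0 [P0 H]].
    exists e0; split; [exact P0 |]; intros e He z tau Hz Sv Su Ht HX.
    specialize (H e (xeps e) (fun z => w e (Some z)) He (Hxy e (proj1 He)) (Hccwe e (proj1 He))
                  (HW e (proj1 He)) z tau Hz Sv Su Ht HX).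
    rewrite G2 in H; rewrite Ep0.
    replace (- A v * (e * tau)) with (e * - A v * tau) by ring; exact H. }
  (* Otherwise the point 1 / 2 would lie in the half-discs around 0 and 1. *)
  assert (Hd2 : delta <= 1 / 2).
  { apply Rnot_lt_le; intros Hd.
    apply (Hdisj i1 i3 ltac:(discriminate) (RtoC (1 / 2))); simpl.
    split; (split; [| lra]).
    - rewrite <- RtoC_minus, Cmod_R, Rabs_left; lra.
    - rewrite <- RtoC_minus, Cmod_R, Rabs_right; lra. }
  assert (Id : 2 <= / delta).
  { replace 2 with (/ (1 / 2)) by field; apply Rinv_le_contravar; lra. }
  assert (Third : exists v u, v <> m /\ m <> u /\ u <> v).
  { exists (nxt m), (nxt (nxt m)); destruct m; repeat split; discriminate. }
  destruct Third as (v0 & u0 & M1 & M2 & M3).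
  split; [| intros i; split; [apply I0 |]].
  - apply (tends_to_0_of_uniform _ (fun e z => Cmod (w e (Some z) - RtoC p0)%C) Ci).
    + split; [simpl; unfold closed_half_plane; simpl; lra |].
      intros j Hj; destruct j; simpl in Hj.
      * destruct Hj as [Hj _]; pose proof (Rabs_Im_le (Ci - 1)%C) as B.
        replace (Im (Ci - 1)%C) with 1 in B by (simpl; ring); rewrite Rabs_R1 in B; lra.
      * destruct Hj as [_ [Hj _]]; rewrite Cmod_Ci, Rinv_1 in Hj; lra.
      * destruct Hj as [Hj _]; replace (Ci - 0)%C with Ci in Hj by ring; rewrite Cmod_Ci in Hj; lra.
    + intros; apply Cmod_ge_0.
    + intros eta Heta.
      (* On the thick part all sizes lie between delta and 2 / delta, so [Tip] applies with tau = 0,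
         where the comparison curve is at p0. *)
      destruct (Tip v0 u0 M1 M2 M3 (2 / (delta * delta)) eta) as [e0 [P0 H]]; [| exact Heta |].
      { replace (2 / (delta * delta)) with (2 * (/ delta * / delta)) by (field; lra).
        assert (2 * 2 <= / delta * / delta) by (apply Rmult_le_compat; lra); lra. }
      exists e0; split; [exact P0 |]; intros e He z Hz.
      destruct (thick_sizes delta z (conj Hdelta Hd2) Hz) as [Iz Sz].
      pose proof (Sz v0) as Sv; pose proof (Sz u0) as Su.
      specialize (H e He z 0 Iz ltac:(lra) ltac:(lra) (Rle_refl 0)).
      rewrite !Rmult_0_r, exp_0 in H; replace (p v0 + (p0 - p v0) * 1) with p0 in H by ring.
      apply H; rewrite Rmult_1_r; split.
      * apply Rle_trans with (delta / (2 / delta)); [apply Req_le; field; lra |].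
        apply Rmult_le_compat; try lra; [left; apply Rinv_0_lt_compat; unfold Rdiv; nra |].
        apply Rinv_le_contravar; lra.
      * apply Rle_trans with (2 / delta / delta); [| apply Req_le; field; lra].
        apply Rmult_le_compat; try lra; [left; apply Rinv_0_lt_compat; lra |].
        apply Rinv_le_contravar; lra.
  - apply (tends_to_0_of_uniform _ (fun e q =>
      Cmod (w e (Some (phi (zpt i) delta q)) - RtoC (I i (e * fst q)%R))%C) (-1, 0)).
    + unfold Theta_ext; simpl; lra.
    + intros; apply Cmod_ge_0.
    + intros eta Heta; destruct (classic (i = m)) as [-> | Ni].
      (* At the middle vertex the gradient line is constant. The ratios of the size at [m] to those
         at the tips are both within a factor 2 of the same [r], so the two tip sizes are within a
         factor 4 of each other, and tau = 0 applies again. *)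
      * destruct (Tip v0 u0 M1 M2 M3 4 eta) as [e0 [P0 H]]; [lra | exact Heta |].
        exists e0; split; [exact P0 |]; intros e He [tau sg] [Ht Hs]; simpl in Ht, Hs.
        destruct (end_sizes m v0 delta tau sg (conj Hdelta Hd2) Ht Hs M1) as (Iz & Sm & Sv & R1).
        destruct (end_sizes m u0 delta tau sg (conj Hdelta Hd2) Ht Hs ltac:(congruence))
          as (_ & _ & Su & R2).
        set (z := phi (zpt m) delta (tau, sg)) in *.
        assert (Im_const : I m (e * fst (tau, sg)) = p0).
        { simpl; rewrite (proj1 (Flow m)) by nra; rewrite I0, Ep0; ring. }
        rewrite Im_const.
        specialize (H e He z 0 Iz Sv Su (Rle_refl 0)).
        rewrite !Rmult_0_r, exp_0 in H; replace (p v0 + (p0 - p v0) * 1) with p0 in H by ring.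
        apply H; rewrite Rmult_1_r.
        set (r := delta * exp (PI * tau)) in *.
        assert (Pr : 0 < r) by (apply Rmult_lt_0_compat; [exact Hdelta | apply exp_pos]).
        assert (Eq : size v0 z / size u0 z = (size m z / size u0 z) / (size m z / size v0 z))
          by (field; lra).
        rewrite Eq; set (k1 := size m z / size v0 z) in *; set (k2 := size m z / size u0 z) in *.
        split; apply Rmult_le_reg_r with k1; try lra.
        -- replace (k2 / k1 * k1) with k2 by (field; lra); lra.
        -- replace (k2 / k1 * k1) with k2 by (field; lra); lra.
      * assert (Third : exists u, m <> u /\ u <> i).
        { destruct i, m; try contradiction;
            solve [exists i1; split; discriminate | exists i2; split; discriminate
                  | exists i3; split; discriminate]. }
        destruct Third as (u & N2 & N3).
        (* The factor 2 / delta absorbs the radius of the half-disc: delta / 2 is its inverse, and 2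
           * delta is below it. *)
        destruct (Tip i u Ni N2 N3 (2 / delta) eta) as [e0 [P0 H]];
          [unfold Rdiv; lra | exact Heta |].
        exists e0; split; [exact P0 |]; intros e He [tau sg] [Ht Hs]; simpl in Ht, Hs.
        destruct (end_sizes i u delta tau sg (conj Hdelta Hd2) Ht Hs N3) as (Iz & Si & Su & R1).
        set (z := phi (zpt i) delta (tau, sg)) in *.
        specialize (H e He z tau Iz Si Su ltac:(lra)).
        rewrite (proj1 (Flow i)) by (simpl; nra); rewrite I0; apply H.
        pose proof (exp_pos (PI * tau)) as PE; split.
        -- eapply Rle_trans; [| apply R1]; apply Req_le; field; lra.
        -- eapply Rle_trans; [apply R1 |].
           rewrite <- Rmult_assoc; apply Rmult_le_compat_r; [lra |]; unfold Rdiv; lra.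
Qed.
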